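(* For all $n\in\mathbb{N}$ and all $C\in\mathcal{C}^n$, there is an isomorphism of graded (super)algebras between the odd center $OZ(OH^n_C)$ of the odd arc algebra and the odd cohomology $OH(\mathfrak{B}_{n,n},\mathbb{Z})$ of the $(n,n)$-Springer variety. Moreover, this isomorphism is given by $$h : OH(\mathfrak{B}_{n,n},\mathbb{Z})\to OZ(OH^n_C),\qquad x_i\mapsto \sum_{a\in B^n}a_i\qquad (1\le i\le 2n),$$ where $a_i\in a(OH^n_C)a$ is the generator given by the circle component of $W(a)a$ passing through the $i$-th end point of $a$, counting from the left.
   Context: Matchings. $B^n$ is the set of crossingless matchings of $2n$ points on a horizontal line by non-crossing arcs placed below the line. For $b\in B^n$, $W(b)$ is the reflection of $b$ across the line, and $W(b)a$ is the gluing of $W(b)$ on top of $a$, a disjoint union of circles; $|W(b)a|$ is the number of circles. $W(c)bW(b)a$ denotes the disjoint union of $W(c)b$ placed on top of $W(b)a$. Odd arc algebra. For a disjoint union $S$ of circles, $V(S)$ is the free abelian group on the components of $S$, each of degree $2$, and $OF(S)=\bigwedge^*V(S)\{-|S|\}$, where $\{m\}$ shifts the degree up by $m$. Put $b(OH^n)a:=OF(W(b)a)\{n\}$ and $OH^n=\bigoplus_{a,b\in B^n}b(OH^n)a$, a $\mathbb{Z}_{\ge 0}$-graded abelian group. For $a,b,c\in B^n$, a choice $C_{cba}$ is a cobordism $W(c)bW(b)a\to W(c)a$ obtained by contracting, by one saddle each, every arc of $b$ with its mirror image in $W(b)$ (replacing the two arcs by two vertical strands), together with (i) an order in which these $n$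 saddles are performed, no arc being contracted before an arc surrounding it, and (ii) for each saddle that splits a circle into two, an orientation, i.e. an ordering $b_1\to b_2$ of the two resulting circles. $\mathcal{C}^n$ is the set of all choices $C=\{C_{cba}\mid a,b,c\in B^n\}$. $OF(C_{cba}):OF(W(c)bW(b)a)\to OF(W(c)a)$ is the composite of the maps of the saddles: a merge of $a_1,a_2$ acts by the map of exterior algebras identifying $a_1$ with $a_2$; a split of $a$ into $b_1\to b_2$ replaces each occurrence of $a$ by $b_1$ and then multiplies on the left by $(b_1-b_2)\wedge$. The product of $x\in c(OH^n)b$ and $y\in b(OH^n)a$ is $xy:=OF(C_{cba})(x\wedge y)\in c(OH^n)a$; the product $d(OH^n)c\otimes b(OH^n)a\to OH^n$ is zero if $c\neq b$. This gives a graded, unital, not necessarily associative $\mathbb{Z}$-algebra $OH^n_C$; ${}_b1_a$ denotes the unit of $\bigwedge^*V(W(b)a)$, $1_a={}_a1_a$, and the unit is $\sum_a1_a$. Odd center. For homogeneous $z\in b(OH^n)a$ the parity is $p(z)=\frac{\deg z-n+|W(b)a|}{2}\bmod 2$ (the number of exterior factors mod 2). The odd center is $OZ(OH^n_C)=\{z\in OH^n_C\mid zx=(-1)^{p(x)p(z)}xz\ \ \forall x\in OH^n_C\}$, where the condition is understood for parity-homogeneous $z$ and $x$ and extended additively. It is an associative superalgebra with superdegree the parity. Odd cohomology. $OPol_{2n}=\mathbb{Z}\langle x_1,\dots,x_{2n}\rangle/\langle x_ix_j+x_jx_i : i\ne j\rangle$, $\deg x_i=2$. For an ordered subset $S\subset\{1,\dots,2n\}$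 put $x_i^S=0$ if $i\notin S$ and $x_i^S=(-1)^{S(i)-1}x_i$ if $i\in S$, where $S(i)$ is the position of $i$ in $S$, and $\epsilon_r^S=\sum_{1\le i_1<\dots<i_r\le 2n}x_{i_1}^S\cdots x_{i_r}^S$. Let $OI_n$ be the left ideal generated by all $\epsilon^S_r$ with $k\in\{1,\dots,n\}$, $|S|=n+k$, $r\in\{n-k+1,\dots,n+k\}$ (it is two-sided). Then $OH(\mathfrak{B}_{n,n},\mathbb{Z}):=OPol_{2n}/OI_n$, with superdegree half the degree. *)

(* Defs.v *)
From HB Require Import structures.
From mathcomp Require Import all_boot all_order all_algebra.
From mathcomp Require Import boolp zify.
From mathcomp.multinomials Require Import monalg.

Set Implicit Arguments.
Unset Strict Implicit.
Unset Printing Implicit Defensive.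

Import GRing.Theory.
Local Open Scope ring_scope.
Local Open Scope quotient_scope.

(* Two-sided ideals and the quotient ring; mathcomp only provides the quotient
   of a commutative ring.  Membership is a Prop, made decidable by asbool. *)
Record ideal (R : pzRingType) := Ideal {
  ideal_prop :> R -> Prop;
  ideal0 : ideal_prop 0;
  idealB : forall x y, ideal_prop x -> ideal_prop y -> ideal_prop (x - y);
  idealMl : forall a x, ideal_prop x -> ideal_prop (a * x);
  idealMr : forall a x, ideal_prop x -> ideal_prop (x * a) }.

Definition ideal_mem (R : pzRingType) (I : ideal R) : {pred R} :=
  fun x => `[< I x >].

Lemma ideal_memE (R : pzRingType) (I : ideal R) x :
  (x \in ideal_mem I) = `[< I x >].
Proof. by []. Qed.

Lemma ideal_mem_closed (R : pzRingType) (I : ideal R) : zmod_closed (ideal_mem I).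
Proof.
split=> [|x y]; rewrite !ideal_memE; first exact/asboolP/ideal0.
by move=> /asboolP Ix /asboolP Iy; apply/asboolP/idealB.
Qed.

HB.instance Definition _ (R : pzRingType) (I : ideal R) :=
  GRing.isZmodClosed.Build R (ideal_mem I) (ideal_mem_closed I).

Definition quot_ring (R : pzRingType) (I : ideal R) := Quotient.quot (ideal_mem I).
HB.instance Definition _ (R : pzRingType) (I : ideal R) :=
  GRing.Zmodule.on (quot_ring I).
HB.instance Definition _ (R : pzRingType) (I : ideal R) :=
  EqQuotient.on (quot_ring I).

HB.lock Definition quot_proj (R : pzRingType) (I : ideal R) (x : R) : quot_ring I :=
  \pi_(quot_ring I) x.
HB.lock Definition quot_mul (R : pzRingType) (I : ideal R) (x y : quot_ring I) :
    quot_ring I :=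
  quot_proj I (repr x * repr y).
Arguments quot_mul {R I} x y.

Section QuotRing.
Variables (R : pzRingType) (I : ideal R).
Local Notation Q := (quot_ring I).

Local Notation quot_proj := (quot_proj I).

Lemma quot_projP x y : quot_proj x = quot_proj y <-> I (x - y).
Proof.
rewrite !quot_proj.unlock; split=> [/eqP|Ixy].
  by rewrite -(Quotient.idealrBE (ideal_mem I)) ideal_memE => /asboolP.
apply/eqP; rewrite -(Quotient.idealrBE (ideal_mem I)) ideal_memE.
exact/asboolP.
Qed.

Lemma quot_reprK (x : Q) : quot_proj (repr x) = x.
Proof. by rewrite quot_proj.unlock reprK. Qed.

Lemma quot_projB : zmod_morphism quot_proj.
Proof.
by move=> x y; rewrite !quot_proj.unlock; exact: (raddfB (\pi_(Quotient.quot (ideal_mem I)))).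
Qed.
HB.instance Definition _ := GRing.isZmodMorphism.Build R Q quot_proj quot_projB.

Definition quot_one : Q := quot_proj 1.

Lemma quot_projM x y : quot_proj (x * y) = quot_mul (quot_proj x) (quot_proj y).
Proof.
rewrite quot_mul.unlock; apply/quot_projP; set x' := repr _; set y' := repr _.
have Ix : I (x - x') by apply/quot_projP; rewrite quot_reprK.
have Iy : I (y - y') by apply/quot_projP; rewrite quot_reprK.
have -> : x * y - x' * y' = x * (y - y') - - ((x - x') * y').
  by rewrite mulrBr mulrBl opprK addrA subrK.
apply: idealB; first exact: idealMl.
by rewrite -mulN1r; apply: idealMl; apply: idealMr.
Qed.

Lemma quot_mulA : associative (@quot_mul R I).
Proof.
move=> x y z; rewrite -[x]quot_reprK -[y]quot_reprK -[z]quot_reprK.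
by rewrite -!quot_projM mulrA.
Qed.
Lemma quot_mul1 : left_id quot_one (@quot_mul R I).
Proof. by move=> x; rewrite -[x]quot_reprK -quot_projM mul1r. Qed.
Lemma quot_mulr1 : right_id quot_one (@quot_mul R I).
Proof. by move=> x; rewrite -[x]quot_reprK -quot_projM mulr1. Qed.
Lemma quot_mulDl : left_distributive (@quot_mul R I) +%R.
Proof.
move=> x y z; rewrite -[x]quot_reprK -[y]quot_reprK -[z]quot_reprK.
by rewrite -raddfD -!quot_projM mulrDl raddfD.
Qed.
Lemma quot_mulDr : right_distributive (@quot_mul R I) +%R.
Proof.
move=> x y z; rewrite -[x]quot_reprK -[y]quot_reprK -[z]quot_reprK.
by rewrite -raddfD -!quot_projM mulrDr raddfD.
Qed.

HB.instance Definition _ := GRing.Zmodule_isPzRing.Build Q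
  quot_mulA quot_mul1 quot_mulr1 quot_mulDl quot_mulDr.

Lemma quot_proj_monoid : monoid_morphism quot_proj.
Proof. by split=> // x y; rewrite quot_projM. Qed.
HB.instance Definition _ := GRing.isMonoidMorphism.Build R Q quot_proj
  quot_proj_monoid.
End QuotRing.

Inductive left_span (R : pzRingType) (G : R -> Prop) : R -> Prop :=
| LeftSpan0 : left_span G 0
| LeftSpanD x y : left_span G x -> left_span G y -> left_span G (x + y)
| LeftSpanM a g : G g -> left_span G (a * g).

Inductive two_sided_span (R : pzRingType) (G : R -> Prop) : R -> Prop :=
| TwoSpan0 : two_sided_span G 0
| TwoSpanD x y : two_sided_span G x -> two_sided_span G y ->
    two_sided_span G (x + y)
| TwoSpanM a g b : G g -> two_sided_span G (a * g * b).

Section Spans.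
Variables (R : pzRingType) (G : R -> Prop).

Lemma left_spanMl a x : left_span G x -> left_span G (a * x).
Proof.
elim=> [|{}x y _ IHx _ IHy|b g Gg].
- by rewrite mulr0; apply: LeftSpan0.
- by rewrite mulrDr; apply: LeftSpanD.
- by rewrite mulrA; apply: LeftSpanM.
Qed.

Lemma left_spanB x y : left_span G x -> left_span G y -> left_span G (x - y).
Proof. by move=> Gx Gy; apply: LeftSpanD => //; rewrite -mulN1r; apply: left_spanMl. Qed.

Lemma two_spanMl a x : two_sided_span G x -> two_sided_span G (a * x).
Proof.
elim=> [|{}x y _ IHx _ IHy|b g c Gg].
- by rewrite mulr0; apply: TwoSpan0.
- by rewrite mulrDr; apply: TwoSpanD.
- by rewrite !mulrA; apply: TwoSpanM.
Qed.

Lemma two_spanMr a x : two_sided_span G x -> two_sided_span G (x * a).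
Proof.
elim=> [|{}x y _ IHx _ IHy|b g c Gg].
- by rewrite mul0r; apply: TwoSpan0.
- by rewrite mulrDl; apply: TwoSpanD.
- by rewrite -mulrA; apply: TwoSpanM.
Qed.

Lemma two_spanB x y :
  two_sided_span G x -> two_sided_span G y -> two_sided_span G (x - y).
Proof. by move=> Gx Gy; apply: TwoSpanD => //; rewrite -mulN1r; apply: two_spanMl. Qed.

Definition ideal_gen : ideal R :=
  Ideal (TwoSpan0 G) two_spanB two_spanMl two_spanMr.
End Spans.

(* Z<x_1, ..., x_m>: [{fmonom 'I_m}] is the free monoid of words. *)
Notation free_alg m := {malg int[{fmonom 'I_m}]}.
Definition free_var (m : nat) (i : 'I_m) : free_alg m := << fmu i >>.

Definition opol_rel (m : nat) (r : free_alg m) : Prop :=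
  exists i j : 'I_m, i != j /\
    r = free_var i * free_var j + free_var j * free_var i.

Definition OPol (m : nat) := quot_ring (ideal_gen (@opol_rel m)).
HB.instance Definition _ m := GRing.PzRing.on (OPol m).
Definition opol_proj (m : nat) : free_alg m -> OPol m :=
  quot_proj (ideal_gen (@opol_rel m)).
HB.instance Definition _ m := GRing.RMorphism.on (@opol_proj m).
Definition opol_var (m : nat) (i : 'I_m) : OPol m := opol_proj (free_var i).

Section OddElem.
Variables (R : pzRingType) (m : nat) (x : 'I_m -> R).
Implicit Types (S A : {set 'I_m}).

(* The position of i in S is #|[set j in S | j < i]| + 1: subsets carry the
   order induced from {1, ..., m}, and indices are 0-based here. *)
Definition signed_var S (i : 'I_m) : R :=
  if i \in S then (-1) ^+ #|[set j in S | (j < i)%N]| * x i else 0.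

(* [enum A] lists A in increasing order, which fixes the order of the factors. *)
Definition odd_elem (r : nat) S : R :=
  \sum_(A : {set 'I_m} | #|A| == r) \prod_(i <- enum A) signed_var S i.
End OddElem.

Definition springer_gen (n : nat) (f : OPol n.*2) : Prop :=
  exists (k : nat) (S : {set 'I_n.*2}) (r : nat),
    [/\ (1 <= k <= n)%N, #|S| = (n + k)%N, (n - k + 1 <= r <= n + k)%N
      & f = odd_elem (@opol_var n.*2) r S].

Definition OI (n : nat) : OPol n.*2 -> Prop := left_span (@springer_gen n).

Lemma opol_var_anti m (i j : 'I_m) :
  i != j -> opol_var i * opol_var j = - (opol_var j * opol_var i).
Proof.
move=> nij; apply/eqP; rewrite -subr_eq0 opprK /opol_var -!rmorphM -rmorphD.
apply/eqP; rewrite -(rmorph0 (@opol_proj m)); apply/quot_projP; rewrite subr0.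
have: opol_rel (free_var i * free_var j + free_var j * free_var i).
  by exists i, j.
by move/(TwoSpanM 1 1); rewrite mul1r mulr1.
Qed.

(* The left ideal OI_n is two-sided, so that the quotient is a ring. *)
Section OITwoSided.
Variables (R : pzRingType) (m : nat) (X : 'I_m -> R).
Hypothesis Xanti : forall i j, i != j -> X i * X j = - (X j * X i).
Implicit Types (S A : {set 'I_m}) (i j : 'I_m).
Local Notation svar := (signed_var X).
Local Notation oelem := (odd_elem X).

Lemma signM (b : nat) (x y : R) : x * ((-1) ^+ b * y) = (-1) ^+ b * (x * y).
Proof. by rewrite !mulrA (commr_sign x b). Qed.

Lemma signed_var_var S j i :
  svar S j * X i = (-1) ^+ (j != i) * (X i * svar S j).
Proof.
rewrite /signed_var; case: (j \in S); last by rewrite mul0r !mulr0.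
case: eqVneq => [->|ji]; first by rewrite mul1r signM mulrA.
by rewrite signM -mulrA (Xanti ji) mulN1r mulrN.
Qed.

Lemma prod_var S i (l : seq 'I_m) :
  (\prod_(j <- l) svar S j) * X i =
  (-1) ^+ count (fun j => j != i) l * (X i * \prod_(j <- l) svar S j).
Proof.
elim: l => [|j l IH]; first by rewrite !big_nil !mul1r mulr1.
rewrite !big_cons -mulrA IH /= signM (mulrA (svar S j)) signed_var_var.
by rewrite addnC exprD -!mulrA.
Qed.

Definition mon S A : R := \prod_(j <- enum A) svar S j.

Lemma mon_var S A i :
  mon S A * X i = (-1) ^+ (#|A| + (i \in A)) * (X i * mon S A).
Proof.
rewrite /mon prod_var; congr (_ * _).
have := count_predC (pred1 i) (enum A); rewrite -cardE.
rewrite (count_uniq_mem i (enum_uniq _)) mem_enum => <-.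
by rewrite addnAC addnn exprD -[(-1) ^+ _.*2]signr_odd odd_double mul1r.
Qed.

Lemma mon_notsub S A j : j \in A -> j \notin S -> mon S A = 0.
Proof.
rewrite -mem_enum => jA jS; rewrite /mon; elim: (enum A) jA => // k l IH.
rewrite big_cons in_cons => /orP[/eqP <-|/IH->]; last by rewrite mulr0.
by rewrite /signed_var (negbTE jS) mul0r.
Qed.

Lemma odd_elemE r S : oelem r S = \sum_(A : {set 'I_m} | #|A| == r) mon S A.
Proof. by []. Qed.

Lemma odd_elem_big r S : (#|S| < r)%N -> oelem r S = 0.
Proof.
move=> rS; rewrite odd_elemE big1 // => A /eqP cA.
have /subsetPn[j jA jS] : ~~ (A \subset S).
  by apply: contraL rS => /subset_leq_card; rewrite cA -leqNgt.
exact: mon_notsub jA jS.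
Qed.

Lemma signed_var_anti S i j : i != j ->
  svar S i * svar S j = - (svar S j * svar S i).
Proof.
move=> ij; rewrite {1 4}/signed_var; case: (i \in S); last by rewrite mul0r mulr0 oppr0.
by rewrite signM signed_var_var eq_sym ij mulN1r mulrN opprK -mulrA.
Qed.

Lemma insert_seq S i (B : {set 'I_m}) (l : seq 'I_m) :
  sorted (fun a b : 'I_m => a < b)%N l -> i \in l -> i \notin B ->
  svar S i * \prod_(j <- l | j \in B) svar S j =
  (-1) ^+ count (fun j : 'I_m => (j \in B) && (j < i)%N) l *
  \prod_(j <- l | j \in i |: B) svar S j.
Proof.
move=> + + iB; elim: l => // k l IH /= sl.
have tr : transitive (fun a b : 'I_m => a < b)%N by move=> ? ? ?; exact: ltn_trans.
have := sl; rewrite path_sortedE // => /andP[/allP kl sl'].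
rewrite in_cons !big_cons; case: eqVneq => [ik _|ik /= il].
  subst k.
  rewrite setU11 (negbTE iB) /= (eq_in_count (a2 := pred0)) ?count_pred0 ?mul1r.
    congr (_ * _); rewrite big_seq_cond [RHS]big_seq_cond; apply: eq_bigl => j; rewrite !inE.
    by case jl: (j \in l) => //=; case: eqVneq => // ji; have /= := kl _ jl; rewrite ji ltnn.
  by move=> j /kl /=; rewrite ltnNge leq_eqVlt negb_or => /andP[_ /negbTE->]; rewrite andbF.
have ki : (k < i)%N by apply: kl.
rewrite !inE eq_sym (negbTE ik) /= ki andbT; case: (k \in B) => /=; last exact: IH.
rewrite mulrA signed_var_anti // mulNr -mulrA IH //.
by rewrite signM exprS mulN1r mulNr.
Qed.

Lemma sorted_enum_ord : sorted (fun a b : 'I_m => a < b)%N (enum 'I_m).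
Proof.
have := iota_ltn_sorted 0 m; rewrite -val_enum_ord.
by rewrite sorted_map.
Qed.

Lemma monE S A : mon S A = \prod_(j <- enum 'I_m | j \in A) svar S j.
Proof. by rewrite /mon {1}/enum_mem big_filter enumT. Qed.

Lemma mon_insert S i (B : {set 'I_m}) : i \notin B ->
  svar S i * mon S B =
  (-1) ^+ #|[set j in B | (j < i)%N]| * mon S (i |: B).
Proof.
move=> iB; rewrite !monE insert_seq ?sorted_enum_ord ?mem_enum //.
congr ((-1) ^+ _ * _); rewrite -size_filter cardE; congr size.
rewrite [RHS]/enum_mem -enumT; by apply: eq_filter => j; rewrite [RHS]inE.
Qed.

Definition sign_sum S r (i : 'I_m) (P : pred {set 'I_m}) : R :=
  \sum_(A : {set 'I_m} | (#|A| == r) && P A)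
    (-1) ^+ #|[set j in A | (j < i)%N]| * mon S A.

Lemma sign_sum_split S r i (P : pred {set 'I_m}) :
  sign_sum S r i predT = sign_sum S r i P + sign_sum S r i (predC P).
Proof.
rewrite /sign_sum (bigID P) /=; congr (_ + _); apply: eq_bigl => A;
by rewrite andbT.
Qed.

Lemma sign_sum_notin S r i : i \in S ->
  sign_sum S r i (fun A => i \notin A) = (-1) ^+ r * oelem r (S :\ i).
Proof.
move=> iS; rewrite odd_elemE (bigID (fun A : {set 'I_m} => i \in A)) /=.
rewrite [X in X + _]big1 ?add0r; last first.
  by move=> A /andP[_ iA]; apply: (mon_notsub iA); rewrite !inE eqxx.
rewrite /sign_sum mulr_sumr; apply: eq_bigr => A /andP[/eqP cA iA].
have -> : mon (S :\ i) A = (-1) ^+ #|[set j in A | (i < j)%N]| * mon S A.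
  rewrite /mon; have <- : count (fun j : 'I_m => (i < j)%N) (enum A)
            = #|[set j in A | (i < j)%N]|.
    rewrite -size_filter cardE /enum_mem -filter_predI; congr size.
    by apply: eq_filter => j; rewrite [RHS]inE /= andbC.
  have : i \notin enum A by rewrite mem_enum.
  elim: (enum A) => [|j l IH]; first by rewrite !big_nil mul1r.
  rewrite in_cons negb_or => /andP[ij /IH{}IH]; rewrite !big_cons {}IH /= signM.
  rewrite [svar S j]/signed_var [svar _ j]/signed_var.
  rewrite in_setD1 eq_sym ij /=; case: ifP => jS; last by rewrite !mul0r !mulr0.
  rewrite addnC exprD -!mulrA; congr (_ * _); rewrite !mulrA -exprD; congr (_ * _ * _).
  case: ltnP => ij'; rewrite ?(add1n, add0n).
    rewrite (cardsD1 i [set k in S | (k < j)%N]) inE iS ij' /= add1n !exprS mulrA mulrNN !mul1r; congr (_ ^+ #|pred_of_set _|).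
    by apply/setP=> k; rewrite !inE andbA.
  congr (_ ^+ #|pred_of_set _|); apply/setP=> k; rewrite !inE.
  by case: eqVneq => //= ->; rewrite ltnNge ij' andbF.
rewrite mulrA -exprD -cA -(cardsID [set j : 'I_m | (j < i)%N] A).
have -> : A :&: [set j : 'I_m | (j < i)%N] = [set j in A | (j < i)%N].
  by apply/setP=> k; rewrite !inE.
have -> : A :\: [set j : 'I_m | (j < i)%N] = [set j in A | (i < j)%N].
  apply/setP=> k; rewrite !inE -leqNgt leq_eqVlt.
  case: eqVneq => [ik|_] /=; last by rewrite andbC.
  by move: iA; rewrite (ord_inj ik) => /negbTE->.
by rewrite -addnA addnn exprD -[(-1) ^+ _.*2]signr_odd odd_double mulr1.
Qed.

Variable G : R -> Prop.
Local Notation J := (left_span G).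

Lemma left_span_sign b x : J x -> J ((-1) ^+ b * x).
Proof. exact: left_spanMl. Qed.

Lemma sign_sum_in S r i : J (oelem r S) ->
  (forall j, j \in S -> J (oelem r (S :\ j))) ->
  J (sign_sum S r i predT).
Proof.
move=> JS JSj; case: i => t; elim: t => [|t IH] tm.
  suff -> : sign_sum S r (Ordinal tm) predT = oelem r S by [].
  rewrite odd_elemE; apply: eq_big => [A|A _]; first by rewrite andbT.
  rewrite (_ : [set _ in A | _] = set0) ?cards0 ?mul1r //.
  by apply/setP=> j; rewrite !inE andbF.
have {}IH := IH (ltnW tm); set i := Ordinal (ltnW tm) in IH.
set i' := Ordinal tm.
have lt_i' (j : 'I_m) : (j < i')%N = (j == i) || (j < i)%N.
  by rewrite ltnS leq_eqVlt.
have notin : sign_sum S r i' (fun A => i \notin A) = sign_sum S r i (fun A => i \notin A).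
  apply: eq_bigr => A /andP[_ iA]; congr (_ ^+ #|pred_of_set _| * _).
  apply/setP=> j; rewrite !inE lt_i'.
  by case: eqVneq => //= ->; rewrite (negbTE iA).
have isin : sign_sum S r i' (predC (fun A => i \notin A))
           = - sign_sum S r i (predC (fun A => i \notin A)).
  rewrite /sign_sum -sumrN; apply: eq_bigr => A /andP[_ /=]; rewrite negbK => iA.
  rewrite (cardsD1 i) inE iA lt_i' eqxx /= add1n exprS mulN1r mulNr.
  congr (- (_ ^+ #|pred_of_set _| * _)).
  apply/setP=> j; rewrite !inE lt_i'.
  by case: eqVneq => //= ->; rewrite ltnn andbF.
have [iS|iS] := boolP (i \in S).
  rewrite (sign_sum_split _ _ _ (fun A => i \notin A)) notin isin.
  have -> : forall a b : R, a - b = a + a - (a + b).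
    by move=> a b; rewrite opprD addrA addrK.
  rewrite -sign_sum_split sign_sum_notin //.
  by apply: left_spanB => //; apply: LeftSpanD; apply/left_span_sign/JSj.
suff -> : sign_sum S r i' predT = sign_sum S r i predT by [].
rewrite !(sign_sum_split _ _ _ (fun A => i \notin A)) notin isin.
rewrite /sign_sum [X in _ - X]big1 ?[X in _ = _ + X]big1 ?subr0 ?addr0 //.
all: by move=> A /andP[_ /=]; rewrite negbK => iA; rewrite (mon_notsub iA iS) mulr0.
Qed.

Lemma odd_elem_mulr S r i : J (oelem r S) -> J (oelem r.+1 S) ->
  (forall j, j \in S -> J (oelem r.+1 (S :\ j))) ->
  J (oelem r S * X i).
Proof.
move=> Jr JS JSj.
pose F := \sum_(A : {set 'I_m} | (#|A| == r) && (i \notin A)) mon S A.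
have -> : oelem r S * X i =
    (-1) ^+ r * (X i * (F + F) - X i * oelem r S).
  rewrite -mulrBr [in RHS]odd_elemE.
  rewrite (bigID (fun A : {set 'I_m} => i \in A)) /= -/F opprD addrACA subrr addr0.
  rewrite odd_elemE mulr_suml (bigID (fun A : {set 'I_m} => i \in A)) /=.
  rewrite addrC !mulrDr; congr (_ + _).
    by rewrite /F !mulr_sumr; apply: eq_bigr => A /andP[/eqP cA /negbTE iA];
       rewrite mon_var cA iA addn0.
  rewrite -sumrN !mulr_sumr; apply: eq_bigr => A /andP[/eqP cA iA].
  by rewrite mon_var cA iA addn1 exprS mulN1r mulNr !mulrN.
apply: left_span_sign; apply: left_spanB; last exact: left_spanMl.
suff JF : J (X i * F) by rewrite mulrDr; apply: LeftSpanD.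
have [iS|iS] := boolP (i \in S); last first.
  suff -> : F = oelem r S by apply: left_spanMl.
  rewrite odd_elemE (bigID (fun A : {set 'I_m} => i \in A)) /= -/F big1 ?add0r //.
  by move=> A /andP[_ iA]; apply: mon_notsub iS.
have JiF : J (svar S i * F).
  suff -> : svar S i * F = sign_sum S r.+1 i (predC (fun A => i \notin A)).
    have /(canLR (addKr _)) <- := sign_sum_split S r.+1 i (fun A => i \notin A).
    rewrite addrC; apply: left_spanB; first exact: sign_sum_in.
    by rewrite sign_sum_notin //; apply/left_span_sign/JSj.
  rewrite mulr_sumr /sign_sum [RHS](reindex_onto (fun A => i |: A) (fun A => A :\ i)) /=.
    apply: eq_big => [A|A /andP[_ iA]]; last first.
      rewrite mon_insert //; congr (_ ^+ #|pred_of_set _| * _).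
      by apply/setP=> j; rewrite !inE; case: eqVneq => //= ->; rewrite ltnn andbF.
    rewrite negbK setU11 andbT; have [iA|iA] := boolP (i \in A).
      rewrite andbF; apply/esym/negbTE; rewrite negb_and; apply/orP; right.
      by apply: contraL iA => /eqP <-; rewrite !inE eqxx.
    by rewrite cardsU1 iA setU1K // eqxx andbT.
  by move=> A /andP[_]; rewrite /= negbK => /setD1K.
have -> : X i * F = (-1) ^+ #|[set j in S | (j < i)%N]| * (svar S i * F).
  by rewrite /signed_var iS !mulrA -exprD addnn -signr_odd odd_double mul1r.
exact: left_span_sign.
Qed.
End OITwoSided.

Lemma malgC_int (K : monomType) (c : int) : malgC c = c%:~R :> {malg int[K]}.
Proof. by rewrite -[c in LHS]intz rmorph_int. Qed.

Lemma word_nil m (c : int) : << c *g FMonom [::] >> = c%:~R :> free_alg m.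
Proof. by rewrite -fmE; exact: malgC_int. Qed.

Lemma word_cons m (c : int) (i : 'I_m) (s : seq 'I_m) :
  << c *g FMonom (i :: s) >> = free_var i * << c *g FMonom s >> :> free_alg m.
Proof. rewrite malgM_def fgmulUU mul1r; congr (<< c *g _ >>).
by rewrite -[RHS]/(fmmul _ _) fmmulE /fmu fmE. Qed.

Section OIIdeal.
Variable n : nat.

Lemma OI_gen_var (f : OPol n.*2) i : springer_gen f -> OI (f * opol_var i).
Proof.
move=> [k [S [r [/andP[k1 kn] cS /andP[r1 r2] ->]]]].
apply: odd_elem_mulr; first exact: opol_var_anti.
- by rewrite -[odd_elem _ _ _]mul1r; apply: LeftSpanM; exists k, S, r; rewrite k1 kn r1 r2.
- have [rS|rS] := leqP r.+1 (n + k); last by rewrite odd_elem_big ?cS //; apply: LeftSpan0.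
  rewrite -[odd_elem _ _ _]mul1r; apply: LeftSpanM; exists k, S, r.+1.
  by rewrite k1 kn rS (leq_trans r1).
move=> j jS; have cSj : #|S :\ j| = (n + k.-1)%N.
  move: cS; rewrite (cardsD1 j) jS add1n; move: #|_| => c; lia.
have [rS|rS] := leqP r.+1 (n + k.-1); last first.
  by rewrite odd_elem_big ?cSj //; apply: LeftSpan0.
rewrite -[odd_elem _ _ _]mul1r; apply: LeftSpanM; exists k.-1, (S :\ j), r.+1.
by split=> //; lia.
Qed.

Lemma OI_var (x : OPol n.*2) i : OI x -> OI (x * opol_var i).
Proof.
elim=> [|{}x y _ IHx _ IHy|a g Gg].
- by rewrite mul0r; apply: LeftSpan0.
- by rewrite mulrDl; apply: LeftSpanD.
- by rewrite -mulrA; exact: left_spanMl (OI_gen_var i Gg).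
Qed.

Lemma OI_mulr (a x : OPol n.*2) : OI x -> OI (x * a).
Proof.
rewrite -[a]quot_reprK; move: (repr a) => p {a} Ix.
rewrite (monalgE p) raddf_sum mulr_sumr /=.
elim/big_ind: _ => [|y z Iy Iz|[s] _]; first exact: LeftSpan0.
  exact: LeftSpanD.
elim: s x Ix (p@_ _) => [|i s IH] x Ix c.
  by rewrite word_nil rmorph_int mulrzr -mulrzl; apply: left_spanMl.
rewrite word_cons rmorphM mulrA; exact: IH (OI_var i Ix) c.
Qed.

Definition springer_ideal : ideal (OPol n.*2) :=
  Ideal (LeftSpan0 _) (@left_spanB _ _) (@left_spanMl _ _) OI_mulr.
End OIIdeal.

Definition OHB (n : nat) := quot_ring (springer_ideal n).
HB.instance Definition _ n := GRing.PzRing.on (OHB n).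
Definition ohb_proj (n : nat) : OPol n.*2 -> OHB n :=
  quot_proj (springer_ideal n).
HB.instance Definition _ n := GRing.RMorphism.on (@ohb_proj n).
Definition ohb_var (n : nat) (i : 'I_n.*2) : OHB n := ohb_proj (opol_var i).

Definition ohb_degree (n d : nat) (x : OHB n) : Prop :=
  exists f : free_alg n.*2, x = ohb_proj (opol_proj f) /\
    forall w, f@_w != 0 -> (fdeg w).*2 = d.

Definition ohb_parity (n : nat) (p : bool) (x : OHB n) : Prop :=
  exists f : free_alg n.*2, x = ohb_proj (opol_proj f) /\
    forall w, f@_w != 0 -> odd (fdeg w) = p.

(* The exterior algebra of the free abelian group on T, in the basis of the
   wedges of subsets A of T with factors in the order of [enum_rank]; see
   [ext_delta_mul], [ext_gen_sqr] and [ext_gen_anti].  The alias avoids the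
   pointwise ring structure on finite functions. *)
Definition ext (T : finType) := {ffun {set T} -> int}.
HB.instance Definition _ (T : finType) := GRing.Zmodule.on (ext T).

Section Exterior.
Variable T : finType.
Implicit Types (A B C : {set T}) (x y z : ext T).

Definition inversions A B : {set T * T} :=
  [set p in setX A B | (enum_rank p.2 < enum_rank p.1)%N].

Definition wedge_sign A B : int :=
  if [disjoint A & B] then (-1) ^+ #|inversions A B| else 0.

Definition ext_delta A : ext T := [ffun B => (B == A)%:R].
Definition ext_gen (t : T) : ext T := ext_delta [set t].
Definition ext_one : ext T := ext_delta set0.
Definition ext_mul x y : ext T :=
  [ffun C => \sum_(A : {set T}) \sum_(B : {set T} | A :|: B == C)
               wedge_sign A B * (x A * y B)].

Lemma inversionsUl A B C : [disjoint A & B] ->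
  #|inversions (A :|: B) C| = (#|inversions A C| + #|inversions B C|)%N.
Proof.
move=> dAB; rewrite -cardsUI [X in (_ + X)%N](_ : _ = 0%N) ?addn0.
  by congr #|pred_of_set _|; apply/setP=> p; rewrite !inE -!andb_orl.
apply: eq_card0 => p; rewrite !inE; apply/negP => /andP[/andP[/andP[pA _] _]].
by rewrite (disjointFr dAB).
Qed.

Lemma inversionsUr A B C : [disjoint B & C] ->
  #|inversions A (B :|: C)| = (#|inversions A B| + #|inversions A C|)%N.
Proof.
move=> dBC; rewrite -cardsUI [X in (_ + X)%N](_ : _ = 0%N) ?addn0.
  by congr #|pred_of_set _|; apply/setP=> p; rewrite !inE -andb_orl -andb_orr.
apply: eq_card0 => p; rewrite !inE; apply/negP => /andP[/andP[/andP[_ pB] _]].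
by rewrite (disjointFr dBC) // andbF.
Qed.

Lemma disjointUl A B C :
  [disjoint A :|: B & C] = [disjoint A & C] && [disjoint B & C].
Proof. by rewrite -!setI_eq0 setIUl setU_eq0. Qed.

Lemma disjointUr A B C :
  [disjoint A & B :|: C] = [disjoint A & B] && [disjoint A & C].
Proof. by rewrite -!setI_eq0 setIUr setU_eq0. Qed.

Lemma wedge_sign_cocycle A B C :
  wedge_sign A B * wedge_sign (A :|: B) C = wedge_sign A (B :|: C) * wedge_sign B C.
Proof.
rewrite /wedge_sign disjointUl disjointUr.
case dAB: [disjoint A & B]; last by rewrite !mul0r.
case dAC: [disjoint A & C]; last by rewrite mulr0 mul0r.
case dBC: [disjoint B & C]; last by rewrite !mulr0.
by rewrite /= inversionsUl // inversionsUr // -!exprD addnA.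
Qed.

Lemma wedge_sign0l A : wedge_sign set0 A = 1.
Proof.
rewrite /wedge_sign -setI_eq0 set0I eqxx (_ : inversions _ _ = set0) ?cards0 //.
by apply/setP=> p; rewrite !inE.
Qed.

Lemma wedge_sign0r A : wedge_sign A set0 = 1.
Proof.
rewrite /wedge_sign -setI_eq0 setI0 eqxx (_ : inversions _ _ = set0) ?cards0 //.
by apply/setP=> p; rewrite !inE andbF.
Qed.

Lemma ext_mulE x y C : ext_mul x y C =
  \sum_(A : {set T}) \sum_(B : {set T})
    (A :|: B == C)%:R * (wedge_sign A B * (x A * y B)).
Proof.
rewrite ffunE; apply: eq_bigr => A _; rewrite big_mkcond; apply: eq_bigr => B _.
by case: eqP; rewrite (mul1r, mul0r).
Qed.

Lemma ext_mulA : associative ext_mul.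
Proof.
move=> x y z; apply/ffunP => D; rewrite !ext_mulE.
pose F A B C := (A :|: B :|: C == D)%:R * (wedge_sign A B * wedge_sign (A :|: B) C *
   (x A * y B * z C)) : int.
transitivity (\sum_A \sum_B \sum_C F A B C).
  apply: eq_bigr => A _.
  transitivity (\sum_E \sum_B \sum_C (B :|: C == E)%:R * F A B C).
    apply: eq_bigr => E _; rewrite ext_mulE !mulr_sumr; apply: eq_bigr => B _.
    rewrite !mulr_sumr; apply: eq_bigr => C _; rewrite /F wedge_sign_cocycle.
    by case: (B :|: C =P E) => [<-|_]; rewrite ?mul0r ?mulr0 // !mul1r setUA; lia.
  rewrite exchange_big; apply: eq_bigr => B _; rewrite exchange_big.
  apply: eq_bigr => C _; rewrite (bigD1 (B :|: C)) //= eqxx mul1r big1 ?addr0 // => E.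
  by rewrite eq_sym => /negbTE ->; rewrite mul0r.
transitivity (\sum_E \sum_A \sum_B \sum_C (A :|: B == E)%:R * F A B C).
  apply/esym; rewrite exchange_big; apply: eq_bigr => A _; rewrite exchange_big.
  apply: eq_bigr => B _.
  rewrite exchange_big; apply: eq_bigr => C _.
  rewrite (bigD1 (A :|: B)) //= eqxx mul1r big1 ?addr0 // => E.
  by rewrite eq_sym => /negbTE ->; rewrite mul0r.
apply: eq_bigr => E _.
under eq_bigr => A _ do rewrite exchange_big /=.
rewrite exchange_big; apply: eq_bigr => C _ /=.
rewrite ext_mulE !mulr_suml !mulr_sumr; apply: eq_bigr => A _.
rewrite !mulr_suml !mulr_sumr; apply: eq_bigr => B _; rewrite /F.
by case: (A :|: B =P E) => [<-|_]; rewrite ?mul0r ?mulr0 // !mul1r; lia.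
Qed.

Lemma ext_mul1 : left_id ext_one ext_mul.
Proof.
move=> x; apply/ffunP=> C; rewrite ext_mulE (bigD1 set0) //=.
rewrite [X in _ + X]big1 ?addr0; last first.
  by move=> A /negbTE A0; apply: big1 => B _; rewrite ffunE A0 mul0r !mulr0.
rewrite (bigD1 C) //= big1 ?addr0; last first.
  by move=> B /negbTE BC; rewrite set0U BC mul0r.
by rewrite ffunE set0U !eqxx wedge_sign0l !mul1r.
Qed.

Lemma ext_mulr1 : right_id ext_one ext_mul.
Proof.
move=> x; apply/ffunP=> C; rewrite ext_mulE exchange_big (bigD1 set0) //=.
rewrite [X in _ + X]big1 ?addr0; last first.
  by move=> A /negbTE A0; apply: big1 => B _; rewrite ffunE A0 !mulr0.
rewrite (bigD1 C) //= big1 ?addr0; last first.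
  by move=> B /negbTE BC; rewrite setU0 BC mul0r.
by rewrite ffunE setU0 !eqxx wedge_sign0r !mul1r mulr1.
Qed.

Lemma ext_mulDl : left_distributive ext_mul +%R.
Proof.
move=> x y z; apply/ffunP=> C; rewrite [RHS]ffunE !ext_mulE -big_split.
apply: eq_bigr => A _; rewrite -big_split; apply: eq_bigr => B _ /=.
by rewrite ffunE mulrDl mulrDr mulrDr.
Qed.

Lemma ext_mulDr : right_distributive ext_mul +%R.
Proof.
move=> x y z; apply/ffunP=> C; rewrite [RHS]ffunE !ext_mulE -big_split.
apply: eq_bigr => A _; rewrite -big_split; apply: eq_bigr => B _ /=.
by rewrite ffunE !mulrDr.
Qed.

HB.instance Definition _ := GRing.Zmodule_isPzRing.Build (ext T)
  ext_mulA ext_mul1 ext_mulr1 ext_mulDl ext_mulDr.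

Lemma ext_delta_mul A B :
  ext_delta A * ext_delta B = ext_delta (A :|: B) *~ wedge_sign A B.
Proof.
apply/ffunP=> C; rewrite [LHS]ext_mulE (bigD1 A) //= [X in _ + X]big1 ?addr0; last first.
  by move=> E /negbTE nE; apply: big1 => F _; rewrite ffunE nE mul0r !mulr0.
rewrite (bigD1 B) //= big1 ?addr0; last first.
  by move=> E /negbTE nE; rewrite [ext_delta B E]ffunE nE !mulr0.
rewrite !ffunE !eqxx !mulr1 ffunMzE ffunE eq_sym.
by case: eqP => _; rewrite ?mul1r ?mul0r ?mul0rz // intz.
Qed.

Lemma ext_gen_sqr t : ext_gen t * ext_gen t = 0.
Proof.
rewrite ext_delta_mul /wedge_sign.
by rewrite -setI_eq0 setIid -cards_eq0 cards1 mulr0z.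
Qed.

Lemma ext_gen_anti t u : ext_gen t * ext_gen u = - (ext_gen u * ext_gen t).
Proof.
have [->|tu] := eqVneq t u; first by rewrite ext_gen_sqr oppr0.
have inv1 a b : #|inversions [set a] [set b]| = (enum_rank b < enum_rank a)%N.
  have [ba|ba] := boolP (enum_rank b < enum_rank a)%N.
    apply/eqP/cards1P; exists (a, b); apply/setP=> p; rewrite !inE -pair_eqE.
    by case: p => p q /=; case: eqP => //= ->; case: eqP => //= ->.
  apply: eq_card0 => p; rewrite !inE; apply/negP=> /andP[/andP[/eqP -> /eqP ->]].
  exact/negP.
rewrite !ext_delta_mul setUC -mulrNz; congr (_ *~ _).
rewrite /wedge_sign !disjoints1 !inE (eq_sym u t) tu !inv1.
have : (enum_rank t != enum_rank u :> nat).
  by apply: contra tu => /eqP/ord_inj/enum_rank_inj ->.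
by case: ltngtP.
Qed.
End Exterior.

(* The morphism of exterior algebras sending the generator t to f t. *)
Definition ext_map (T U : finType) (f : T -> U) (x : ext T) : ext U :=
  \sum_(A : {set T}) (\prod_(t <- enum A) ext_gen (f t)) *~ x A.

Definition crossingless (m : nat) (f : {ffun 'I_m -> 'I_m}) : bool :=
  [forall i, (f i != i) && (f (f i) == i)] &&
  [forall i : 'I_m, forall j : 'I_m, ~~ [&& i < j, j < f i & f i < f j]%N].

Record matching (n : nat) := Matching {
  partner :> {ffun 'I_n.*2 -> 'I_n.*2};
  _ : crossingless partner }.
HB.instance Definition _ n := [isSub for @partner n].
HB.instance Definition _ n := [Finite of matching n by <:].

(* A circle is the set of marked points it passes through; [e] joins two marked
   points when an arc or a strand does, and is symmetric in all uses below. *)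
Definition circles (P : finType) (e : rel P) : finType :=
  {A : {set P} | [exists x, A == [set y | connect e x y]]}.

Lemma component_circle (P : finType) (e : rel P) (x : P) :
  [exists z, [set y | connect e x y] == [set y | connect e z y]].
Proof. by apply/existsP; exists x. Qed.

Definition circle_of (P : finType) (e : rel P) (x : P) : circles e :=
  Sub [set y | connect e x y] (component_circle e x).

Definition circle_pt (P : finType) (e : rel P) (A : circles e) : P :=
  xchoose (existsP (valP A)).

Definition circle_map (P P' : finType) (e : rel P) (e' : rel P') (f : P -> P')
  (A : circles e) : circles e' := circle_of e' (f (circle_pt A)).

(* The 1-manifold W(b)a. *)
Definition glue (n : nat) (b a : matching n) : rel 'I_n.*2 :=
  fun i j => (j == a i) || (j == b i).

Section Cobordism.
Variables (n : nat) (c b a : matching n).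
Local Notation pt := 'I_n.*2.

(* W(c)bW(b)a after the arcs of b with endpoints in D have been contracted.
   The point (false, i) lies on the lower line, (true, i) on the upper one; the
   outer arcs are those of a and W(c), and the inner ones are those of W(b) and
   b, or vertical strands at the points of D. *)
Definition stage (D : {set pt}) : rel (bool * pt) := fun p q =>
  (q == (p.1, (if p.1 then c else a) p.2)) ||
  (q == if p.2 \in D then (~~ p.1, p.2) else (p.1, b p.2)).

(* The saddle at the arc of b with left endpoint i.  It merges when its two arcs
   lie on distinct circles.  Otherwise it splits, and the two vertical strands
   lie on the two resulting circles: o = true is the orientation from the
   circle through the left strand to that through the right one. *)
Definition saddle (D : {set pt}) (o : bool) (i : pt)
    (x : ext (circles (stage D))) :
    ext (circles (stage (i |: (b i |: D)))) :=
  let old := circle_of (stage D) in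
  let new := circle_of (stage (i |: (b i |: D))) in
  let keep (A : circles (stage D)) := new (circle_pt A) in
  if old (false, i) != old (true, i) then ext_map keep x
  else
    let b1 := new (false, if o then i else b i) in
    let b2 := new (false, if o then b i else i) in
    (ext_gen b1 - ext_gen b2) *
      ext_map (fun A => if A == old (false, i) then b1 else keep A) x.

Fixpoint saddles (o : pt -> bool) (s : seq pt) (D : {set pt}) :
    ext (circles (stage D)) -> ext (circles (glue c a)) :=
  match s with
  | [::] => ext_map (circle_map (glue c a) snd)
  | i :: s' => fun x => saddles o s' (saddle (o i) i x)
  end.

(* Arcs are named by their left endpoints; an arc must come after those that
   surround it.  The orientation is ignored at the saddles that merge. *)
Record cob_choice := CobChoice {
  saddle_order : seq pt;
  saddle_orient : pt -> bool;
  _ : perm_eq saddle_order [seq i : pt <- enum pt | (i < b i)%N];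
  _ : forall i j : pt, i \in saddle_order -> j \in saddle_order ->
        (i < j)%N -> (b j < b i)%N ->
        (index i saddle_order < index j saddle_order)%N }.

Definition cob_map (C : cob_choice) :
    ext (circles (stage set0)) -> ext (circles (glue c a)) :=
  saddles (saddle_orient C) (saddle_order C) (D := set0).

(* The element x /\ y of OF(W(c)bW(b)a). *)
Definition stack (x : ext (circles (glue c b))) (y : ext (circles (glue b a))) :
    ext (circles (stage set0)) :=
  ext_map (circle_map (stage set0) (pair true)) x *
  ext_map (circle_map (stage set0) (pair false)) y.
End Cobordism.

Definition choices (n : nat) := forall c b a : matching n, cob_choice b.

(* The component at (b, a) is b(OH^n)a. *)
Definition OH (n : nat) :=
  {dffun forall p : matching n * matching n, ext (circles (glue p.1 p.2))}.
HB.instance Definition _ n := Choice.on (OH n).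

Definition oh_comp (n : nat) (x : OH n) (b a : matching n) :
  ext (circles (glue b a)) := x (b, a).

Section OHZmod.
Variable n : nat.
Implicit Types x y z : OH n.
Definition oh_zero : OH n := [ffun p => 0].
Definition oh_opp x : OH n := [ffun p => - x p].
Definition oh_add x y : OH n := [ffun p => x p + y p].
Lemma oh_addA : associative oh_add.
Proof. by move=> x y z; apply/ffunP=> p; rewrite !ffunE addrA. Qed.
Lemma oh_addC : commutative oh_add.
Proof. by move=> x y; apply/ffunP=> p; rewrite !ffunE addrC. Qed.
Lemma oh_add0 : left_id oh_zero oh_add.
Proof. by move=> x; apply/ffunP=> p; rewrite !ffunE add0r. Qed.
Lemma oh_addN : left_inverse oh_zero oh_opp oh_add.
Proof. by move=> x; apply/ffunP=> p; rewrite !ffunE addNr. Qed.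
HB.instance Definition _ := GRing.isZmodule.Build (OH n)
  oh_addA oh_addC oh_add0 oh_addN.
End OHZmod.

Definition oh_mul (n : nat) (C : choices n) (x y : OH n) : OH n :=
  [ffun p => \sum_(b : matching n)
     cob_map (C p.1 b p.2) (stack (oh_comp x p.1 b) (oh_comp y b p.2))].

Definition oh_diag (n : nat) (a : matching n)
    (F : forall p : matching n * matching n, ext (circles (glue p.1 p.2))) : OH n :=
  [ffun p => if p == (a, a) then F p else 0].

(* The idempotent 1_a, and below the generator a_i. *)
Definition oh_idem (n : nat) (a : matching n) : OH n := oh_diag a (fun=> 1).
Definition oh_one (n : nat) : OH n := \sum_(a : matching n) oh_idem a.
Definition oh_circle (n : nat) (a : matching n) (i : 'I_n.*2) : OH n :=
  oh_diag a (fun p => ext_gen (circle_of (glue p.1 p.2) i)).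

(* A wedge of k circles of W(b)a has degree 2k - |W(b)a| + n in b(OH^n)a. *)
Definition oh_degree (n d : nat) (z : OH n) : Prop :=
  forall (b a : matching n) (A : {set circles (glue b a)}), oh_comp z b a A != 0 ->
    (#|A|.*2)%:Z - #|circles (glue b a)|%:Z + n%:Z = d%:Z.

Definition oh_parity (n : nat) (p : bool) (z : OH n) : Prop :=
  forall (b a : matching n) (A : {set circles (glue b a)}), oh_comp z b a A != 0 ->
    odd #|A| = p.

Definition supercentral (n : nat) (C : choices n) (p : bool) (z : OH n) : Prop :=
  oh_parity p z /\
  forall (q : bool) (x : OH n), oh_parity q x ->
    oh_mul C z x = oh_mul C x z *~ (-1) ^+ (q * p).

(* The additive span of the parity-homogeneous supercentral elements. *)
Definition odd_center (n : nat) (C : choices n) (z : OH n) : Prop :=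
  exists z0 z1, [/\ z = z0 + z1, supercentral C false z0 & supercentral C true z1].

(* Main.v *)
Require Import Defs.
From HB Require Import structures.
From mathcomp Require Import fingroup perm.
From mathcomp Require Import all_boot all_order all_algebra.
From mathcomp Require Import boolp zify.
From mathcomp.multinomials Require Import monalg.

Set Implicit Arguments.
Unset Strict Implicit.
Unset Printing Implicit Defensive.

Import GRing.Theory.
Local Open Scope ring_scope.

(* Multiplying an element of b(OH)a by one of b(OH)b or a(OH)a only involves
   merges, so splits and their orientations never matter for the center: an
   element of the odd center is a family z_a in the exterior algebra of W(a)a such
   that z_a and z_b have the same image in the exterior algebra of W(b)a for all
   a, b.

   The relations OI_n hold in the exterior algebra of W(a)a because the odd
   elementary functions are the homogeneous parts of the ordered product of the
   1 + x_i^S, in which an arc with both ends in S does not raise the degree.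

   In OH(B), x_i^2 = 0, and the relations rewrite a squarefree monomial that
   violates the ballot condition as a combination of monomials with larger sums
   of indices.  Hence the monomials x_I with I ballot span.  For such I there is a
   crossingless matching a in which I consists of the right ends of dotted arcs
   with no undotted arc beneath a dotted one; the coefficient of z_a at these
   dotted arcs is unitriangular on the x_I.  Finally these coefficients determine
   a compatible family: comparing a matching with the one where a dotted arc and an
   undotted arc directly beneath it are replaced by two unnested arcs expresses
   any coefficient through those whose dotted arcs have smaller total length. *)

(** * Exterior algebras *)

(** The exterior algebra on the 2n end points mediates between the two sides. Because the squares of
    the variables vanish, [OHB n] is a quotient of [ext 'I_n.*2]; sending an end point to its circle
    maps the same algebra to the diagonal families in [OH n]. Statements about the isomorphism are
    thus checked on wedges of end points, and the non-associative product of [OH n] is met only with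
    a diagonal factor, where it becomes an exterior product.

    Over the integers, a comparison of ranks would not rule out an image of finite index. The
    argument therefore counts nothing: it uses a triangular matrix with diagonal entries 1 or -1.
    Spanning with triangularity gives injectivity; triangularity with the vanishing criterion gives
    surjectivity. Only the invertibility of the signs matters there, so coefficient statements
    merely assert that some sign exists. Signs are computed exactly only where cancellation depends
    on them, in the exterior product and in the Springer relations. *)

Lemma mulrz_lift (R : pzRingType) (x y : R) (m n : int) :
  (x *~ m) * (y *~ n) = (x * y) *~ (m * n).
Proof. by rewrite mulrzAl mulrzAr -mulrzA mulrC. Qed.

Section ExteriorSum.
Variable T : finType.

Lemma ext_sum_delta (x : ext T) : x = \sum_(A : {set T}) ext_delta A *~ x A.
Proof.
apply/ffunP=> B; rewrite sum_ffunE (bigD1 B) //= big1 ?addr0.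
  by rewrite ffunMzE ffunE eqxx intz.
by move=> A AB; rewrite ffunMzE ffunE eq_sym (negbTE AB) mul0rz.
Qed.

Lemma ext_deltaE (A B : {set T}) : ext_delta A B = (B == A)%:R.
Proof. by rewrite ffunE. Qed.

Lemma wedge_sign1_sqr (t : T) (A : {set T}) :
  t \notin A -> wedge_sign [set t] A * wedge_sign [set t] A = 1.
Proof. by move=> tA; rewrite /wedge_sign disjoints1 tA -expr2 sqrr_sign. Qed.
End ExteriorSum.

(** Squares are required separately: over the integers, antisymmetry at equal indices only gives
    that twice the square vanishes. *)
Definition anticommuting (R : pzRingType) (T : Type) (g : T -> R) : Prop :=
  (forall t u, g t * g u = - (g u * g t)) /\ forall t, g t * g t = 0.

Definition ext_prod (R : pzRingType) (T : finType) (g : T -> R) (A : {set T}) : R :=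
  \prod_(t <- enum A) g t.

(** The universal property of the exterior algebra. The target is any ring, so that it covers both
    [ext_map] and the map onto [OHB n]. *)
Definition ext_lift (R : pzRingType) (T : finType) (g : T -> R) (x : ext T) : R :=
  \sum_(A : {set T}) ext_prod g A *~ x A.

Section ExtLift.
Variables (R : pzRingType) (T : finType) (g : T -> R).

Lemma ext_lift_is_additive : zmod_morphism (ext_lift g).
Proof.
move=> x y; rewrite -sumrB; apply: eq_bigr => A _.
by rewrite !ffunE mulrzBr.
Qed.
HB.instance Definition _ :=
  GRing.isZmodMorphism.Build (ext T) R (ext_lift g) ext_lift_is_additive.

Lemma ext_lift_delta A : ext_lift g (ext_delta A) = ext_prod g A.
Proof.
rewrite /ext_lift (bigD1 A) //= ext_deltaE eqxx mulr1z big1 ?addr0 // => B /negbTE nBA.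
by rewrite ext_deltaE nBA mulr0z.
Qed.

Lemma ext_prod0 : ext_prod g set0 = 1.
Proof. by rewrite /ext_prod enum_set0 big_nil. Qed.

Lemma ext_prod1 t : ext_prod g [set t] = g t.
Proof. by rewrite /ext_prod enum_set1 big_seq1. Qed.

Lemma ext_lift_gen t : ext_lift g (ext_gen t) = g t.
Proof. by rewrite ext_lift_delta ext_prod1. Qed.

Lemma ext_lift1 : ext_lift g 1 = 1.
Proof. by rewrite [1 in LHS]/(ext_delta set0) ext_lift_delta ext_prod0. Qed.

Lemma ext_prodE A : ext_prod g A = \prod_(t <- enum T | t \in A) g t.
Proof. by rewrite /ext_prod {1}/enum_mem big_filter enumT. Qed.

Hypothesis gP : anticommuting g.
Let ganti := gP.1.
Let gsqr := gP.2.

Lemma prod_anti_swap (t : T) (l : seq T) :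
  g t * \prod_(u <- l) g u = (-1) ^+ size l * ((\prod_(u <- l) g u) * g t).
Proof.
elim: l => [|u l IH]; first by rewrite !big_nil mulr1 !mul1r.
rewrite !big_cons mulrA ganti mulNr -mulrA IH /= exprS mulN1r mulNr; congr (- _).
by rewrite signM (mulrA (g u)).
Qed.

(** Moving [g t] to its place in the sorted product costs one sign for each smaller factor that it
    passes. *)
Lemma ext_prod_insert_seq (t : T) (A : {set T}) (l : seq T) :
  sorted (fun a b : T => enum_rank a < enum_rank b)%N l -> t \in l -> t \notin A ->
  g t * \prod_(u <- l | u \in A) g u =
  (-1) ^+ count (fun u : T => (u \in A) && (enum_rank u < enum_rank t)%N) l *
  \prod_(u <- l | u \in t |: A) g u.
Proof.
move=> + + tA; elim: l => // k l IH /= sl.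
have tr : transitive (fun a b : T => enum_rank a < enum_rank b)%N.
  by move=> ? ? ?; exact: ltn_trans.
have := sl; rewrite path_sortedE // => /andP[/allP kl sl'].
rewrite in_cons !big_cons; case: eqVneq => [tk _|tk /= tl].
  subst k.
  rewrite setU11 (negbTE tA) /= (eq_in_count (a2 := pred0)) ?count_pred0 ?mul1r.
    congr (_ * _); rewrite big_seq_cond [RHS]big_seq_cond; apply: eq_bigl => j; rewrite !inE.
    by case jl: (j \in l) => //=; case: eqVneq => // ji; have /= := kl _ jl; rewrite ji ltnn.
  by move=> j /kl /=; rewrite ltnNge leq_eqVlt negb_or => /andP[_ /negbTE->]; rewrite andbF.
have kt : (enum_rank k < enum_rank t)%N by apply: kl.
rewrite !inE eq_sym (negbTE tk) /= kt andbT; case: (k \in A) => /=; last exact: IH.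
by rewrite mulrA ganti mulNr -mulrA IH // exprS mulN1r mulNr signM.
Qed.

Lemma sorted_enum_rank : sorted (fun a b : T => enum_rank a < enum_rank b)%N (enum T).
Proof.
case def_e: (enum T) => [|x0 l] //; rewrite -def_e.
apply/(sortedP x0) => i si.
have rk k : (k < size (enum T))%N -> enum_rank (nth x0 (enum T) k) = k :> nat.
  move=> sk; have kT : (k < #|T|)%N by rewrite cardE.
  by rewrite -(enum_val_nth x0 (Ordinal kT)) enum_valK.
by rewrite !rk // ltnW.
Qed.

Lemma ext_prod_insert (t : T) (A : {set T}) :
  g t * ext_prod g A = ext_prod g (t |: A) *~ wedge_sign [set t] A.
Proof.
rewrite /wedge_sign disjoints1; case: (boolP (t \in A)) => tA /=.
  have [l1 [l2 e]] : exists l1 l2, enum A = l1 ++ t :: l2.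
    have : t \in enum A by rewrite mem_enum.
    by case/splitPr => l1 l2; exists l1, l2.
  rewrite mulr0z /ext_prod e big_cat big_cons /= mulrA.
  by rewrite prod_anti_swap !mulrA -(mulrA _ (g t) (g t)) gsqr mulr0 mul0r.
rewrite !ext_prodE ext_prod_insert_seq ?sorted_enum_rank ?mem_enum //.
rewrite -signr_odd -[in RHS]signr_odd.
have -> : #|inversions [set t] A| =
  count (fun u : T => (u \in A) && (enum_rank u < enum_rank t)%N) (enum T).
  rewrite -size_filter.
  have -> : inversions [set t] A =
      [set (t, u) | u in [set u in A | (enum_rank u < enum_rank t)%N]].
    apply/setP=> -[u v]; rewrite !inE /=.
    apply/idP/imsetP => [/andP[/andP[/eqP -> vA] lt]|[w]]; first by exists v; rewrite ?inE ?vA.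
    by rewrite inE => /andP[wA lt] [-> ->]; rewrite eqxx wA.
  rewrite card_imset => [|u v [] //]; rewrite cardE; congr size.
  rewrite [LHS]/enum_mem -enumT.
  by apply: eq_filter => u; rewrite [LHS]inE.
by case: odd; rewrite ?mulr1z ?mul1r //= mulrNz mulr1z mulN1r.
Qed.

(** Peeling one generator off the left factor reduces this to [ext_prod_insert]; the cocycle
    identity reassembles the signs. *)
Lemma ext_prodM (A B : {set T}) :
  ext_prod g A * ext_prod g B = ext_prod g (A :|: B) *~ wedge_sign A B.
Proof.
have [m] := ubnP #|A|; elim: m A => // m IH A Am.
have [->|[t tA]] := set_0Vmem A.
  by rewrite set0U wedge_sign0l ext_prod0 mul1r.
pose A' := A :\ t; have tA' : t \notin A' by rewrite !inE eqxx.
have eA : A = t |: A' by rewrite setD1K.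
have -> : ext_prod g A = g t * ext_prod g A' *~ wedge_sign [set t] A'.
  by rewrite ext_prod_insert -mulrzA wedge_sign1_sqr // eA.
have co := wedge_sign_cocycle [set t] A' B; rewrite -eA in co.
rewrite mulrzAl -mulrA IH; last by move: Am; rewrite (cardsD1 t) tA.
rewrite mulrzAr ext_prod_insert setUA -eA -!mulrzA; congr (_ *~ _).
by rewrite mulrA -co mulrC mulrA wedge_sign1_sqr // mul1r.
Qed.

Lemma ext_lift_monoid : monoid_morphism (ext_lift g).
Proof.
split=> [|x y]; first exact: ext_lift1.
rewrite [x in LHS]ext_sum_delta [y in LHS]ext_sum_delta mulr_suml raddf_sum /=.
rewrite mulr_suml; apply: eq_bigr => A _.
rewrite mulr_sumr raddf_sum mulr_sumr; apply: eq_bigr => B _.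
by rewrite !mulrz_lift ext_delta_mul raddfMz raddfMz /= ext_lift_delta ext_prodM.
Qed.

End ExtLift.

Lemma ext_gen_anticommuting (T U : finType) (f : T -> U) :
  anticommuting (fun t => ext_gen (f t)).
Proof. by split=> [t u|t]; [exact: ext_gen_anti|exact: ext_gen_sqr]. Qed.

Section ExtMap.
Variables (T U : finType) (f : T -> U).

Lemma ext_mapE (x : ext T) : ext_map f x = ext_lift (fun t => ext_gen (f t)) x.
Proof. by []. Qed.

Lemma ext_map_is_additive : zmod_morphism (ext_map f).
Proof. exact: ext_lift_is_additive. Qed.
HB.instance Definition _ :=
  GRing.isZmodMorphism.Build (ext T) (ext U) (ext_map f) ext_map_is_additive.

Lemma ext_map_monoid : monoid_morphism (ext_map f).
Proof. exact/ext_lift_monoid/ext_gen_anticommuting. Qed.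
HB.instance Definition _ :=
  GRing.isMonoidMorphism.Build (ext T) (ext U) (ext_map f) ext_map_monoid.

Lemma ext_map_gen t : ext_map f (ext_gen t) = ext_gen (f t).
Proof. exact: ext_lift_gen. Qed.
End ExtMap.

Lemma ext_prod_gen (T : finType) (A : {set T}) : ext_prod (@ext_gen T) A = ext_delta A.
Proof.
have [m] := ubnP #|A|; elim: m A => // m IH A Am.
have [->|[t tA]] := set_0Vmem A; first exact: ext_prod0.
have tA' : t \notin A :\ t by rewrite !inE eqxx.
have := wedge_sign1_sqr tA'; have := ext_prod_insert (ext_gen_anticommuting (@id T)) t (A :\ t).
rewrite IH; last by move: Am; rewrite (cardsD1 t) tA.
rewrite [_ * _]ext_delta_mul setD1K // => + sq => /(congr1 (fun x => x *~ wedge_sign [set t] (A :\ t))).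
by rewrite -!mulrzA sq !mulr1z => <-.
Qed.

(** Uniqueness in the universal property: composites can be compared on generators, without tracking
    the signs produced by reordering subsets. *)
Lemma ext_lift_unique (T : finType) (R : pzRingType) (F : ext T -> R) :
  monoid_morphism F -> zmod_morphism F -> F =1 ext_lift (F \o @ext_gen T).
Proof.
move=> [F1 FM] FB x.
have F0 : F 0 = 0 by rewrite -(subrr (0 : ext T)) FB subrr.
have FN y : F (- y) = - F y by rewrite -[- y]sub0r FB F0 sub0r.
have FD y z : F (y + z) = F y + F z by rewrite -[z in LHS]opprK FB FN opprK.
have FMz y (m : int) : F (y *~ m) = F y *~ m.
  have FMn k : F (y *+ k) = F y *+ k by elim: k => // k IH; rewrite !mulrS FD IH.
  by case: m => m; rewrite ?NegzE ?mulrNz ?FN -!pmulrn FMn.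
rewrite [x in LHS]ext_sum_delta (big_morph F FD F0); apply: eq_bigr => A _.
rewrite FMz -ext_prod_gen /ext_prod; congr (_ *~ _).
by rewrite (big_morph F FM F1).
Qed.

Lemma eq_ext_lift (R : pzRingType) (T : finType) (g g' : T -> R) :
  g =1 g' -> ext_lift g =1 ext_lift g'.
Proof. by move=> gg x; apply: eq_bigr => A _; congr (_ *~ _); apply: eq_bigr. Qed.

Lemma eq_ext_map (T U : finType) (f f' : T -> U) : f =1 f' -> ext_map f =1 ext_map f'.
Proof. by move=> ff; apply: eq_ext_lift => t; rewrite ff. Qed.

Lemma ext_lift_map (R : pzRingType) (T U : finType) (f : T -> U) (g : U -> R) x :
  anticommuting g -> ext_lift g (ext_map f x) = ext_lift (g \o f) x.
Proof.
move=> gP; have /(_ _ _ x) /= -> := @ext_lift_unique _ _ (ext_lift g \o ext_map f).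
- by apply: eq_ext_lift => t /=; rewrite ext_map_gen ext_lift_gen.
- split=> [|y z] /=; first by rewrite (ext_map_monoid f).1 (ext_lift_monoid gP).1.
  by rewrite (ext_map_monoid f).2 (ext_lift_monoid gP).2.
- by move=> y z /=; rewrite ext_map_is_additive ext_lift_is_additive.
Qed.

Lemma ext_map_comp (T U V : finType) (f : T -> U) (g : U -> V) x :
  ext_map g (ext_map f x) = ext_map (g \o f) x.
Proof. by rewrite ext_mapE (ext_lift_map _ _ (ext_gen_anticommuting g)). Qed.

Lemma ext_map_id (T : finType) (x : ext T) : ext_map id x = x.
Proof.
rewrite [RHS]ext_sum_delta; apply: eq_bigr => A _; congr (_ *~ _).
exact: (ext_prod_gen A).
Qed.

Lemma ext_delta_comm (T : finType) (A B : {set T}) :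
  ext_delta A * ext_delta B = (ext_delta B * ext_delta A) *~ (-1) ^+ (odd #|A| && odd #|B|).
Proof.
have [m] := ubnP #|A|; elim: m A => // m IH A Am.
have [->|[t tA]] := set_0Vmem A.
  by rewrite cards0 /= mulr1z [ext_delta set0]/(1 : ext T) mulr1 mul1r.
have tA' : t \notin A :\ t by rewrite !inE eqxx.
have {IH} := IH (A :\ t); rewrite -ltnS (leq_trans _ Am); last by rewrite [in X in (_ < X)%N](cardsD1 t) tA.
move=> /(_ isT) IH.
have eA : ext_delta A = ext_gen t * ext_delta (A :\ t) *~ wedge_sign [set t] (A :\ t).
  by rewrite ext_delta_mul setD1K // -mulrzA wedge_sign1_sqr.
have gt : ext_gen t * ext_delta B = (ext_delta B * ext_gen t) *~ (-1) ^+ odd #|B|.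
  rewrite -ext_prod_gen /ext_prod (prod_anti_swap (ext_gen_anticommuting (@id T))) -cardE.
  by rewrite -signr_odd; case: odd; rewrite ?mul1r ?mulr1z //= mulN1r mulrNz mulr1z.
rewrite eA mulrzAl mulrzAr -mulrA IH mulrzAr mulrA gt mulrzAl -!mulrA -!mulrzA; congr (_ *~ _).
rewrite mulrA mulrC (cardsD1 t A) tA oddD /=; congr (_ * _).
by case: (odd #|B|); case: (odd #|A :\ t|).
Qed.

Definition ext_parity (T : finType) (p : bool) (x : ext T) : Prop :=
  forall A : {set T}, x A != 0 -> odd #|A| = p.

Lemma ext_supercomm (T : finType) (p q : bool) (x y : ext T) :
  ext_parity p x -> ext_parity q y -> x * y = (y * x) *~ (-1) ^+ (p && q).
Proof.
move=> px qy; rewrite {1}[x]ext_sum_delta {1}[y]ext_sum_delta mulr_suml.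
rewrite [x in RHS]ext_sum_delta [y in RHS]ext_sum_delta mulr_sumr mulrz_suml; apply: eq_bigr => A _.
rewrite mulr_sumr mulr_suml mulrz_suml; apply: eq_bigr => B _.
have [->|xA] := eqVneq (x A) 0; first by rewrite !mulr0z mul0r mulr0 mul0rz.
have [->|yB] := eqVneq (y B) 0; first by rewrite !mulr0z mul0r mulr0 mul0rz.
rewrite !mulrz_lift ext_delta_comm (px _ xA) (qy _ yB) -!mulrzA; congr (_ *~ _).
by rewrite mulrC (mulrC (x A)).
Qed.

Section ExtMapCoef.
Variables (T U : finType) (f : T -> U).

Lemma ext_prod_map_inj (A : {set T}) : {in A &, injective f} ->
  exists b : bool, ext_prod (fun t => ext_gen (f t)) A = ext_delta (f @: A) *~ (-1) ^+ b.
Proof.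
have [m] := ubnP #|A|; elim: m A => // m IH A Am finj.
have [->|[t tA]] := set_0Vmem A.
  by exists false; rewrite ext_prod0 imset0 mulr1z.
have tA' : t \notin A :\ t by rewrite !inE eqxx.
have [||b e] := IH (A :\ t).
- by move: Am; rewrite (cardsD1 t) tA.
- by move=> u v /setD1P[_ uA] /setD1P[_ vA]; apply: finj.
have /(congr1 (fun x => x *~ wedge_sign [set t] (A :\ t))) :=
  ext_prod_insert (ext_gen_anticommuting f) t (A :\ t).
rewrite -mulrzA wedge_sign1_sqr // setD1K // mulr1z => <-.
rewrite e mulrzAr ext_delta_mul -imset_set1 -imsetU setD1K //.
rewrite -!mulrzA /wedge_sign imset_set1 !disjoints1 tA' ifT; last first.
  apply/imsetP=> -[u /setD1P[ut uA] /finj e']; by rewrite e' ?eqxx // in ut.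
rewrite -!exprD -signr_odd; by eexists.
Qed.

Lemma ext_prod_map_noninj (A : {set T}) t u : t \in A -> u \in A -> t != u -> f t = f u ->
  ext_prod (fun t => ext_gen (f t)) A = 0.
Proof.
move=> tA uA tu ftu; have tA' : t \notin A :\ t by rewrite !inE eqxx.
have uA' : u \in A :\ t by rewrite !inE eq_sym tu.
pose B := (A :\ t) :\ u; have uB : u \notin B by rewrite !inE eqxx.
have gP := ext_gen_anticommuting f.
have /(congr1 (fun x => x *~ wedge_sign [set t] (A :\ t))) := ext_prod_insert gP t (A :\ t).
rewrite -mulrzA wedge_sign1_sqr // setD1K // mulr1z => <-.
have /(congr1 (fun x => x *~ wedge_sign [set u] B)) := ext_prod_insert gP u B.
rewrite -mulrzA wedge_sign1_sqr // setD1K // mulr1z => <-.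
by rewrite ftu mulrzAr mulrA ext_gen_sqr mul0r !mul0rz.
Qed.

(** The equality of cardinalities keeps exactly the sets on which [f] is injective; on the others a
    generator repeats and the wedge dies. The signs stay unspecified, since only their invertibility
    is needed later. *)
Lemma ext_map_coef (x : ext T) (C : {set U}) :
  exists s : {set T} -> bool,
    ext_map f x C = \sum_(A : {set T} | (f @: A == C) && (#|A| == #|C|)) x A * (-1) ^+ s A.
Proof.
have H (A : {set T}) : exists b : bool, (ext_prod (fun t => ext_gen (f t)) A *~ x A) C =
    if (f @: A == C) && (#|A| == #|C|) then x A * (-1) ^+ b else 0.
  rewrite ffunMzE; case: (boolP [forall t in A, forall u in A, (f t == f u) ==> (t == u)]) => [fi|fi].
    have finj : {in A &, injective f}.
      move=> t u tA uA /eqP ftu.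
      by move/forall_inP: fi => /(_ t tA) /forall_inP /(_ u uA); rewrite ftu => /eqP.
    have [b ->] := ext_prod_map_inj finj; exists b.
    rewrite ffunMzE ext_deltaE eq_sym -(card_in_imset finj).
    case: eqP => [->|_] /=; last by rewrite !mul0rz.
    by rewrite eqxx -mulrzA mulrC intz.
  exists false; move: fi; rewrite negb_forall_in => /exists_inP[t tA].
  rewrite negb_forall_in => /exists_inP[u uA]; rewrite negb_imply => /andP[/eqP ftu tu].
  rewrite (ext_prod_map_noninj tA uA tu ftu) ffunE mul0rz.
  case: ifP => // /andP[/eqP <- /eqP cA]; have /imset_injP finj : #|f @: A| == #|A| by rewrite cA.
  by rewrite (finj _ _ tA uA ftu) eqxx in tu.
exists (fun A => projT1 (cid (H A))); rewrite sum_ffunE [RHS]big_mkcond.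
by apply: eq_bigr => A _; case: cid.
Qed.
End ExtMapCoef.

(** * Merging circles and the odd center *)

Section Circles.
Variables (P : finType) (e : rel P).

Lemma circle_ptK (A : circles e) : circle_of e (circle_pt A) = A.
Proof. by apply/val_inj/esym/eqP/(xchooseP (existsP (valP A))). Qed.

Lemma circle_of_eq x y : connect_sym e ->
  (circle_of e x == circle_of e y) = connect e x y.
Proof.
move=> sym; rewrite -val_eqE /=; apply/eqP/idP => [/setP/(_ y)|xy].
  by rewrite !inE connect0.
by apply/setP=> z; rewrite !inE; apply: same_connect.
Qed.

End Circles.

(** [circle_map] applies [f] to a chosen point of the circle; compatibility with the edges makes
    that choice irrelevant. *)
Lemma circle_map_of (P P' : finType) (e : rel P) (e' : rel P') (f : P -> P') x : connect_sym e' ->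
  (forall x y, e x y -> connect e' (f x) (f y)) ->
  circle_map e' f (circle_of e x) = circle_of e' (f x).
Proof.
move=> sym' ef; apply/eqP; rewrite circle_of_eq //.
have : connect e (circle_pt (circle_of e x)) x.
  have /(congr1 val)/setP/(_ x) := circle_ptK (circle_of e x).
  by rewrite !inE connect0.
move: (circle_pt _) => z /connectP[p + ->].
elim: p z => [|y p IH] z /=; first by move=> _; apply: connect0.
by move=> /andP[/ef zy /IH]; apply: connect_trans.
Qed.

Lemma ext_circle_map_comp (P1 P2 P3 : finType) (e1 : rel P1) (e2 : rel P2) (e3 : rel P3)
    (f : P1 -> P2) (g : P2 -> P3) (x : ext (circles e1)) :
  connect_sym e2 -> connect_sym e3 ->
  (forall x y, e1 x y -> connect e2 (f x) (f y)) ->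
  (forall x y, e2 x y -> connect e3 (g x) (g y)) ->
  ext_map (circle_map e3 g) (ext_map (circle_map e2 f) x) =
  ext_map (circle_map e3 (g \o f)) x.
Proof.
move=> sym2 sym3 fe ge; apply: etrans (ext_map_comp _ _ _) _; apply: eq_ext_map => A.
rewrite -(circle_ptK A) /comp; move: (circle_pt A) => p.
rewrite (circle_map_of _ sym2 fe) (circle_map_of _ sym3 ge) circle_map_of //.
move=> u v /fe /connectP[q + ->]; elim: q (f u) => [|y q IH] z /=.
  by move=> _; apply: connect0.
by move=> /andP[/ge zy /IH]; apply: connect_trans.
Qed.

Lemma circle_map_id (P : finType) (e : rel P) : circle_map e id =1 @id (circles e).
Proof. exact: circle_ptK. Qed.

Section Matchings.
Variables (n : nat) (a : matching n).
Implicit Types i j : 'I_n.*2.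

Lemma matching_neq i : a i != i.
Proof. by case: a => f /= /andP[/forallP/(_ i)/andP[]]. Qed.

Lemma matchingK : involutive a.
Proof. by move=> i; case: a => f /= /andP[/forallP/(_ i)/andP[_ /eqP]]. Qed.

Lemma matching_noncrossing i j : (i < j)%N -> (j < a i)%N -> (a i < a j)%N -> False.
Proof.
case: a => f /= /andP[_ /forallP/(_ i)/forallP/(_ j)] + ij jfi fifj.
by rewrite ij jfi fifj.
Qed.

Lemma matching_eq i j : (j == a i) = (i == a j).
Proof. by apply/eqP/eqP => ->; rewrite matchingK. Qed.
End Matchings.

Lemma glue_sym n (b a : matching n) : connect_sym (glue b a).
Proof.
by apply: sym_connect_sym => i j; rewrite /glue matching_eq (matching_eq b).
Qed.

Section Merging.
Variables (n : nat) (c b a : matching n).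
Implicit Types (D : {set 'I_n.*2}) (i : 'I_n.*2).
Local Notation e D := (@stage n c b a D).

(** Contracted points come in pairs of ends of arcs of [b]; this is what makes [stage] symmetric. *)
Definition arc_closed D : Prop := forall i, (b i \in D) = (i \in D).

Lemma arc_closed_add D i : arc_closed D -> arc_closed (i |: (b i |: D)).
Proof.
move=> Db j; rewrite !inE Db (inj_eq (can_inj (matchingK b))) orbCA.
by rewrite (eq_sym (b j)) -matching_eq.
Qed.

Lemma stage_sym D : arc_closed D -> connect_sym (e D).
Proof.
move=> Db; suff H p q : e D p q -> e D q p.
  by apply: sym_connect_sym => p q; apply/idP/idP; apply: H.
case: p => k i; rewrite /stage /= => /orP[] /eqP -> /=.
  by case: k; rewrite matchingK eqxx.
case: (boolP (i \in D)) => iD /=; first by rewrite iD negbK eqxx orbT.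
by rewrite Db (negbTE iD) matchingK eqxx orbT.
Qed.

(* [l] is the line on which the arcs outside the middle are those of [b]. *)
Variable l : bool.
Hypothesis outer_l : (if l then c else a) = b.

(** On line [l] the inner and the outer arc at [i] have the same two ends, so they close up to a
    circle through just these two points, and the other arc of the saddle lies on another circle. *)
Lemma stage_merges D i : arc_closed D -> i \notin D ->
  circle_of (e D) (false, i) != circle_of (e D) (true, i).
Proof.
move=> Db iD; rewrite circle_of_eq; last exact: stage_sym.
pose X := [pred q : bool * 'I_n.*2 | (q.1 == l) && ((q.2 == i) || (q.2 == b i))].
have clX : closed (e D) X.
  apply: intro_closed; first exact: stage_sym.
  move=> [k j] q; rewrite /stage /= => + /andP[/eqP /= kl ji]; subst k.
  have jD : j \notin D by case/orP: ji => /eqP ->; rewrite ?Db.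
  rewrite outer_l (negbTE jD) orbb => /eqP -> /=; rewrite inE /= eqxx /=.
  by case/orP: ji => /eqP ->; rewrite ?matchingK eqxx ?orbT.
apply/negP => /(closed_connect clX); rewrite !inE /= eqxx /=.
by case: (l).
Qed.

(** The inner arc removed from line [l] is still doubled by the outer arc of [b]. The one removed
    from the other line is rerouted along a strand, that outer arc, and the second strand. *)
Lemma stage_merge_sub D i p q : arc_closed D -> i \notin D ->
  e D p q -> connect (e (i |: (b i |: D))) p q.
Proof.
move=> Db iD; set D' := i |: _.
have Db' : arc_closed D'.
  exact: arc_closed_add.
have sym := stage_sym Db'.
have outer k j : connect (e D') (k, j) (k, (if k then c else a) j).
  by apply: connect1; rewrite /stage eqxx.
have strand k j : j \in D' -> connect (e D') (k, j) (~~ k, j).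
  by move=> jD; apply: connect1; rewrite /stage /= jD eqxx orbT.
case: p => k j; rewrite /stage /= => /orP[/eqP -> //|].
case: (boolP (j \in D)) => jD /eqP ->; first by apply: strand; rewrite !inE jD !orbT.
case: (boolP (j \in D')) => jD'; last first.
  by apply: connect1; rewrite /stage /= (negbTE jD') eqxx orbT.
have [->|kl] := eqVneq k l; first by have := outer l j; rewrite outer_l.
have {kl} -> : k = ~~ l by move: kl; case: (k); case: (l).
apply: connect_trans (strand _ _ jD') _; rewrite negbK.
have := outer l j; rewrite outer_l => /connect_trans; apply.
by apply: strand; rewrite Db'.
Qed.

Lemma saddle_merge D o i (x : ext (circles (e D))) : arc_closed D -> i \notin D ->
  saddle o i x = ext_map (circle_map (e (i |: (b i |: D))) id) x.
Proof. by move=> Db iD; rewrite /saddle stage_merges. Qed.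

Lemma glue_outer x y : (y == b x) -> glue c a x y.
Proof. by rewrite /glue -outer_l; case: (l) => ->; rewrite ?orbT. Qed.

Lemma stage_sub_glue D p q : e D p q -> connect (glue c a) p.2 q.2.
Proof.
case: p => k j; rewrite /stage /= => /orP[] /eqP -> /=.
  by apply: connect1; rewrite /glue; case: k; rewrite eqxx ?orbT.
by case: ifP => _ /=; rewrite ?connect0 //; apply/connect1/glue_outer.
Qed.

Lemma saddles_merge o (s : seq 'I_n.*2) D (x : ext (circles (e D))) :
  arc_closed D -> uniq s -> {in s, forall i, i \notin D} -> {in s, forall i : 'I_n.*2, (i < b i)%N} ->
  saddles o s x = ext_map (circle_map (glue c a) snd) x.
Proof.
elim: s D x => //= i s IH D x Db /andP[iNs us] sD sb.
have iD : i \notin D by apply: sD; rewrite inE eqxx.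
have Db' : arc_closed (i |: (b i |: D)).
  exact: arc_closed_add.
have sD' : {in s, forall j, j \notin i |: (b i |: D)}.
  move=> j js; rewrite !inE !negb_or sD ?inE ?js ?orbT // andbT; apply/andP; split.
    by apply: contraNneq iNs => <-.
  (* [j = b i] is impossible, because [i] and [j] are both left ends. *)
  apply/eqP => ji; have := sb j; rewrite inE js orbT => /(_ isT).
  by have := sb i; rewrite inE eqxx => /(_ isT); rewrite ji matchingK; lia.
have sb' : {in s, forall j : 'I_n.*2, (j < b j)%N} by move=> j js; apply: sb; rewrite inE js orbT.
transitivity (ext_map (circle_map (glue c a) snd) (saddle (o i) i x)).
  exact: (IH _ (saddle (o i) i x) Db' us sD' sb').
rewrite (saddle_merge _ _ Db iD).
apply: ext_circle_map_comp; [exact: stage_sym|exact: glue_sym| |exact: stage_sub_glue].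
by move=> u v; apply: stage_merge_sub.
Qed.

Lemma cob_map_merge (C : cob_choice b) (x : ext (circles (e set0))) :
  cob_map C x = ext_map (circle_map (glue c a) snd) x.
Proof.
case: C => s o so ssurr; rewrite /cob_map /=; apply: saddles_merge.
- by move=> i; rewrite !inE.
- by rewrite (perm_uniq so) filter_uniq // enum_uniq.
- by move=> i; rewrite inE.
- by move=> i; rewrite (perm_mem so) mem_filter => /andP[].
Qed.

Lemma cob_map_stack (C : cob_choice b) x y :
  cob_map C (@stack n c b a x y) =
  ext_map (circle_map (glue c a) id) x * ext_map (circle_map (glue c a) id) y.
Proof.
have Db : arc_closed set0 by move=> i; rewrite !inE.
rewrite cob_map_merge /stack (ext_map_monoid _).2.
congr (_ * _); apply: ext_circle_map_comp; try exact: glue_sym; try exact: stage_sym;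
  try exact: stage_sub_glue.
all: move=> u v /orP[] uv; apply: connect1.
all: by rewrite /stage /= ?in_set0 ?xpair_eqE ?eqxx /= ?uv ?orbT.
Qed.
End Merging.

Definition oh_at (n : nat) (b a : matching n) (z : OH n) : ext (circles (glue b a)) :=
  oh_comp z b a.

Lemma oh_at_is_additive n (b a : matching n) : zmod_morphism (oh_at b a).
Proof. by move=> x y; rewrite /oh_at /oh_comp !ffunE. Qed.
HB.instance Definition _ n (b a : matching n) :=
  GRing.isZmodMorphism.Build (OH n) (ext (circles (glue b a))) (oh_at b a)
    (oh_at_is_additive b a).

Lemma oh_at_inj n (x y : OH n) : (forall b a, oh_at b a x = oh_at b a y) -> x = y.
Proof. by move=> xy; apply/ffunP => -[b a]; apply: xy. Qed.

Lemma oh_at_diag n (a : matching n) F : oh_at a a (oh_diag a F) = F (a, a).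
Proof. by rewrite /oh_at /oh_comp ffunE eqxx. Qed.

Lemma oh_at_diag0 n (c b a : matching n) F :
  (b, a) != (c, c) -> oh_at b a (oh_diag c F) = 0.
Proof. by move=> /negbTE ba; rewrite /oh_at /oh_comp ffunE ba. Qed.

(* Meaningful when every circle of W(d)c lies inside one of W(b)a; it is only
   used with d = c = b, d = c = a, or (d, c) = (b, a). *)
Definition merge_map (n : nat) (d c b a : matching n) :
    ext (circles (glue d c)) -> ext (circles (glue b a)) :=
  ext_map (circle_map (glue b a) id).

HB.instance Definition _ n (d c b a : matching n) :=
  GRing.isZmodMorphism.Build _ _ (@merge_map n d c b a) (ext_map_is_additive _).
HB.instance Definition _ n (d c b a : matching n) :=
  GRing.isMonoidMorphism.Build _ _ (@merge_map n d c b a) (ext_map_monoid _).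

Lemma merge_map_id n (b a : matching n) x : merge_map b a x = x :> ext (circles (glue b a)).
Proof. by rewrite /merge_map (eq_ext_map (circle_map_id (e := glue b a))) ext_map_id. Qed.

Lemma glue_diag_sub n (d b a : matching n) x y : d = b \/ d = a ->
  glue d d x y -> connect (glue b a) x y.
Proof.
by move=> dba; rewrite /glue orbb => xy; apply: connect1; case: dba => <-; rewrite /glue xy ?orbT.
Qed.

Lemma merge_map_circle n (d b a : matching n) i : d = b \/ d = a ->
  circle_map (glue b a) id (circle_of (glue d d) i) = circle_of (glue b a) i.
Proof.
move=> dba; rewrite circle_map_of //; first exact: glue_sym.
by move=> x y; apply: glue_diag_sub.
Qed.

Lemma ext_map_parity (T U : finType) (f : T -> U) p (x : ext T) :
  ext_parity p x -> ext_parity p (ext_map f x).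
Proof.
move=> px C; have [s ->] := ext_map_coef f x C => nz.
have [A /andP[_ /eqP <-] xA] : exists2 A : {set T}, (f @: A == C) && (#|A| == #|C|) & x A != 0.
  apply: contrapT => nA; move: nz; apply/negP; rewrite negbK; apply/eqP/big1 => A AC.
  by have [->|xA] := eqVneq (x A) 0; [rewrite mul0r | case: nA; exists A].
exact: px.
Qed.

(** * Supercentral elements as compatible families *)

Section Center.
Variables (n : nat) (C : choices n).
Implicit Types (x y z : OH n).

Lemma saddles0 (c b a : matching n) o s D : @saddles n c b a o s D 0 = 0.
Proof.
elim: s D => [|i s IH] D /=; first exact: (raddf0 (ext_map _)).
rewrite (_ : saddle _ _ _ = 0) ?IH // /saddle.
by case: ifP => _; [exact: (raddf0 (ext_map _)) | rewrite (raddf0 (ext_map _)) mulr0].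
Qed.

Lemma cob_map0 (c b a : matching n) (D : cob_choice b) : @cob_map n c b a D 0 = 0.
Proof. exact: saddles0. Qed.

Lemma stack0l (c b a : matching n) v : @stack n c b a 0 v = 0.
Proof. by rewrite /stack (raddf0 (ext_map _)) mul0r. Qed.

Lemma stack0r (c b a : matching n) v : @stack n c b a v 0 = 0.
Proof. by rewrite /stack (raddf0 (ext_map _)) mulr0. Qed.

Definition oh_diagonal z := forall b a : matching n, b != a -> oh_at b a z = 0.

Lemma oh_at_mul b a x y : oh_at b a (oh_mul C x y) =
  \sum_(d : matching n) cob_map (C b d a) (stack (oh_at b d x) (oh_at d a y)).
Proof. by rewrite /oh_at /oh_comp ffunE. Qed.

(** The middle matching [b] is also the outer matching of the upper line, so the cobordism acts by a
    map of exterior algebras, whatever [C] chooses. *)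
Lemma oh_mul_diagl z x b a : oh_diagonal z ->
  oh_at b a (oh_mul C z x) = merge_map b a (oh_at b b z) * oh_at b a x.
Proof.
move=> dz; rewrite oh_at_mul (bigD1 b) //= big1 ?addr0; last first.
  by move=> d db; rewrite (dz b d) ?stack0l ?cob_map0 // eq_sym.
by rewrite (@cob_map_stack n b b a true erefl); congr (_ * _); exact: merge_map_id.
Qed.

Lemma oh_mul_diagr z x b a : oh_diagonal z ->
  oh_at b a (oh_mul C x z) = oh_at b a x * merge_map b a (oh_at a a z).
Proof.
move=> dz; rewrite oh_at_mul (bigD1 a) //= big1 ?addr0; last first.
  by move=> d da; rewrite (dz d a) ?stack0r ?cob_map0.
by rewrite (@cob_map_stack n b a a false erefl); congr (_ * _); exact: merge_map_id.
Qed.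

Definition compatible z := oh_diagonal z /\
  forall b a : matching n, merge_map b a (oh_at b b z) = merge_map b a (oh_at a a z).

Lemma compatibleB y z : compatible y -> compatible z -> compatible (y - z).
Proof.
move=> [dy cy] [dz cz]; split=> b a; first by move=> ba; rewrite raddfB /= dy ?dz ?subrr.
by rewrite !raddfB /= cy cz.
Qed.

Lemma ext_parity1 (T : finType) : ext_parity false (1 : ext T).
Proof. by move=> A; rewrite ffunE; case: (A =P set0) => [->|_]; rewrite ?cards0. Qed.

Lemma oh_idem_parity (a : matching n) : oh_parity false (oh_idem a).
Proof.
move=> b d A; rewrite /oh_comp /oh_idem /oh_diag ffunE.
by case: ifP => _; [exact: ext_parity1 | rewrite ffunE].
Qed.

Lemma oh_idem_diagonal (a : matching n) : oh_diagonal (oh_idem a).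
Proof.
move=> b d bd; apply: oh_at_diag0; rewrite xpair_eqE.
by apply: contra bd => /andP[/eqP -> /eqP ->].
Qed.

(** Even test elements suffice and bring in no sign: the idempotents kill the components off the
    diagonal, and the unit of each b(OH)a compares the components at [b] and at [a]. *)
Lemma supercentral_compatible p z : supercentral C p z -> compatible z.
Proof.
move=> [pz cz].
have dz : oh_diagonal z.
  move=> b a ba; have := cz false _ (@oh_idem_parity a); rewrite /= mulr1z => /(congr1 (oh_at b a)).
  rewrite oh_mul_diagr; last exact: oh_idem_diagonal.
  rewrite oh_mul_diagl; last exact: oh_idem_diagonal.
  rewrite oh_at_diag /= rmorph1 mulr1 => ->.
  by rewrite (@oh_at_diag0 _ a b b) ?raddf0 ?mul0r // xpair_eqE negb_and ba.
split=> [|b a]; first exact: dz.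
pose u : OH n := [ffun q => if q == (b, a) then 1 else 0].
have pu : oh_parity false u.
  move=> d c A; rewrite /oh_comp ffunE.
  by case: ifP => _; [exact: ext_parity1 | rewrite ffunE].
have ub : oh_at b a u = 1 by rewrite /oh_at /oh_comp ffunE eqxx.
have /(congr1 (oh_at b a)) := cz false _ pu.
rewrite /= mulr1z (oh_mul_diagr _ _ _ dz) (oh_mul_diagl _ _ _ dz) ub.
by rewrite mul1r mulr1.
Qed.

(** Compatibility turns both products into products in the exterior algebra of W(b)a, where
    supercommutativity supplies exactly the required sign. *)
Lemma compatible_supercentral p z :
  compatible z -> oh_parity p z -> supercentral C p z.
Proof.
move=> [dz cz] pz; split=> // q x qx; apply: oh_at_inj => b a.
rewrite raddfMz /= (oh_mul_diagr _ _ _ dz) (oh_mul_diagl _ _ _ dz) cz.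
have pza : ext_parity p (merge_map b a (oh_at a a z)).
  by apply: ext_map_parity => A; apply: pz.
have qxa : ext_parity q (oh_at b a x) by move=> A; apply: qx.
by rewrite (ext_supercomm pza qxa) andbC; case: q p {pz qx pza qxa} => [] [].
Qed.

Lemma odd_center_compatible z : odd_center C z -> compatible z.
Proof.
move=> [z0 [z1 [-> /supercentral_compatible c0 /supercentral_compatible c1]]].
rewrite -[z1]opprK; apply: compatibleB; first exact: c0.
rewrite -[- z1]sub0r; apply: compatibleB; last exact: c1.
by split=> b a; rewrite !raddf0.
Qed.
End Center.

(** * Squares of variables in the odd cohomology *)

Lemma ext_nonzero (T : finType) : (1 : ext T) != 0.
Proof. by apply/eqP => /ffunP/(_ set0); rewrite !ffunE eqxx. Qed.
HB.instance Definition _ (T : finType) :=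
  GRing.PzSemiRing_isNonZero.Build (ext T) (ext_nonzero T).

Section FreeToExt.
Variable m : nat.
Local Notation E := (ext 'I_m).

Definition word_ext (w : {fmonom 'I_m}) : E := \prod_(i <- fmonom_val w) ext_gen i.

Lemma word_ext_mmorphism : mmorphism word_ext.
Proof.
split=> [v w|]; rewrite /word_ext ?fm1 ?big_nil //.
by rewrite fmM big_cat.
Qed.
HB.instance Definition _ := isMultiplicative.Build _ _ word_ext word_ext_mmorphism.

Definition free_ext : free_alg m -> E := mmap (intmul 1) word_ext.
HB.instance Definition _ := GRing.Additive.on free_ext.

Lemma free_ext_monoid : monoid_morphism free_ext.
Proof.
have [] := commr_mmap_is_multiplicative (f := intmul 1) (h := word_ext) => [f u v|].
  by rewrite /GRing.comm mulrzl mulrzr.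
by move=> HM H1; split.
Qed.

Lemma free_ext_var i : free_ext (free_var i) = ext_gen i.
Proof. by rewrite /free_ext mmapU /= mulr1z mul1r /word_ext fmU big_seq1. Qed.

Lemma free_ext_rel f : two_sided_span (@opol_rel m) f -> free_ext f = 0.
Proof.
have [F1 FM] := free_ext_monoid.
elim=> [|x y _ IHx _ IHy|a g b [i [j [_ ->]]]]; first exact: raddf0.
  by rewrite raddfD /= IHx IHy addr0.
have e : free_ext (free_var i * free_var j + free_var j * free_var i) = 0.
  transitivity (ext_gen i * ext_gen j + ext_gen j * ext_gen i : E).
    apply: etrans (raddfD free_ext _ _) _; rewrite -!free_ext_var.
    congr (_ + _); exact: FM.
  by rewrite ext_gen_anti addNr.
by rewrite (FM _ b) (FM a) e mulr0 mul0r.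
Qed.

Definition opol_ext (x : OPol m) : E := free_ext (repr x).

Lemma opol_ext_proj f : opol_ext (opol_proj f) = free_ext f.
Proof.
apply/eqP; rewrite -subr_eq0 -raddfB; apply/eqP/free_ext_rel.
by apply/(quot_projP (ideal_gen (@opol_rel m))); rewrite quot_reprK.
Qed.

Lemma opol_projP (x : OPol m) : exists f, x = opol_proj f.
Proof. by exists (repr x); rewrite /opol_proj quot_reprK. Qed.

Lemma opol_ext_is_additive : zmod_morphism opol_ext.
Proof.
move=> x y; have [f ->] := opol_projP x; have [g ->] := opol_projP y.
by rewrite -raddfB !opol_ext_proj raddfB.
Qed.
HB.instance Definition _ :=
  GRing.isZmodMorphism.Build (OPol m) E opol_ext opol_ext_is_additive.

Lemma opol_ext_monoid : monoid_morphism opol_ext.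
Proof.
have [F1 FM] := free_ext_monoid.
split=> [|x y]; first by rewrite -(rmorph1 (@opol_proj m)) opol_ext_proj.
have [f ->] := opol_projP x; have [g ->] := opol_projP y.
by rewrite -rmorphM !opol_ext_proj FM.
Qed.

Lemma opol_ext_var i : opol_ext (opol_var i) = ext_gen i.
Proof. by rewrite opol_ext_proj free_ext_var. Qed.

Lemma word_ext_coef (w : {fmonom 'I_m}) (A : {set 'I_m}) : word_ext w A != 0 -> #|A| = fdeg w.
Proof.
rewrite /word_ext fdegE; elim: (fmonom_val w) A => [|i s IH] A /=.
  by rewrite big_nil ffunE; case: (A =P set0) => [->|//]; rewrite cards0.
rewrite big_cons [\prod_(_ <- _) _]ext_sum_delta mulr_sumr sum_ffunE => nz.
have [B] : exists B : {set 'I_m}, (ext_gen i * (ext_delta B *~ (\prod_(j <- s) ext_gen j) B)) A != 0.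
  apply: contrapT => nB; move: nz; rewrite big1 ?eqxx // => B _.
  by apply/eqP/negPn/negP => nz; apply: nB; exists B.
have [->|/IH sB] := eqVneq ((\prod_(j <- s) @ext_gen 'I_m j) B) 0.
  by rewrite mulr0z mulr0 ffunE.
rewrite mulrzAr ext_delta_mul !ffunMzE ffunE; case: (A =P _) => [->|_]; last by rewrite !mul0rz.
rewrite /wedge_sign disjoints1; case: (boolP (i \in B)) => iB /=; first by rewrite !mulr0z mul0rz.
by rewrite cardsU1 iB sB.
Qed.

Definition set_word (A : {set 'I_m}) : {fmonom 'I_m} := FMonom (enum A).

Lemma fdeg_set_word A : fdeg (set_word A) = #|A|.
Proof. by rewrite cardE. Qed.
End FreeToExt.

Section OHBVar.
Variable n : nat.
Local Notation X := (@opol_var n.*2).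
Implicit Types (S A : {set 'I_n.*2}).

Lemma OI_odd_elem k S r : (1 <= k <= n)%N -> #|S| = (n + k)%N -> (n - k < r)%N ->
  OI (odd_elem X r S).
Proof.
move=> kn cS kr; have [rk|rk] := leqP r (n + k); last first.
  by rewrite odd_elem_big ?cS //; apply: LeftSpan0.
rewrite -[odd_elem _ _ _]mul1r; apply: LeftSpanM; exists k, S, r; split=> //.
by rewrite rk addn1 kr.
Qed.

Lemma signed_var_sqr S i : i \in S -> signed_var X S i * signed_var X S i = X i * X i.
Proof.
move=> iS; rewrite /signed_var iS signM !mulrA -exprD addnn.
by rewrite -[(-1) ^+ _.*2]signr_odd odd_double mul1r.
Qed.

(** Let S be the set of all points. The signed sum over the pairs containing [i] lies in the ideal,
    because the degree 2 functions of S and of S minus a point do. This sum equals y_i (e_1 - y_i),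
    and e_1 lies in the ideal too, hence so does y_i^2 = x_i^2. *)
Lemma OI_var_sqr i : OI (X i * X i).
Proof.
have n0 : (0 < n)%N by case: n i => // -[].
have Xa := @opol_var_anti n.*2.
have cT : #|[set: 'I_n.*2]| = (n + n)%N by rewrite cardsT card_ord addnn.
have iT : i \in [set: 'I_n.*2] by rewrite inE.
have JT r : (0 < r)%N -> OI (odd_elem X r setT).
  by move=> r0; apply: (OI_odd_elem (k := n)); rewrite ?n0 ?leqnn ?subnn.
have JTi j : OI (odd_elem X 2 ([set: 'I_n.*2] :\ j)).
  have cTj : #|[set: 'I_n.*2] :\ j| = (n + n.-1)%N.
    by move: cT; rewrite (cardsD1 j) inE; move: n0; lia.
  (* k = n - 1 serves when n > 1; for n = 1 the set has a single element and its function of degree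
     2 is zero. *)
  have [n1|n1] := ltnP 1 n; first by apply: (OI_odd_elem (k := n.-1)); rewrite ?cTj; lia.
  by rewrite odd_elem_big ?cTj; [apply: LeftSpan0 | lia].
pose P (A : {set 'I_n.*2}) := i \notin A.
have JiF : OI (sign_sum X setT 2 i (predC P)).
  have /(canLR (addKr _)) <- := sign_sum_split X setT 2 i P.
  rewrite addrC; apply: left_spanB; first by apply: sign_sum_in => [|j _]; [exact: JT|exact: JTi].
  by rewrite sign_sum_notin //; apply/left_span_sign/JTi.
have eF : sign_sum X setT 2 i (predC P) =
    signed_var X setT i * (odd_elem X 1 setT - signed_var X setT i).
  have -> : odd_elem X 1 setT - signed_var X setT i =
      \sum_(A : {set 'I_n.*2} | (#|A| == 1) && P A) mon X setT A.
    rewrite odd_elemE (bigID P) /= addrC (bigD1 [set i]) /=; last first.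
      by rewrite cards1 /P set11.
    rewrite [mon X setT [set i]]/mon enum_set1 big_seq1 [X in _ + X + _ - _]big1 ?addr0 1?addrAC ?subrr ?add0r //.
    move=> A /andP[/andP[/cards1P[j ->]]].
    by rewrite /P negbK inE => /eqP ->; rewrite eqxx.
  rewrite mulr_sumr /sign_sum [LHS](reindex_onto (fun A => i |: A) (fun A => A :\ i)) /=.
    apply: eq_big => [A|A /andP[_ iA]].
      rewrite negbK setU11 andbT /P; have [iA|iA] := boolP (i \in A).
        rewrite andbF; apply/negbTE; rewrite negb_and; apply/orP; right.
        by apply: contraL iA => /eqP <-; rewrite !inE eqxx.
      by rewrite cardsU1 iA setU1K // eqxx !andbT.
    rewrite mon_insert //; last by move: iA => /eqP <-; rewrite !inE eqxx.
    congr (_ ^+ #|pred_of_set _| * _).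
    by apply/setP=> j; rewrite !inE; case: eqVneq => //= ->; rewrite ltnn andbF.
  by move=> A /andP[_]; rewrite /= negbK => /setD1K.
rewrite -(signed_var_sqr iT).
have -> : signed_var X setT i * signed_var X setT i =
   signed_var X setT i * odd_elem X 1 setT - sign_sum X setT 2 i (predC P).
  by rewrite eF mulrBr subKr.
by apply: left_spanB => //; apply/left_spanMl/JT.
Qed.

Lemma ohb_var_anticommuting : anticommuting (@ohb_var n).
Proof.
have sqr (i : 'I_n.*2) : ohb_var i * ohb_var i = 0.
  rewrite /ohb_var -rmorphM.
  transitivity (ohb_proj (0 : OPol n.*2)); last exact: (raddf0 (@ohb_proj n)).
  by apply/(quot_projP (springer_ideal n)); rewrite subr0; apply: OI_var_sqr.
split=> // i j; have [->|ij] := eqVneq i j; first by rewrite sqr oppr0.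
transitivity (ohb_proj (opol_var i * opol_var j)); first exact/esym/(rmorphM (@ohb_proj n)).
rewrite (opol_var_anti ij); apply: etrans (raddfN (@ohb_proj n) _) _.
congr (- _); exact: (rmorphM (@ohb_proj n)).
Qed.

(** With squares equal to zero, the projection of every word factors through the exterior algebra,
    where a degree is the size of a subset. *)
Lemma ohb_proj_free f : ohb_proj (opol_proj f) = ext_lift (@ohb_var n) (free_ext f).
Proof.
have [E1 EM] := ext_lift_monoid ohb_var_anticommuting.
have [F1 FM] := @free_ext_monoid n.*2.
rewrite (monalgE f); elim/big_ind: _ => [|g k IHg IHk|[s] _].
- by rewrite (raddf0 (@opol_proj n.*2)) (raddf0 (@ohb_proj n)) (raddf0 (@free_ext n.*2))
    (raddf0 (ext_lift (@ohb_var n))).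
- by rewrite (raddfD (@opol_proj n.*2)) (raddfD (@ohb_proj n)) (raddfD (@free_ext n.*2))
    (raddfD (ext_lift (@ohb_var n))) /= IHg IHk.
elim: s (f@_ _) => [|i s IH] c.
  rewrite word_nil (raddfMz (@opol_proj n.*2)) (raddfMz (@ohb_proj n)).
  rewrite (raddfMz (@free_ext n.*2)) (raddfMz (ext_lift (@ohb_var n))) /= F1 E1.
  by rewrite (rmorph1 (@opol_proj n.*2)) (rmorph1 (@ohb_proj n)).
rewrite word_cons (rmorphM (@opol_proj n.*2)) (rmorphM (@ohb_proj n)) /= IH FM EM.
by rewrite free_ext_var ext_lift_gen.
Qed.

Lemma ohb_projP (x : OHB n) : exists u, x = ohb_proj u.
Proof. by exists (repr x); rewrite /ohb_proj quot_reprK. Qed.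

Lemma ohb_proj_ext u : ohb_proj u = ext_lift (@ohb_var n) (opol_ext u).
Proof. by have [f ->] := opol_projP u; rewrite opol_ext_proj ohb_proj_free. Qed.
End OHBVar.

(** * Dotted matchings *)

Section PartialMatchings.
Variable N : nat.
Implicit Types (f : {perm 'I_N}) (i j p q : 'I_N).

(* The fixed points of f are the unmatched points; no arc passes over them. *)
Definition partial_matching f : Prop :=
  [/\ involutive f,
      forall i j, (i < j)%N -> (j < f i)%N -> (f i < f j)%N -> False
    & forall i p, f p = p -> (i < p)%N -> (p < f i)%N -> False].

Definition matched f : {set 'I_N} := [set p | f p != p].

Section AddArc.
Variables (f : {perm 'I_N}) (q m : 'I_N).
Hypotheses (fP : partial_matching f) (fq : f q = q) (fm : f m = m) (qm : (q < m)%N).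
Hypothesis gap : forall p, (q < p)%N -> (p < m)%N -> f p != p.

Let f' : {perm 'I_N} := (tperm q m * f)%g.

Lemma add_arcL : f' q = m. Proof. by rewrite permM tpermL. Qed.
Lemma add_arcR : f' m = q. Proof. by rewrite permM tpermR. Qed.
Lemma add_arcD p : p != q -> p != m -> f' p = f p.
Proof. by move=> pq pm; rewrite permM tpermD // eq_sym. Qed.

Lemma add_arc_matched : matched f' = q |: (m |: matched f).
Proof.
apply/setP=> p; rewrite !inE.
have [->|pq] := eqVneq p q; first by rewrite add_arcL neq_ltn qm orbT.
have [->|pm] := eqVneq p m; first by rewrite add_arcR neq_ltn qm.
by rewrite add_arcD.
Qed.

(** An arc crossing the new one would pass over [q] or [m], which are fixed points of [f]; [gap]
    keeps the new arc itself from passing over a fixed point. *)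
Lemma add_arc_partial_matching : partial_matching f'.
Proof.
case: fP => inv nc unc.
have fne p : p != q -> p != m -> (f p != q) && (f p != m).
  by move=> pq pm; rewrite -{1}fq -{1}fm !(inj_eq perm_inj) pq.
split.
- move=> p; have [->|pq] := eqVneq p q; first by rewrite add_arcL add_arcR.
  have [->|pm] := eqVneq p m; first by rewrite add_arcR add_arcL.
  by rewrite !(add_arcD pq pm); case/andP: (fne _ pq pm) => *; rewrite add_arcD // inv.
- move=> i j.
  have [->|iq] := eqVneq i q.
    rewrite add_arcL => qj jm; rewrite add_arcD ?neq_ltn ?qj ?jm ?orbT // => mfj.
    exact: (unc j m).
  have [->|im] := eqVneq i m; first by rewrite add_arcR; lia.
  rewrite (add_arcD iq im); have [->|jq] := eqVneq j q; first by move=> iq' qfi _; apply: (unc i q).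
  have [->|jm] := eqVneq j m; first by move=> im' mfi _; apply: (unc i m).
  by rewrite add_arcD //; apply: nc.
move=> i p; have [->|pq] := eqVneq p q.
  by rewrite add_arcL => mq; move: qm; rewrite mq ltnn.
have [->|pm] := eqVneq p m.
  by rewrite add_arcR => mq; move: qm; rewrite mq ltnn.
rewrite add_arcD // => fp.
have [->|iq] := eqVneq i q.
  by rewrite add_arcL => qp pm'; move: (gap qp pm'); rewrite fp eqxx.
have [->|im] := eqVneq i m; first by rewrite add_arcR; lia.
by rewrite add_arcD //; apply: unc.
Qed.
End AddArc.
End PartialMatchings.

Definition dotted_right_ends (n : nat) (a : matching n) (I : {set 'I_n.*2}) : bool :=
  [forall i in I, (a i < i)%N &&
     [forall p : 'I_n.*2, (a i < p < i)%N ==> (p \in I) || (a p \in I)]].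

Definition standard (n : nat) (I : {set 'I_n.*2}) : bool :=
  [exists a : matching n, dotted_right_ends a I].

Lemma dotted_right_endsP n (a : matching n) (I : {set 'I_n.*2}) :
  reflect (forall i, i \in I -> (a i < i)%N /\
             forall p : 'I_n.*2, (a i < p)%N -> (p < i)%N -> (p \in I) || (a p \in I))
          (dotted_right_ends a I).
Proof.
apply: (iffP forall_inP) => H i iI; have := H i iI.
  by move=> /andP[-> /forallP H']; split=> // p ap pi; have := H' p; rewrite ap pi.
by move=> [-> H']; apply/forallP => p; apply/implyP => /andP[ap pi]; apply: H'.
Qed.

(** Induction on [i]. If a i < b i < i, then [b i] lies beneath a dotted arc of [a]; being a left
    end in [b], it is not in [I], so its [a]-partner is. That partner is smaller than [i], so by
    induction both matchings join it to [b i], forcing it to be [i]. *)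
Lemma dotted_right_ends_unique n (a b : matching n) (I : {set 'I_n.*2}) :
  dotted_right_ends a I -> dotted_right_ends b I -> {in I, a =1 b}.
Proof.
move=> /dotted_right_endsP Ia /dotted_right_endsP Ib i.
have [m] := ubnP (val i); elim: m i => // m IH i im iI.
wlog lt_ab : a b Ia Ib IH / (a i < b i)%N => [W|].
  have [lt|lt|e] := ltngtP (a i) (b i); [exact: W| |exact: ord_inj].
  by apply/esym/W => // j jm jI; apply/esym/IH.
have [_ Hai] := Ia i iI; have [bi _] := Ib i iI.
have [bI|abI] := orP (Hai _ lt_ab bi).
  by have [+ _] := Ib _ bI; rewrite matchingK; lia.
have e : b (a (b i)) = a (a (b i)).
  have [lt _] := Ia _ abI; rewrite matchingK in lt.
  have lt_i : (a (b i) < i)%N.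
    rewrite ltnNge leq_eqVlt negb_or; apply/andP; split; last first.
      apply/negP => lt'.
      apply: (@matching_noncrossing _ a (a i) (b i) lt_ab); rewrite matchingK //.
    apply/eqP => /ord_inj e; have := lt_ab.
    by rewrite {1}e matchingK ltnn.
  by apply/esym/IH => //; apply: leq_trans lt_i im.
move: e; rewrite matchingK => /(congr1 b); rewrite !matchingK => e.
by move: lt_ab; rewrite -[b i](matchingK a) e ltnn.
Qed.

(** The two leftmost unmatched points can always be joined, since every point between them is
    matched; parity guarantees that there is a second one. *)
Lemma partial_matching_extend n (f : {perm 'I_n.*2}) :
  partial_matching f -> ~~ odd #|matched f| ->
  exists a : matching n, forall p, f p != p -> a p = f p.
Proof.
have [m] := ubnP #|~: matched f|; elim: m f => // m IH f fm fP ev.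
have cf : (#|matched f| + #|~: matched f| = n.*2)%N by rewrite cardsC card_ord.
have [f0|[p0 p0f]] := set_0Vmem (~: matched f).
  have fne p : f p != p by have := in_set0 p; rewrite -f0 !inE negbK => /negbT.
  have fc : crossingless [ffun p => f p].
    case: fP => inv nc _; apply/andP; split.
      by apply/forallP => p; rewrite !ffunE fne inv eqxx.
    apply/forallP => i; apply/forallP => j; rewrite !ffunE; apply/negP => /and3P[].
    exact: nc.
  by exists (Matching fc) => p _; rewrite /= ffunE.
have [p /= pf pmin] : exists2 p, p \in ~: matched f &
    forall r, r \in ~: matched f -> (p <= r)%N.
  by case: (arg_minnP (fun p : 'I_n.*2 => val p) p0f) => p pf pmin; exists p.
have [q0 q0f] : exists q, q \in ~: matched f :\ p.
  apply/set0Pn; rewrite -card_gt0.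
  by move: cf ev; rewrite (cardsD1 p (~: _)) pf; lia.
have [q /= qf qmin] : exists2 q, q \in ~: matched f :\ p &
    forall r, r \in ~: matched f :\ p -> (q <= r)%N.
  by case: (arg_minnP (fun p : 'I_n.*2 => val p) q0f) => q qf qmin; exists q.
move: qf; rewrite !inE negbK => /andP[qp /eqP fq].
have {pf} fp : f p = p by move: pf; rewrite !inE negbK => /eqP.
have pq : (p < q)%N.
  by rewrite ltn_neqAle eq_sym qp pmin // !inE fq eqxx.
have gap (r : 'I_n.*2) : (p < r)%N -> (r < q)%N -> f r != r.
  move=> pr rq; apply/negP => /eqP fr; have := qmin r.
  by rewrite !inE fr eqxx (neq_ltn r) pr orbT /= => /(_ isT); lia.
have mP := add_arc_matched fp fq pq.
have cm : #|matched (tperm p q * f)%g| = #|matched f|.+2.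
  by rewrite mP !cardsU1 !inE fp fq !eqxx (eq_sym p q) (negbTE qp).
have [||a aP] := IH _ _ (add_arc_partial_matching fP fp fq pq gap).
- have := cardsC (matched (tperm p q * f)%g); rewrite cm card_ord; move=> e.
  have e2 : #|~: matched (tperm p q * f)%g|.+2 = #|~: matched f|.
    by apply: (@addnI #|matched f|); apply: etrans _ (etrans e (esym cf)); rewrite !addnS !addSn.
  by move: fm; rewrite -e2 => /ltnW.
- by rewrite cm /= negbK.
exists a => r fr.
have rp : r != p by apply: contraNneq fr => ->; rewrite fp.
have rq : r != q by apply: contraNneq fr => ->; rewrite fq.
by rewrite aP (add_arcD f rp rq).
Qed.

Lemma card_lt_ord N t : (t <= N)%N -> #|[set p : 'I_N | (p < t)%N]| = t.
Proof.
move=> tN; rewrite -[RHS]card_ord -(card_imset _ (f := widen_ord tN)); last first.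
  by move=> i j /(congr1 val) /= /ord_inj.
apply: eq_card => p; rewrite inE; apply/idP/imsetP => [pt|[i _ ->]]; last by rewrite /=.
by exists (Ordinal pt) => //; apply: ord_inj.
Qed.

(* Scanning from left to right, each point of I is joined to the nearest
   unmatched point on its left, which the ballot condition provides. *)
Lemma ballot_standard n (I : {set 'I_n.*2}) :
  (forall m, (m <= n.*2)%N -> (#|[set i in I | (i < m)%N]|.*2 <= m)%N) -> standard I.
Proof.
move=> ballot.
(* Invariant after [t] points: each point of [I] among them is a right end, and no other arcs have
   been drawn. *)
suff H t : (t <= n.*2)%N -> exists f : {perm 'I_n.*2}, [/\ partial_matching f,
    forall p, f p != p -> (p \in I) || (f p \in I),
    forall i, i \in I -> (i < t)%N -> (f i < i)%N,
    forall p, f p != p -> (p < t)%N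
    & #|matched f| = #|[set i in I | (i < t)%N]|.*2].
  have [f [fP fI fr _ cf]] := H _ (leqnn _).
  have [|a aP] := partial_matching_extend fP; first by rewrite cf odd_double.
  apply/existsP; exists a; apply/dotted_right_endsP => i iI.
  have fi := fr i iI (ltn_ord i).
  rewrite aP ?neq_ltn ?fi //; split=> // p fip pi.
  have fp : f p != p.
    apply/negP => /eqP fp; case: fP => inv _ unc.
    by apply: (unc (f i) p fp fip); rewrite inv.
  by rewrite aP //; apply: fI.
elim: t => [|t IH] tN.
  exists 1%g; split.
  - by split=> [p|i j|i p]; rewrite ?permE //; lia.
  - by move=> p; rewrite perm1 eqxx.
  - by [].
  - by move=> p; rewrite perm1 eqxx.
  have -> : matched (1%g : {perm 'I_n.*2}) = set0.
    by apply/setP=> p; rewrite !inE perm1 eqxx.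
  have -> : [set i in I | (i < 0)%N] = set0 by apply/setP=> p; rewrite !inE ltn0 andbF.
  by rewrite cards0.
have [f [fP fI fr ft cf]] := IH (ltnW tN).
pose m := Ordinal tN; have [mI|mI] := boolP (m \in I); last first.
  have lt_t1 i : i \in I -> (i < t.+1)%N = (i < t)%N.
    move=> iI; rewrite ltnS leq_eqVlt; case: eqP => // e.
    by move: mI; rewrite (_ : m = i) ?iI //; apply: ord_inj.
  exists f; split=> //.
  - by move=> i iI; rewrite lt_t1 //; apply: fr.
  - by move=> p /ft; apply: leqW.
  by rewrite cf; congr (#|pred_of_set _|.*2); apply/setP=> i; rewrite !inE; case: (boolP (i \in I)) => //= /lt_t1 ->.
have fm : f m = m by apply/eqP/negPn/negP => /ft; rewrite ltnn.
have cI : #|[set i in I | (i < t.+1)%N]| = #|[set i in I | (i < t)%N]|.+1.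
  rewrite (cardsD1 m) !inE mI /= ltnS leqnn add1n; congr (#|pred_of_set _|.+1).
  apply/setP=> i; rewrite !inE ltnS leq_eqVlt.
  case: (eqVneq i m) => [->|im] /=; first by rewrite ltnn andbF.
  by congr (_ && _); case: eqP => // e; case/eqP: im; apply: ord_inj.
(* The ballot condition at t + 1 already counts [m], so fewer than t of the t points before [m] are
   matched. *)
have [q0 q0f] : exists q, q \in [set p : 'I_n.*2 | (p < t)%N] :\: matched f.
  apply/set0Pn; rewrite -card_gt0 cardsD (setIidPr _); last by apply/subsetP=> p; rewrite !inE => /ft.
  by rewrite card_lt_ord ?(ltnW tN) // subn_gt0 cf; have := ballot _ tN; rewrite cI; lia.
have [q /= qf qmax] : exists2 q : 'I_n.*2, q \in [set p : 'I_n.*2 | (p < t)%N] :\: matched f &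
    forall r : 'I_n.*2, r \in [set p : 'I_n.*2 | (p < t)%N] :\: matched f -> (r <= q)%N.
  by case: (arg_maxnP (fun p : 'I_n.*2 => val p) q0f) => q qf qmax; exists q.
move: qf; rewrite !inE negbK => /andP[/eqP fq qt].
have gap (r : 'I_n.*2) : (q < r)%N -> (r < m)%N -> f r != r.
  move=> qr rm; apply/negP => /eqP fr'; have := qmax r.
  by rewrite !inE fr' eqxx (rm : (r < t)%N) /= => /(_ isT); lia.
have qm : (q < m)%N by [].
have mP := add_arc_matched fq fm qm.
exists (tperm q m * f)%g; split.
- exact: add_arc_partial_matching.
- move=> p; have [->|pq] := eqVneq p q; first by rewrite (@add_arcL _ _ _ _ fm) mI orbT.
  have [->|pm] := eqVneq p m; first by rewrite mI.
  by rewrite (add_arcD f pq pm); apply: fI.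
- move=> i iI; rewrite ltnS leq_eqVlt => /orP[/eqP it|it].
    by rewrite (_ : i = m) ?(@add_arcR _ _ _ _ fq) //; apply: ord_inj.
  have iq : i != q by apply: contraTneq (fr i iI it) => ->; rewrite fq ltnn.
  by rewrite (add_arcD f iq) ?fr // neq_ltn it.
- move=> p fp; have : p \in matched (tperm q m * f)%g by rewrite inE.
  by rewrite mP !inE => /orP[/eqP ->|/orP[/eqP ->|/ft]] //=; lia.
rewrite mP !cardsU1 !inE fm fq !eqxx cf cI doubleS.
by have -> : (q == m) = false by apply/negbTE; rewrite neq_ltn qm.
Qed.

(** * Vanishing of the Springer relations *)

Section ExtDegree.
Variable T : finType.
Implicit Types (x y P : ext T) (A B C : {set T}).

Definition ext_deg_le d x : Prop := forall C, x C != 0 -> (#|C| <= d)%N.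
Definition ext_homog d x : Prop := forall C, x C != 0 -> #|C| = d.

Lemma ext_mul_coef x y C : (x * y) C != 0 ->
  exists A B, [/\ x A != 0, y B != 0, [disjoint A & B] & A :|: B = C].
Proof.
rewrite [(x * y) C]ext_mulE => nz; apply: contrapT => nAB; case/eqP: nz.
apply: big1 => A _; apply: big1 => B _.
have [->|xA] := eqVneq (x A) 0; first by rewrite mul0r !mulr0.
have [->|yB] := eqVneq (y B) 0; first by rewrite !mulr0.
rewrite /wedge_sign; case: (boolP [disjoint A & B]) => dAB; last by rewrite mul0r mulr0.
by case: (A :|: B =P C) => [AB|_]; [case: nAB; exists A, B | rewrite mul0r].
Qed.

Lemma ext_deg_leM d e x y : ext_deg_le d x -> ext_deg_le e y -> ext_deg_le (d + e) (x * y).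
Proof.
move=> dx ey C /ext_mul_coef[A [B [/dx xA /ey yB _ <-]]].
by apply: leq_trans (leq_add xA yB); rewrite cardsU leq_subr.
Qed.

Lemma ext_homogM d e x y : ext_homog d x -> ext_homog e y -> ext_homog (d + e) (x * y).
Proof.
move=> dx ey C /ext_mul_coef[A [B [/dx xA /ey yB dAB <-]]].
by rewrite cardsU (disjoint_setI0 dAB) cards0 subn0 xA yB.
Qed.

Lemma ext_deg_leD d x y : ext_deg_le d x -> ext_deg_le d y -> ext_deg_le d (x + y).
Proof.
move=> dx dy C; rewrite ffunE; have [x0|/dx //] := eqVneq (x C) 0.
by rewrite x0 add0r => /dy.
Qed.

Lemma ext_deg_leMz d x (m : int) : ext_deg_le d x -> ext_deg_le d (x *~ m).
Proof.
by move=> dx C; rewrite ffunMzE; have [->|/dx //] := eqVneq (x C) 0; rewrite mul0rz eqxx.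
Qed.

Lemma ext_deg_leW d e x : (d <= e)%N -> ext_deg_le d x -> ext_deg_le e x.
Proof. by move=> de dx C /dx /leq_trans; apply. Qed.

Lemma ext_homog_deg d x : ext_homog d x -> ext_deg_le d x.
Proof. by move=> dx C /dx ->. Qed.

Lemma ext_homog_delta A : ext_homog #|A| (ext_delta A).
Proof. by move=> C; rewrite ext_deltaE; case: (C =P A) => [->|]. Qed.

Lemma ext_homog_gen t : ext_homog 1 (ext_gen t).
Proof. by rewrite -(cards1 t); apply: ext_homog_delta. Qed.

Lemma ext_homog1 : ext_homog 0 (1 : ext T).
Proof. by rewrite -(cards0 T); apply: ext_homog_delta. Qed.

Lemma ext_homogMz d x (m : int) : ext_homog d x -> ext_homog d (x *~ m).
Proof.
by move=> dx C; rewrite ffunMzE; have [->|/dx //] := eqVneq (x C) 0; rewrite mul0rz eqxx.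
Qed.

Lemma ext_deg_le_sum (I : finType) d (F : I -> ext T) :
  (forall i, ext_deg_le d (F i)) -> ext_deg_le d (\sum_i F i).
Proof.
move=> dF; elim/big_ind: _ => [C|x y|i _]; [by rewrite ffunE eqxx|exact: ext_deg_leD|exact: dF].
Qed.

(* The two end points of an arc enclosing P contribute nothing in top degree:
   x anticommutes past the top part of P with exactly the sign (-1)^d. *)
Lemma ext_arc_deg d (t : T) (e : int) P : ext_deg_le d P ->
  ext_deg_le d ((1 + ext_gen t *~ e) * P * (1 - ext_gen t *~ (e * (-1) ^+ d))).
Proof.
move=> dP; rewrite [P]ext_sum_delta mulr_sumr mulr_suml; apply: ext_deg_le_sum => A.
have [->|/dP Ad] := eqVneq (P A) 0.
  by rewrite mulr0z mulr0 mul0r => C; rewrite ffunE eqxx.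
rewrite mulrzAr mulrzAl; apply: ext_deg_leMz.
have comm : ext_delta A * ext_gen t = (ext_gen t * ext_delta A) *~ (-1) ^+ #|A|.
  by rewrite ext_delta_comm cards1 andbT signr_odd.
have sq : ext_gen t * ext_delta A * ext_gen t = 0.
  by rewrite -mulrA comm mulrzAr mulrA ext_gen_sqr mul0r mul0rz.
have -> : (1 + ext_gen t *~ e) * ext_delta A * (1 - ext_gen t *~ (e * (-1) ^+ d)) =
    ext_delta A + (ext_gen t * ext_delta A) *~ (e * (1 - (-1) ^+ (#|A| + d))).
  rewrite mulrDl mul1r mulrBr mulr1 mulrDl !mulrzAl !mulrzAr sq !mul0rz addr0.
  rewrite comm -mulrzA -addrA; congr (_ + _); rewrite -mulrzBr; congr (_ *~ _).
  by rewrite mulrBr mulr1 exprD mulrCA.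
apply: ext_deg_leD; first exact/ext_deg_leW/ext_homog_deg/ext_homog_delta.
have [dA|dA] := eqVneq #|A| d.
  rewrite dA addnn -signr_odd odd_double subrr mulr0 mulr0z => C.
  by rewrite ffunE eqxx.
have {dA} Ad' : (1 + #|A| <= d)%N by rewrite add1n ltn_neqAle dA.
apply/ext_deg_leMz/(ext_deg_leW Ad')/ext_homog_deg/ext_homogM; last exact: ext_homog_delta.
exact: ext_homog_gen.
Qed.
End ExtDegree.

Section SpringerRelations.
Variables (n : nat) (a : matching n) (S : {set 'I_n.*2}).
Local Notation T := (circles (glue a a)).
Local Notation pt := 'I_n.*2.

Definition arc_gen (i : pt) : ext T := ext_gen (circle_of (glue a a) i).
Local Notation y := (signed_var arc_gen S).

Lemma arc_gen_partner i : arc_gen (a i) = arc_gen i.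
Proof.
congr ext_gen; apply/eqP; rewrite circle_of_eq; last exact: glue_sym.
by apply: connect1; rewrite /glue matchingK eqxx.
Qed.

(** Extends [f] by [u0] past the last point, so that products and counts run over intervals of
    natural numbers and can be cut there. *)
Definition on_nat (U : Type) (u0 : U) (f : pt -> U) (t : nat) : U :=
  if insub t is Some i then f i else u0.

Lemma on_natE (U : Type) (u0 : U) (f : pt -> U) (i : pt) : on_nat u0 f i = f i.
Proof. by rewrite /on_nat valK. Qed.

Definition interval_prod lo hi : ext T := \prod_(lo <= t < hi) on_nat 1 (fun i => 1 + y i) t.
Definition interval_count (Q : pred pt) lo hi : nat := (\sum_(lo <= t < hi) on_nat 0%N Q t)%N.
(** Meets each arc with exactly one end in [S] once, at that end. *)
Definition single : pred pt := fun i => (i \in S) && (a i \notin S).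

Definition interval_closed lo hi : Prop :=
  forall i : pt, (lo <= i < hi)%N -> (lo <= a i < hi)%N.

Lemma card_below (i : pt) : #|[set j in S | (j < i)%N]| = interval_count [in S] 0 i.
Proof.
rewrite /interval_count big_mkord (big_ord_widen_cond _ predT (on_nat 0%N [in S]) (ltnW (ltn_ord i))).
rewrite -sum1_card big_mkcond [RHS]big_mkcond; apply: eq_bigr => j _ /=.
by rewrite inE on_natE; case: (j \in S); case: (j < i)%N.
Qed.

(** Peels off the leftmost arc: the points beneath it and those to its right are again unions of
    arcs. *)
Lemma interval_closed_inside (i : pt) lo hi : interval_closed lo hi -> lo = i -> (lo < hi)%N ->
  [/\ (lo < a i)%N, (a i < hi)%N, interval_closed lo.+1 (a i) & interval_closed (a i).+1 hi].
Proof.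
move=> cl lo_i lo_hi; subst lo.
have ne (j k : pt) : j != k -> (j : nat) != k by apply: contra => /eqP/ord_inj ->.
have ai : (i < a i < hi)%N.
  have := cl i; rewrite leqnn lo_hi => /(_ isT) /andP[le_i ->].
  by rewrite andbT ltn_neqAle le_i ne // eq_sym matching_neq.
have other (j : pt) : j != i -> j != a i -> ((a j : nat) != i) && ((a j : nat) != a i).
  move=> ji jai; apply/andP; split; apply: ne; last by rewrite (inj_eq (can_inj (matchingK a))).
  by rewrite eq_sym -matching_eq.
case/andP: ai => i_ai ai_hi; split=> // j /andP[lo_j j_hi].
- have ji : j != i by rewrite neq_ltn lo_j orbT.
  have jai : j != a i by rewrite neq_ltn j_hi.
  have := cl j; rewrite (ltnW lo_j) (ltn_trans j_hi ai_hi) => /(_ isT) /andP[i_aj _].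
  have /andP[aji ajai] := other j ji jai.
  rewrite ltn_neqAle eq_sym aji i_aj /=.
  rewrite ltn_neqAle ajai /= leqNgt; apply/negP.
  exact: (matching_noncrossing lo_j j_hi).
have ji : j != i by rewrite neq_ltn (ltn_trans i_ai lo_j) orbT.
have jai : j != a i by rewrite neq_ltn lo_j orbT.
have := cl j; rewrite (ltnW (ltn_trans i_ai lo_j)) j_hi => /(_ isT) /andP[i_aj aj_hi].
have /andP[aji ajai] := other j ji jai.
rewrite aj_hi andbT ltn_neqAle eq_sym ajai leqNgt; apply/negP => aj_ai.
have i_aj' : (i < a j)%N by rewrite ltn_neqAle eq_sym aji.
by apply: (matching_noncrossing i_aj' aj_ai); rewrite matchingK.
Qed.

Lemma signed_var_gen i : exists e : int, y i = arc_gen i *~ e.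
Proof.
rewrite /signed_var; case: ifP => _; last by exists 0.
exists ((-1) ^+ #|[set j in S | (j < i)%N]|).
rewrite -signr_odd -[in RHS]signr_odd.
by case: (odd _); rewrite ?mulr1z ?mul1r //= mulN1r mulrNz mulr1z.
Qed.

Lemma signed_var_homog i : ext_homog 1 (y i).
Proof. by have [e ->] := signed_var_gen i; apply/ext_homogMz/ext_homog_gen. Qed.

Lemma one_plus_deg i : ext_deg_le 1 (1 + y i).
Proof.
apply: ext_deg_leD; last exact/ext_homog_deg/signed_var_homog.
exact/(ext_deg_leW (leq0n 1))/ext_homog_deg/ext_homog1.
Qed.

Lemma one_plus_notin i : i \notin S -> 1 + y i = 1.
Proof. by move=> iS; rewrite /signed_var (negbTE iS) addr0. Qed.

Lemma interval_cat (i : pt) (lo hi : nat) (R' : Type) (idx : R') (op : Monoid.law idx) (F : nat -> R') :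
  lo = i -> (lo < a i)%N -> (a i < hi)%N ->
  \big[op/idx]_(lo <= t < hi) F t =
  op (F i) (op (\big[op/idx]_(lo.+1 <= t < a i) F t)
     (op (F (a i)) (\big[op/idx]_((a i).+1 <= t < hi) F t))).
Proof.
move=> -> i_ai ai_hi; rewrite big_ltn ?(ltn_trans i_ai) //; congr (op _ _).
by rewrite (big_cat_nat i_ai (ltnW ai_hi)) /=; congr (op _ _); rewrite big_ltn.
Qed.

(** Induction along the leftmost arc. With one end in [S] it raises the degree bound by one; with
    two ends it raises it by nothing, thanks to [ext_arc_deg]. The parity claim is carried along
    because the sign between two ends counts points of [S], while [ext_arc_deg] wants the sign of
    the degree bound. *)
Lemma interval_deg lo hi : (hi <= n.*2)%N -> interval_closed lo hi ->
  ext_deg_le (interval_count single lo hi) (interval_prod lo hi) /\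
  odd (interval_count [in S] lo hi) = odd (interval_count single lo hi).
Proof.
have [m] := ubnP (hi - lo); elim: m lo hi => // m IH lo hi hm hin cl.
have [hilo|lohi] := leqP hi lo.
  rewrite /interval_prod /interval_count !big_geq //; split=> //.
  exact/ext_homog_deg/ext_homog1.
pose i := Ordinal (leq_trans lohi hin).
have [i_ai ai_hi cl1 cl2] := interval_closed_inside cl (erefl : lo = i) lohi.
have [||d1 o1] := IH _ _ _ _ cl1; [lia|exact: ltnW|].
have [|d2 o2] := IH _ _ _ hin cl2; first lia.
have cat R' idx op F := @interval_cat i lo hi R' idx op F erefl i_ai ai_hi.
rewrite /interval_prod /interval_count !cat !on_natE.
move: d1 o1 d2 o2; rewrite -/(interval_prod _ _) -!/(interval_count _ _ _).
set P1 := interval_prod _ (a i); set P2 := interval_prod _ hi.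
set s1 := interval_count single _ (a i); set s2 := interval_count single _ hi.
set c1 := interval_count _ _ (a i); set c2 := interval_count _ _ hi.
move=> d1 o1 d2 o2; rewrite !oddD o1 o2 /single matchingK /=.
case: (boolP (i \in S)) => iS; case: (boolP (a i \in S)) => aiS; split; rewrite /= ?add0n.
- rewrite !mulrA; apply: ext_deg_leM => //.
  have [e ye] := signed_var_gen i.
  (* Compared with [y i], the sign of [y (a i)] also counts [i] itself and the [c1] points of [S]
     beneath the arc, and [c1] has the parity of [s1]. *)
  have -> : y (a i) = - (arc_gen i *~ (e * (-1) ^+ s1)).
    have -> : arc_gen i *~ (e * (-1) ^+ s1) = y i *~ (-1) ^+ s1 by rewrite ye -mulrzA.
    rewrite /signed_var iS aiS arc_gen_partner card_below.
    have -> : interval_count [in S] 0 (a i) = (interval_count [in S] 0 i + c1).+1.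
      rewrite /interval_count (big_cat_nat (leq0n i) (ltnW i_ai)) /= -addnS; congr (_ + _)%N.
      by rewrite [LHS](big_ltn (i_ai : (i < a i)%N)) on_natE /= iS add1n.
    rewrite -card_below exprS mulN1r mulNr exprD -mulrA; congr (- _).
    rewrite -(signr_odd _ c1) -(signr_odd _ s1) o1.
    by case: (odd s1); rewrite ?mulr1z ?mul1r //= mulrNz mulr1z mulN1r mulrN.
  by rewrite ye; apply: ext_arc_deg.
- by case: (odd s1); case: (odd s2).
- rewrite (one_plus_notin aiS) mul1r; apply: ext_deg_leM; first exact: one_plus_deg.
  exact: ext_deg_leM.
- by [].
- rewrite (one_plus_notin iS) mul1r; apply: ext_deg_leM => //.
  by apply: ext_deg_leM => //; apply: one_plus_deg.
- by [].
- by rewrite (one_plus_notin iS) (one_plus_notin aiS) !mul1r; apply: ext_deg_leM.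
by [].
Qed.

Lemma prod_signed_var (A : {set pt}) :
  ext_homog #|A| (\prod_(i <- enum A) y i).
Proof.
rewrite cardE; elim: (enum A) => [|i s IH]; first by rewrite big_nil; apply: ext_homog1.
by rewrite big_cons /= -add1n; apply: ext_homogM => //; apply: signed_var_homog.
Qed.

Lemma odd_elem_homog r : ext_homog r (odd_elem arc_gen r S).
Proof.
rewrite /odd_elem => C; rewrite sum_ffunE => nz; apply: contrapT => cC; case/eqP: nz.
apply: big1 => A /eqP cA; apply/eqP/negPn/negP => /prod_signed_var; rewrite cA => /esym.
by move/esym.
Qed.

Lemma prod_one_plus : \prod_(i : pt) (1 + y i) = \sum_(A : {set pt}) \prod_(i <- enum A) y i.
Proof.
transitivity (\prod_(i : pt) (y i + 1)); first by apply: eq_bigr => i _; rewrite addrC.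
rewrite bigA_distr; apply: eq_bigr => A _.
have e : enum pt = index_enum pt by rewrite enumT [index_enum _]unlock.
by rewrite -/(ext_prod y A) ext_prodE e [RHS]big_mkcond.
Qed.

Lemma prod_one_plus_coef (C : {set T}) :
  (\prod_(i : pt) (1 + y i)) C = odd_elem arc_gen #|C| S C.
Proof.
rewrite prod_one_plus /odd_elem !sum_ffunE [RHS]big_mkcond; apply: eq_bigr => A _.
case: eqP => // nAC; apply/eqP/negPn/negP => /prod_signed_var cC; by case: nAC.
Qed.

(** The partner of such an end lies outside [S], and [a] is injective. *)
Lemma single_count : (interval_count single 0 n.*2 <= #|~: S|)%N.
Proof.
rewrite /interval_count big_mkord.
have -> : (\sum_(i < n.*2) on_nat 0%N single i = #|[set i | single i]|)%N.
  rewrite -sum1_card [RHS]big_mkcond; apply: eq_bigr => i _.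
  by rewrite on_natE inE; case: (single i).
rewrite -(card_imset _ (can_inj (matchingK a))); apply: subset_leq_card.
by apply/subsetP=> _ /imsetP[i + ->]; rewrite !inE => /andP[].
Qed.

(** A nonzero coefficient in degree [r] would require at least [r] arcs with exactly one end in [S],
    but only n - k points lie outside [S]. *)
Lemma odd_elem_arc_gen k r : #|S| = (n + k)%N -> (n - k < r)%N ->
  odd_elem arc_gen r S = 0.
Proof.
move=> cS kr; apply/ffunP => C; rewrite [RHS]ffunE; apply/eqP/negPn/negP => nz.
have cC := odd_elem_homog nz; move: nz; rewrite -cC -prod_one_plus_coef => nz.
have cl : interval_closed 0 n.*2 by move=> i _ /=.
have [/(_ C)] := interval_deg (leqnn _) cl.
have -> : interval_prod 0 n.*2 = \prod_(i : pt) (1 + y i).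
  by rewrite /interval_prod big_mkord; apply: eq_bigr => i _; rewrite on_natE.
move=> /(_ nz) le_s _; have := leq_trans le_s single_count.
have := cardsC S; rewrite cS card_ord cC; move: kr.
by move: #|~: S| => c; lia.
Qed.
End SpringerRelations.

(** * Standard monomials span *)

HB.instance Definition _ (m : nat) :=
  GRing.isMonoidMorphism.Build (OPol m) (ext 'I_m) (@opol_ext m) (@opol_ext_monoid m).

Lemma rmorph_odd_elem (R R' : pzRingType) (F : {rmorphism R -> R'}) m (x : 'I_m -> R) r S :
  F (odd_elem x r S) = odd_elem (F \o x) r S.
Proof.
rewrite raddf_sum; apply: eq_bigr => A _.
apply: etrans (big_morph F (rmorphM F) (rmorph1 F) _ _ _) _; apply: eq_bigr => i _.
by rewrite /signed_var; case: ifP => _; rewrite ?raddf0 // rmorphM rmorph_sign.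
Qed.

Lemma eq_odd_elem (R : pzRingType) m (x x' : 'I_m -> R) r S :
  x =1 x' -> odd_elem x r S = odd_elem x' r S.
Proof.
move=> xx; apply: eq_bigr => A _; apply: eq_bigr => i _.
by rewrite /signed_var xx.
Qed.

Lemma mon_subset (R : pzRingType) m (x : 'I_m -> R) (S A : {set 'I_m}) : A \subset S ->
  exists b : nat, mon x S A = ext_prod x A *~ (-1) ^+ b.
Proof.
move=> AS; rewrite /mon /ext_prod.
have : {subset enum A <= S} by move=> i; rewrite mem_enum => /(subsetP AS).
elim: (enum A) => [|i s IH] sS; first by exists 0%N; rewrite !big_nil mulr1z.
have [b e] := IH (fun j js => sS j (mem_behead (s := i :: s) js)).
rewrite !big_cons e /signed_var (sS i (mem_head i s)).
exists (#|[set j in S | (j < i)%N]| + b)%N.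
have signE k (z : R) : (-1) ^+ k * z = z *~ (-1) ^+ k.
  rewrite -signr_odd -[in RHS]signr_odd; case: (odd k); rewrite ?mulr1z ?mul1r //=.
  by rewrite mulrNz mulr1z mulN1r.
by rewrite signE mulrz_lift -exprD.
Qed.

Section Spanning.
Variable n : nat.
Local Notation pt := 'I_n.*2.
Implicit Types (A B S T : {set pt}) (x : OHB n).
Local Notation xprod := (ext_prod (@ohb_var n)).

Definition index_sum A : nat := (\sum_(i in A) i)%N.

Definition std_span x : Prop :=
  exists c : {set pt} -> int, x = \sum_(A | standard A) xprod A *~ c A.

Lemma std_span0 : std_span 0.
Proof. by exists (fun=> 0); rewrite big1 // => A _; rewrite mulr0z. Qed.

Lemma std_spanD x y : std_span x -> std_span y -> std_span (x + y).
Proof.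
move=> [c ->] [d ->]; exists (fun A => c A + d A).
by rewrite -big_split; apply: eq_bigr => A _; rewrite mulrzDr.
Qed.

Lemma std_spanMz x m : std_span x -> std_span (x *~ m).
Proof.
move=> [c ->]; exists (fun A => c A * m).
by rewrite mulrz_suml; apply: eq_bigr => A _; rewrite mulrzA.
Qed.

Lemma std_span_standard A : standard A -> std_span (xprod A).
Proof.
move=> sA; exists (fun B => (B == A)%:R); rewrite (bigD1 A) //= eqxx mulr1z big1 ?addr0 //.
by move=> B /andP[_ /negbTE ->]; rewrite mulr0z.
Qed.

Lemma index_sum_le A : (index_sum A <= index_sum [set: pt])%N.
Proof.
rewrite /index_sum big_mkcond [leqRHS]big_mkcond; apply: leq_sum => i _.
by rewrite inE; case: ifP.
Qed.

Lemma index_sumU A B : [disjoint A & B] -> index_sum (A :|: B) = (index_sum A + index_sum B)%N.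
Proof. by move=> dAB; rewrite /index_sum -bigU //; apply: eq_bigl => i; rewrite !inE. Qed.

(** The common elements cancel, and [m] separates the rest: those of [T] lie below it, those of [B]
    at or above it. *)
Lemma index_sum_exchange (m : nat) T B : #|B| = #|T| -> B != T ->
  (forall i, i \in T -> (i < m)%N) -> (forall i, i \in B -> i \notin T -> (m <= i)%N) ->
  (index_sum T < index_sum B)%N.
Proof.
move=> cBT BT Tm Bm.
have eT : index_sum T = (index_sum (T :&: B) + index_sum (T :\: B))%N.
  by rewrite -index_sumU ?setID // -setI_eq0 setDE setIACA setICr setI0.
have eB : index_sum B = (index_sum (T :&: B) + index_sum (B :\: T))%N.
  by rewrite [T :&: B]setIC -index_sumU ?setID // -setI_eq0 setDE setIACA setICr setI0.
have cD : #|T :\: B| = #|B :\: T|.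
  by move: cBT; rewrite -(cardsID T B) -(cardsID B T) [B :&: T]setIC => /addnI.
have c0 : (0 < #|T :\: B|)%N.
  rewrite card_gt0; apply: contraNneq BT => TB0.
  have BT0 : B :\: T = set0 by apply/eqP; rewrite -cards_eq0 -cD TB0 cards0.
  by apply/eqP/setP => i; apply/idP/idP; apply: subsetP i; rewrite -setD_eq0 ?BT0 ?TB0.
have leB : (m * #|B :\: T| <= index_sum (B :\: T))%N.
  rewrite mulnC -sum_nat_const; apply: leq_sum => i; rewrite inE => /andP[iT iB].
  exact: Bm.
have leT : (index_sum (T :\: B) + #|T :\: B| <= m * #|T :\: B|)%N.
  rewrite -[X in (_ + X <= _)%N]sum1_card /index_sum -big_split mulnC -sum_nat_const /=.
  by apply: leq_sum => i; rewrite inE addn1 => /andP[_ /Tm].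
by move: c0 leT leB; rewrite eT eB cD; move: #|_|; nia.
Qed.

Lemma ohb_odd_elem k S r : (1 <= k <= n)%N -> #|S| = (n + k)%N -> (n - k < r)%N ->
  odd_elem (@ohb_var n) r S = 0.
Proof.
move=> kn cS kr; have oi := OI_odd_elem kn cS kr.
apply: etrans (esym (rmorph_odd_elem (@ohb_proj n) (@opol_var n.*2) r S)) _.
apply: etrans _ (raddf0 (@ohb_proj n)).
by apply/(quot_projP (springer_ideal n)); rewrite subr0.
Qed.

(* With m minimal such that A has more than m/2 elements below m, and T these
   elements, the generator of degree #|T| for T together with all the points
   above m rewrites x_T in terms of products with larger index sums. *)
Lemma std_span_prod A : std_span (xprod A).
Proof.
have [k] := ubnP (index_sum [set: pt] - index_sum A); elim: k A => // k IH A Ak.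
have [/std_span_standard //|nsA] := boolP (standard A).
pose c m := #|[set i in A | (i < m)%N]|.
have [m /andP[mn mc] min_m] : {m | (m <= n.*2)%N && (m < (c m).*2)%N &
    forall m', (m' <= n.*2)%N && (m' < (c m').*2)%N -> (m <= m')%N}.
  have ex : exists m, (m <= n.*2)%N && (m < (c m).*2)%N.
    apply: contrapT => nex; move/negP: nsA; apply; apply: ballot_standard => m mn.
    by rewrite leqNgt; apply/negP => mc; apply: nex; exists m; rewrite mn.
  by case: (ex_minnP ex) => m H min_m; exists m.
pose T := [set i in A | (i < m)%N].
have m0 : (0 < m)%N.
  rewrite lt0n; apply/eqP => m0; move: mc; rewrite m0 /c (_ : [set _ in _ | _] = set0) ?cards0 //.
  by apply/setP=> i; rewrite !inE ltn0 andbF.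
have cT : (#|T|.*2 = m.+1)%N.
  have m1 : (m.-1 < n.*2)%N by rewrite prednK.
  have c_le : (c m <= (c m.-1).+1)%N.
    apply: (@leq_trans #|Ordinal m1 |: [set i in A | (i < m.-1)%N]|).
      apply/subset_leq_card/subsetP => i; rewrite !inE -{1}(prednK m0) ltnS leq_eqVlt.
      move=> /andP[-> /orP[/eqP im|->]]; last by rewrite orbT.
      by rewrite (_ : i = Ordinal m1) ?eqxx //; apply: ord_inj.
    by rewrite cardsU1 -add1n leq_add2r leq_b1.
  have c_pred : ((c m.-1).*2 <= m.-1)%N.
    rewrite leqNgt; apply/negP => h; have := min_m m.-1; rewrite (ltnW m1) h => /(_ isT).
    by rewrite leqNgt prednK // leqnn.
  change (#|T|) with (c m); lia.
pose S := T :|: [set i : pt | (m <= i)%N].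
have cS : #|S| = (n + (n.+1 - #|T|))%N.
  rewrite cardsU (_ : _ :&: _ = set0) ?cards0 ?subn0; last first.
    by apply/setP=> i; rewrite !inE [(m <= i)%N]leqNgt; case: (i < m)%N; rewrite ?andbF.
  have := cardsC [set i : pt | (i < m)%N]; rewrite card_lt_ord // card_ord.
  have -> : ~: [set i : pt | (i < m)%N] = [set i : pt | (m <= i)%N].
    by apply/setP=> i; rewrite !inE -leqNgt.
  by move: cT; move: #|T| #|[set i : pt | _]| => u v; lia.
(* With k = n + 1 - #|T|, the relations for [S] start in degree n - k + 1 = #|T|, the one used
   here. *)
have rel : odd_elem (@ohb_var n) #|T| S = 0.
  apply: (ohb_odd_elem (k := (n.+1 - #|T|)%N)) => //; move: cT; move: #|T| => u; lia.
pose A' := A :\: T.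
have TA : T \subset A by apply/subsetP=> i; rewrite inE => /andP[].
have AE : A = T :|: A'.
  apply/setP => i; rewrite /A' in_setU in_setD.
  by case: (boolP (i \in T)) => //= /(subsetP TA) ->.
have dTA : [disjoint T & A'].
  rewrite -setI_eq0; apply/eqP/setP => i; rewrite /A' in_setI in_setD in_set0.
  by case: (i \in T).
have xP := ohb_var_anticommuting n.
have sg (w : nat) x : std_span (x *~ (-1) ^+ w) -> std_span x.
  by move=> /(std_spanMz ((-1) ^+ w)); rewrite -mulrzA -expr2 sqrr_sign mulr1z.
have xA : xprod T * xprod A' = xprod A *~ (-1) ^+ #|inversions T A'|.
  by rewrite ext_prodM // -AE /wedge_sign dTA.
apply: (sg #|inversions T A'|); rewrite -xA.
have [b eb] := mon_subset (@ohb_var n) (subsetUl T [set i : pt | (m <= i)%N]).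
apply: (sg b); rewrite -mulrzAl -eb.
move: rel; rewrite odd_elemE (bigD1 T) //= => /eqP; rewrite addr_eq0 => /eqP ->.
rewrite mulNr -mulrN1z; apply: std_spanMz.
rewrite mulr_suml; elim/big_ind: _ => [|x y|B /andP[/eqP cB BT]]; [exact: std_span0|exact: std_spanD|].
have [BS|/subsetPn[j jB jS]] := boolP (B \subset S); last first.
  by rewrite (mon_notsub _ jB jS) mul0r; apply: std_span0.
have [b' ->] := mon_subset (@ohb_var n) BS.
rewrite mulrzAl; apply: std_spanMz; rewrite ext_prodM // /wedge_sign.
have [dBA|_] := boolP [disjoint B & A']; last by rewrite mulr0z; apply: std_span0.
apply/std_spanMz/IH.
have lt : (index_sum A < index_sum (B :|: A'))%N.
  rewrite index_sumU // {1}AE index_sumU // ltn_add2r.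
  apply: (index_sum_exchange (m := m)) => // i; first by rewrite inE => /andP[].
  by move=> iB iT; have := subsetP BS i iB; rewrite inE (negbTE iT) /= inE.
exact: leq_trans (ltn_sub2l (leq_trans lt (index_sum_le _)) lt) Ak.
Qed.
End Spanning.

(** * Compatible families are determined by standard coefficients *)

Section NestedSwap.
Variables (n : nat) (b : matching n) (i j k l : 'I_n.*2).
Hypotheses (bi : b i = l) (bj : b j = k) (ij : (i < j)%N) (jk : (j < k)%N) (kl : (k < l)%N).
Hypothesis direct : forall x : 'I_n.*2, (i < x)%N -> (x < j)%N -> (k < b x)%N -> (b x < l)%N -> False.

Definition swap_points : {set 'I_n.*2} := [set i; j; k; l].

(** An arc crossing (i,j) or (k,l) either crosses one of the old arcs or joins the two gaps between
    them; [direct] excludes the latter. *)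
Lemma matching_swap : exists a : matching n,
  [/\ a i = j, a j = i, a k = l, a l = k & forall x, x \notin swap_points -> a x = b x].
Proof.
have ne (x y : 'I_n.*2) : (x < y)%N -> (x == y) = false /\ (y == x) = false.
  by move=> xy; rewrite -!val_eqE /=; split; apply/negbTE; rewrite neq_ltn xy ?orbT.
have [nij nji] := ne _ _ ij; have [njk nkj] := ne _ _ jk; have [nkl nlk] := ne _ _ kl.
have [nik nki] := ne _ _ (ltn_trans ij jk); have [njl nlj] := ne _ _ (ltn_trans jk kl).
have [nil' nli] := ne _ _ (ltn_trans ij (ltn_trans jk kl)).
have bl : b l = i by rewrite -bi matchingK.
have bk : b k = j by rewrite -bj matchingK.
pose f x := if x == i then j else if x == j then i else if x == k then l
            else if x == l then k else b x.
have fi : f i = j by rewrite /f eqxx.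
have fj : f j = i by rewrite /f nji eqxx.
have fk : f k = l by rewrite /f nki nkj eqxx.
have fl : f l = k by rewrite /f nli nlj nlk eqxx.
have fD x : x \notin swap_points -> f x = b x.
  by rewrite /f !inE !negb_or -!andbA => /and4P[/negbTE-> /negbTE-> /negbTE-> /negbTE->].
have swapP x : [\/ x = i, x = j, x = k | x = l] \/ x \notin swap_points.
  rewrite /swap_points !inE.
  case: (eqVneq x i) => [|_]; first by left; constructor 1.
  case: (eqVneq x j) => [|_]; first by left; constructor 2.
  case: (eqVneq x k) => [|_]; first by left; constructor 3.
  by case: (eqVneq x l) => [|_]; [left; constructor 4 | right].
have bD x : x \notin swap_points -> b x \notin swap_points.
  apply: contra; rewrite !inE -!orbA => /or4P[] /eqP e; rewrite -[x](matchingK b) e.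
  - by rewrite bi eqxx !orbT.
  - by rewrite bj eqxx !orbT.
  - by rewrite bk eqxx !orbT.
  by rewrite bl eqxx.
have val_ne (x : 'I_n.*2) : x \notin swap_points ->
    [/\ x != i :> nat, x != j :> nat, x != k :> nat & x != l :> nat].
  by rewrite !inE !negb_or -!andbA => /and4P[].
have hb := @matching_noncrossing _ b.
have fc : crossingless [ffun x => f x].
  apply/andP; split.
    apply/forallP => x; rewrite !ffunE.
    case: (swapP x) => [[]->|xQ]; rewrite ?(fi, fj, fk, fl) ?nij ?nji ?nkl ?nlk ?eqxx //.
    by rewrite fD // matching_neq fD ?matchingK ?eqxx // bD.
  apply/forallP => x; apply/forallP => y; rewrite !ffunE; apply/negP => /and3P[].
  case: (swapP x) => [[]->|xQ]; rewrite ?(fi, fj, fk, fl).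
  - case: (swapP y) => [[]->|yQ]; rewrite ?(fi, fj, fk, fl); try (clear -ij jk kl; lia).
    rewrite fD // => iy yj jby; have [byi byj byk byl] := val_ne _ (bD _ yQ).
    have [lby|lby] := ltnP l (b y); first by apply: (hb i y); rewrite ?bi //; clear -ij jk kl iy yj lby byl; lia.
    have [kby|kby] := ltnP k (b y); first by apply: (direct iy yj kby); clear -lby byl; lia.
    by apply: (hb y j); rewrite ?bj //; clear -jby kby byk; lia.
  - by move=> jy yi _; clear -ij jy yi; lia.
  - case: (swapP y) => [[]->|yQ]; rewrite ?(fi, fj, fk, fl); try (clear -ij jk kl; lia).
    by rewrite fD // => ky yl lby; apply: (hb i y); rewrite ?bi //; clear -ij jk ky; lia.
  - by move=> ly yk _; clear -kl ly yk; lia.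
  rewrite (fD _ xQ); have [xi xj xk xl] := val_ne _ xQ.
  case: (swapP y) => [[]->|yQ]; rewrite ?(fi, fj, fk, fl).
  - by move=> xi' ibx bxj; apply: (hb x i); rewrite ?bi //; clear -bxj jk kl; lia.
  - by move=> xj' jbx bxi; clear -ij jbx bxi; lia.
  - move=> xk' kbx bxl; have [x_i|i_x] := ltnP x i.
      by apply: (hb x i); rewrite ?bi //; clear -kbx ij jk; lia.
    have [x_j|j_x] := ltnP x j; first by apply: (direct (x := x)) => //; clear -i_x xi; lia.
    by apply: (hb j x); rewrite ?bj //; clear -j_x xj; lia.
  - by move=> xl' lbx bxk; clear -kl lbx bxk; lia.
  by rewrite (fD _ yQ); apply: hb.
by exists (Matching fc); split=> [||||x xQ]; rewrite /= ffunE // fD.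
Qed.
End NestedSwap.

Section ArcCircles.
Variable n : nat.
Implicit Types (a b d : matching n) (i j x y : 'I_n.*2) (X : {set 'I_n.*2}).

Lemma glue_connect_closed b a X x y : (forall u, u \in X -> (a u \in X) && (b u \in X)) ->
  x \in X -> connect (glue b a) x y -> y \in X.
Proof.
move=> clX xX /connectP[p + ->]; elim: p x xX => //= u p IH x xX /andP[xu].
apply: IH; move: xu; rewrite /glue => /orP[] /eqP ->; by case/andP: (clX _ xX).
Qed.

(** An arc common to both matchings closes up to a circle of its own. *)
Lemma glue_circle_common b a x y : a x = b x ->
  circle_of (glue b a) x = circle_of (glue b a) y -> (y == x) || (y == b x).
Proof.
move=> abx /eqP; rewrite circle_of_eq; last exact: glue_sym.
move/(glue_connect_closed (X := [set x; b x])); rewrite !inE eqxx; apply=> // u.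
by rewrite !inE => /orP[] /eqP ->; rewrite ?abx -?abx ?matchingK abx ?matchingK !eqxx ?orbT.
Qed.

Definition arc_circle a i : circles (glue a a) := circle_of (glue a a) i.

Lemma arc_circle_partner a i : arc_circle a (a i) = arc_circle a i.
Proof.
apply/eqP; rewrite circle_of_eq; last exact: glue_sym.
by apply: connect1; rewrite /glue matchingK eqxx.
Qed.

Lemma arc_circle_eq a x y : arc_circle a x = arc_circle a y -> (y == x) || (y == a x).
Proof. exact: glue_circle_common. Qed.

Lemma arc_circleP a (c : circles (glue a a)) : exists i, c = arc_circle a i.
Proof. by exists (circle_pt c); rewrite /arc_circle circle_ptK. Qed.

(** With truncated subtraction one of the two terms is zero, so this is the distance between the
    ends, whichever end [i] is. *)
Definition arc_len a i : nat := ((a i - i) + (i - a i))%N.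

Lemma arc_len_partner a i : arc_len a (a i) = arc_len a i.
Proof. by rewrite /arc_len matchingK addnC. Qed.

Definition circle_len a (c : circles (glue a a)) : nat := arc_len a (circle_pt c).

Lemma circle_len_arc a i : circle_len (arc_circle a i) = arc_len a i.
Proof.
rewrite /circle_len; have := circle_ptK (arc_circle a i).
by move/esym/arc_circle_eq => /orP[] /eqP ->; rewrite ?arc_len_partner.
Qed.

Definition merge_circle d b a (c : circles (glue d d)) : circles (glue b a) :=
  circle_map (glue b a) id c.
End ArcCircles.

(** Over each point of the common image, [A1] has one element and [A2] at least one, so the sums are
    compared fibre by fibre. The weights are arc lengths in one use and indices of points in
    another. *)
Lemma sum_weight_lt (U1 U2 V : finType) (f1 : U1 -> V) (f2 : U2 -> V)
    (A1 : {set U1}) (A2 : {set U2}) (w1 : U1 -> nat) (w2 : U2 -> nat) :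
  {in A1 &, injective f1} -> f1 @: A1 = f2 @: A2 ->
  (forall c1 c2, c1 \in A1 -> c2 \in A2 -> f1 c1 = f2 c2 -> (w1 c1 <= w2 c2)%N) ->
  (exists2 c1, c1 \in A1 &
     forall c2, c2 \in A2 -> f1 c1 = f2 c2 -> (w1 c1 < w2 c2)%N) ->
  (\sum_(c in A1) w1 c < \sum_(c in A2) w2 c)%N.
Proof.
move=> inj1 im12 le12 [c1 c1A lt12].
pose M v := (\sum_(c in A2 | f2 c == v) w2 c)%N.
have leM c2 : c2 \in A2 -> (w2 c2 <= M (f2 c2))%N.
  by move=> c2A; rewrite /M (bigD1 c2) ?c2A ?eqxx //= leq_addr.
have ex c : c \in A1 -> exists2 c2, c2 \in A2 & f1 c = f2 c2.
  by move=> cA; apply/imsetP; rewrite -im12 imset_f.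
have -> : (\sum_(c in A2) w2 c = \sum_(c in A1) M (f1 c))%N.
  rewrite (partition_big_imset f2) /= -im12.
  exact: (big_imset (fun v => M v) inj1).
rewrite (bigD1 c1) //= [leqRHS](bigD1 c1) //= -addSn; apply: leq_add.
  have [c2 c2A e] := ex _ c1A; apply: leq_trans (lt12 _ c2A e) _.
  by rewrite e leM.
apply: leq_sum => c /andP[cA _]; have [c2 c2A e] := ex _ cA.
by apply: leq_trans (le12 _ _ cA c2A e) _; rewrite e leM.
Qed.

Section Vanishing.
Variables (n : nat) (z : OH n).
Hypothesis zC : compatible z.
Implicit Types (a b : matching n) (I : {set 'I_n.*2}).

Definition dotted_coef a (A : {set circles (glue a a)}) : int := oh_at a a z A.

Lemma merge_circle_arc b a d i : d = b \/ d = a ->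
  merge_circle b a (arc_circle d i) = circle_of (glue b a) i.
Proof. exact: merge_map_circle. Qed.

(** Compatibility is read at the image of [A0] in W(b)a: the hypotheses leave a single term there,
    the coefficient of [A0] up to sign. *)
Lemma compatible_coef b a (A0 : {set circles (glue b b)}) :
  {in A0 &, injective (merge_circle (d := b) b a)} ->
  (forall A : {set circles (glue b b)}, A != A0 -> #|A| = #|A0| ->
     merge_circle b a @: A = merge_circle b a @: A0 -> dotted_coef A = 0) ->
  (forall A : {set circles (glue a a)}, #|A| = #|A0| ->
     merge_circle b a @: A = merge_circle b a @: A0 -> dotted_coef A = 0) ->
  dotted_coef A0 = 0.
Proof.
move=> inj0 zb za; have /ffunP/(_ (merge_circle b a @: A0)) := zC.2 b a.
rewrite /merge_map.
have [s ->] := ext_map_coef (circle_map (glue b a) id) (oh_at b b z) (merge_circle b a @: A0).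
have [t ->] := ext_map_coef (circle_map (glue b a) id) (oh_at a a z) (merge_circle b a @: A0).
have cF := card_in_imset inj0.
rewrite [X in _ = X]big1; last first.
  move=> A /andP[/eqP eA /eqP cA]; have -> : oh_at a a z A = 0; last by rewrite mul0r.
  by apply: za; [rewrite cA cF|exact: eA].
rewrite (bigD1 A0) /=; last by rewrite eqxx cF eqxx.
rewrite big1 ?addr0; last first.
  move=> A /andP[/andP[/eqP eA /eqP cA] nA]; have -> : oh_at b b z A = 0; last by rewrite mul0r.
  by apply: zb; [exact: nA|rewrite cA cF|exact: eA].
by rewrite /dotted_coef => /(congr1 (fun u => u * (-1) ^+ s A0)); rewrite -mulrA -expr2 sqrr_sign mulr1 mul0r.
Qed.

Definition right_end_circles a I : {set circles (glue a a)} := [set arc_circle a i | i in I].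

(** The dotted arcs belong to both matchings, hence are separate circles of W(b)a; on each side only
    this one dotting has their set as image. *)
Lemma right_end_circles_transfer a b I : {in I, a =1 b} ->
  dotted_coef (right_end_circles a I) = 0 -> dotted_coef (right_end_circles b I) = 0.
Proof.
move=> ab z0.
have common i x : i \in I -> circle_of (glue b a) x = circle_of (glue b a) i ->
    arc_circle b x = arc_circle b i /\ arc_circle a x = arc_circle a i.
  move=> iI /esym /(glue_circle_common (ab i iI)) /orP[] /eqP -> //.
  by split; [|rewrite -ab //]; rewrite arc_circle_partner.
have im d (A : {set circles (glue d d)}) : d = b \/ d = a ->
    merge_circle b a @: A = merge_circle b a @: right_end_circles b I ->
    A = right_end_circles d I.
  move=> dba e; apply/setP => c; have [x ->] := arc_circleP c.
  have cd i : i \in I -> circle_of (glue b a) x = circle_of (glue b a) i ->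
      arc_circle d x = arc_circle d i.
    by move=> iI /(common _ _ iI) [xb xa]; case: dba => ->.
  apply/idP/idP => [cA|/imsetP[i iI ->]].
    have : merge_circle b a (arc_circle d x) \in merge_circle b a @: A by rewrite imset_f.
    rewrite e => /imsetP[_ /imsetP[i iI ->]].
    rewrite (merge_circle_arc _ dba) merge_circle_arc; last by left.
    by move/(cd i iI) ->; rewrite imset_f.
  have : merge_circle b a (arc_circle b i) \in merge_circle b a @: right_end_circles b I.
    by rewrite !imset_f.
  rewrite -e => /imsetP[c' c'A]; have [y ec] := arc_circleP c'; subst c'.
  rewrite (merge_circle_arc _ dba) merge_circle_arc; last by left.
  move/esym/(common _ _ iI) => [yb ya]; case: dba => dd; subst d; first by rewrite -yb.
  by rewrite -ya.
apply: (@compatible_coef b a) => [c c' /imsetP[i iI ->] /imsetP[i' iI' ->]|A nA _ e|A _ e].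
- by rewrite !merge_circle_arc; [move/(common _ _ iI') => [] | left..].
- by case/negP: nA; apply/eqP/im; [left|exact: e].
by rewrite (im a A) //; right.
Qed.

(* The relation comparing b with the matching a in which the nested arcs
   (i,l) and (j,k) of b are replaced by (i,j) and (k,l). *)
Lemma swap_vanishing b i j k l (A0 : {set circles (glue b b)}) :
  b i = l -> b j = k -> (i < j)%N -> (j < k)%N -> (k < l)%N ->
  (forall x : 'I_n.*2, (i < x)%N -> (x < j)%N -> (k < b x)%N -> (b x < l)%N -> False) ->
  arc_circle b l \in A0 -> arc_circle b k \notin A0 ->
  (forall a (A : {set circles (glue a a)}),
     (\sum_(c in A) circle_len c < \sum_(c in A0) circle_len c)%N -> dotted_coef A = 0) ->
  dotted_coef A0 = 0.
Proof.
move=> bi bj ij jk kl direct lA kA IH.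
have bl : b l = i by rewrite -bi matchingK.
have bk : b k = j by rewrite -bj matchingK.
have [a [ai aj ak al aD]] := matching_swap bi bj ij jk kl direct.
pose Q := swap_points i j k l.
have Qcl u : u \in Q -> (a u \in Q) && (b u \in Q).
  by rewrite !inE -!orbA => /or4P[] /eqP ->; rewrite ?(ai, aj, ak, al) ?(bi, bj, bk, bl) !eqxx ?orbT.
have lenQa x : x \in Q -> (arc_len a x < l - i)%N.
  rewrite !inE -!orbA /arc_len => /or4P[] /eqP ->; rewrite ?(ai, aj, ak, al);
  clear -ij jk kl; lia.
have lenQb x : x \in Q -> (arc_circle b x = arc_circle b k /\ (arc_len b x < l - i)%N) \/
    (arc_circle b x = arc_circle b l /\ arc_len b x = (l - i)%N).
  have ci : arc_circle b i = arc_circle b l by rewrite -bl arc_circle_partner.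
  have cj : arc_circle b j = arc_circle b k by rewrite -bk arc_circle_partner.
  rewrite !inE -!orbA /arc_len => /or4P[] /eqP ->; rewrite ?(bi, bj, bk, bl) ?ci ?cj;
  by [left; split=> //; clear -ij jk kl; lia | right; split=> //; clear -ij jk kl; lia].
have lenD x : x \notin Q -> arc_len a x = arc_len b x by move=> xQ; rewrite /arc_len aD.
have sameQ x y : circle_of (glue b a) x = circle_of (glue b a) y -> x \in Q -> y \in Q.
  move/eqP; rewrite circle_of_eq; last exact: glue_sym.
  by move=> xy xQ; apply: glue_connect_closed xQ xy.
have sameD x y : circle_of (glue b a) x = circle_of (glue b a) y -> x \notin Q ->
    (y == x) || (y == b x).
  by move=> xy xQ; apply: glue_circle_common xy; rewrite aD.
have lQ : l \in Q by rewrite !inE eqxx !orbT.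
have kQ : k \in Q by rewrite !inE eqxx !orbT.
have toQ x y : x \in Q -> y \in Q -> circle_of (glue b a) x = circle_of (glue b a) y.
  have step u v : (v == a u) || (v == b u) -> circle_of (glue b a) u = circle_of (glue b a) v.
    move=> uv; apply/eqP; rewrite circle_of_eq; last exact: glue_sym.
    exact: connect1.
  have il : circle_of (glue b a) i = circle_of (glue b a) l by apply: step; rewrite bi eqxx orbT.
  have jl : circle_of (glue b a) j = circle_of (glue b a) l.
    by rewrite -il; apply: step; rewrite aj eqxx.
  have kl' : circle_of (glue b a) k = circle_of (glue b a) l by apply: step; rewrite ak eqxx.
  have all_l u : u \in Q -> circle_of (glue b a) u = circle_of (glue b a) l.
    by rewrite !inE -!orbA => /or4P[] /eqP ->.
  by move=> /all_l -> /all_l ->.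
have lenA0 y : y \in Q -> arc_circle b y \in A0 -> arc_circle b y = arc_circle b l /\ arc_len b y = (l - i)%N.
  by move=> yQ yA; case: (lenQb y yQ) => // -[e _]; rewrite e (negbTE kA) in yA.
have injA0 : {in A0 &, injective (merge_circle (d := b) b a)}.
  move=> c c'; have [x ->] := arc_circleP c; have [y ->] := arc_circleP c'.
  move=> xA yA; rewrite !merge_circle_arc; try by left.
  move=> e; have [xQ|xQ] := boolP (x \in Q).
    by rewrite (lenA0 x xQ xA).1 (lenA0 y (sameQ _ _ e xQ) yA).1.
  by case/orP: (sameD _ _ e xQ) => /eqP ->; rewrite ?arc_circle_partner.
have lA_im d (A : {set circles (glue d d)}) : d = b \/ d = a ->
    merge_circle b a @: A = merge_circle b a @: A0 ->
    exists2 x, arc_circle d x \in A & x \in Q.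
  move=> dba e; have : merge_circle b a (arc_circle b l) \in merge_circle b a @: A0.
    exact: imset_f.
  rewrite -e => /imsetP[c cA]; have [x ec] := arc_circleP c; subst c.
  rewrite (merge_circle_arc _ dba) merge_circle_arc; last by left.
  by move=> elx; exists x => //; apply: sameQ elx lQ.
have injA d (A : {set circles (glue d d)}) : #|A| = #|A0| ->
    merge_circle b a @: A = merge_circle b a @: A0 ->
    {in A &, injective (merge_circle (d := d) b a)}.
  move=> cA e; apply/imset_injP; rewrite e (card_in_imset injA0) cA //.
(* Every other contribution is lighter: in [b] it dots (j,k) instead of (i,l), and in [a] it dots
   (i,j) or (k,l), each shorter than l - i. The arcs outside [Q] are common to both matchings. *)
apply: (@compatible_coef b a); [exact: injA0|move=> A nA cA e|move=> A cA e].
- apply: (IH b); apply: (@sum_weight_lt _ _ _ (merge_circle b a) (merge_circle b a)); [exact: injA|exact: e| |].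
  + move=> c c'; have [x ->] := arc_circleP c; have [y ->] := arc_circleP c'.
    move=> xA yA; rewrite !merge_circle_arc; try by left.
    move=> exy; rewrite !circle_len_arc; have [yQ|yQ] := boolP (y \in Q).
      rewrite (lenA0 y yQ yA).2; case: (lenQb x (sameQ _ _ (esym exy) yQ)) => -[_] //; last by move=> ->.
      exact: ltnW.
    by case/orP: (sameD _ _ (esym exy) yQ) => /eqP ->; rewrite ?arc_len_partner.
  have {injA} [c cA' cA0] : exists2 c, c \in A & c \notin A0.
    apply/subsetPn; apply: contra nA => sub; by rewrite eqEcard sub cA leqnn.
  exists c; [exact: cA'|move=> c'; move: cA' cA0].
  have [x ->] := arc_circleP c; have [y ->] := arc_circleP c'.
  move=> xA xA0 yA; rewrite !merge_circle_arc; try by left.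
  move=> exy; rewrite !circle_len_arc; have [yQ|yQ] := boolP (y \in Q).
    rewrite (lenA0 y yQ yA).2; case: (lenQb x (sameQ _ _ (esym exy) yQ)) => -[ex] //.
    by move: xA0; rewrite ex lA.
  case/negP: xA0; case/orP: (sameD _ _ (esym exy) yQ) => /eqP -> //.
  by rewrite arc_circle_partner.
apply: (IH a); apply: (@sum_weight_lt _ _ _ (merge_circle b a) (merge_circle b a)); [exact: injA|exact: e| |].
- move=> c c'; have [x ->] := arc_circleP c; have [y ->] := arc_circleP c'.
  move=> xA yA; rewrite merge_circle_arc; last by right.
  rewrite merge_circle_arc; last by left.
  move=> exy; rewrite !circle_len_arc; have [yQ|yQ] := boolP (y \in Q).
    rewrite (lenA0 y yQ yA).2; apply: ltnW; apply: lenQa.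
    exact: (sameQ _ _ (esym exy) yQ).
  have xQ : x \notin Q by apply: contra yQ; apply: sameQ.
  by rewrite lenD //; case/orP: (sameD _ _ (esym exy) yQ) => /eqP ->; rewrite ?arc_len_partner.
have [x xA xQ] := lA_im a A (or_intror erefl) e.
exists (arc_circle a x); [exact: xA|move=> c']; have [y ->] := arc_circleP c' => yA.
rewrite merge_circle_arc; last by right.
rewrite merge_circle_arc; last by left.
move=> exy; rewrite !circle_len_arc (lenA0 y (sameQ _ _ exy xQ) yA).2.
exact: lenQa.
Qed.

Hypothesis z0 : forall a I, dotted_right_ends a I -> dotted_coef (right_end_circles a I) = 0.

(** Induction on the total length of the dotted arcs. A dotting that is not standard has an undotted
    arc beneath a dotted one, and a closest such pair satisfies the conditions of
    [swap_vanishing]. *)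
Lemma dotted_coef_eq0 b (A : {set circles (glue b b)}) : dotted_coef A = 0.
Proof.
have [w] := ubnP (\sum_(c in A) circle_len c); elim: w b A => // w IH b A Aw.
pose I := [set p | (arc_circle b p \in A) && (b p < p)%N].
have AI : A = right_end_circles b I.
  apply/setP=> c; have [x ->] := arc_circleP c; apply/idP/imsetP => [xA|[y]].
    case: (ltngtP (b x) x) => [lt|gt|/ord_inj e]; last by have := matching_neq b x; rewrite e eqxx.
      by exists x => //; rewrite inE xA.
    by exists (b x); rewrite ?inE ?arc_circle_partner // xA matchingK.
  by rewrite inE => /andP[yA _] ->.
have [sI|] := boolP (dotted_right_ends b I); first by rewrite AI; apply: z0.
rewrite negb_forall_in => /exists_inP[l0 l0I].
have /andP[l0A l0r] : (arc_circle b l0 \in A) && (b l0 < l0)%N by move: l0I; rewrite inE.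
rewrite l0r /= negb_forall => /existsP[p]; rewrite negb_imply negb_or => /andP[/andP[lp pl]].
move=> /andP[pI bpI].
have pA : arc_circle b p \notin A.
  apply/negP => pA; case: (ltngtP (b p) p) => [lt|gt|/ord_inj e].
  - by move: pI; rewrite inE pA lt.
  - by move: bpI; rewrite inE arc_circle_partner pA matchingK gt.
  by have := matching_neq b p; rewrite e eqxx.
pose ok (q : 'I_n.*2 * 'I_n.*2) := [&& arc_circle b q.1 \in A, arc_circle b q.2 \notin A,
   (b q.2 < q.2)%N, (b q.1 < b q.2)%N & (q.2 < q.1)%N].
(* [p] may be either end of the undotted arc, whereas [ok] names both arcs by their right ends;
   noncrossing puts the whole undotted arc beneath the dotted one. *)
have [q0 q0ok] : exists q, ok q.
  case: (ltngtP (b p) p) => [lt|gt|/ord_inj e].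
  - exists (l0, p); rewrite /ok /= l0A pA lt pl andbT /=.
    rewrite ltnNge leq_eqVlt negb_or; apply/andP; split.
      apply/eqP => /ord_inj /(can_inj (matchingK b)) e; by rewrite e ltnn in pl.
    apply/negP => bpl; apply: (@matching_noncrossing _ b (b p) (b l0)) => //; rewrite !matchingK //.
  - exists (l0, b p); rewrite /ok /= arc_circle_partner matchingK l0A pA gt lp /=.
    rewrite ltnNge leq_eqVlt negb_or; apply/andP; split.
      apply/eqP => /ord_inj e; by rewrite e matchingK ltnn in lp.
    apply/negP => bpl; apply: (@matching_noncrossing _ b (b l0) p) => //; rewrite !matchingK //.
  by have := matching_neq b p; rewrite e eqxx.
pose gap (q : 'I_n.*2 * 'I_n.*2) : nat := ((q.1 - q.2) + (b q.2 - b q.1))%N.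
have [[l k] /and5P[/= lA kA kr bl_bk kl] min_lk] : exists2 q, ok q & forall q', ok q' -> (gap q <= gap q')%N.
  by case: (arg_minnP gap q0ok) => q qok qmin; exists q.
apply: (@swap_vanishing b (b l) (b k) k l A); [exact: matchingK|exact: matchingK
  |exact: bl_bk|exact: kr|exact: kl|move=> x lx xk kbx bxl|exact: lA|exact: kA
  |by move=> a A' A'A; apply: IH; apply: leq_trans A'A Aw].
(* An arc between the two would give a pair of smaller gap: with [k] if it is dotted, with [l] if it
   is not. *)
have [xA|xA] := boolP (arc_circle b x \in A).
  have := min_lk (b x, k); rewrite /ok /gap /= arc_circle_partner matchingK xA kA kr xk kbx /=.
  by move=> /(_ isT); clear -lx xk kbx bxl; lia.
have := min_lk (l, b x); rewrite /ok /gap /= arc_circle_partner matchingK lA xA lx bxl andbT /=.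
rewrite (ltn_trans xk (ltn_trans kr kbx)) => /(_ isT); clear -lx xk kbx bxl; lia.
Qed.

Lemma compatible_eq0 : z = 0.
Proof.
apply: oh_at_inj => b a; rewrite raddf0.
have [<-|ba] := eqVneq b a; last exact: (zC.1 _ _ ba).
by apply/ffunP => A; rewrite [RHS]ffunE; apply: dotted_coef_eq0.
Qed.
End Vanishing.

(** * The isomorphism *)

Section OddCenterMap.
Variable n : nat.
Local Notation pt := 'I_n.*2.
Local Notation xprod := (ext_prod (@ohb_var n)).
Implicit Types (a b : matching n) (I J A : {set pt}) (y : ext pt).

Definition arc_map b a : ext pt -> ext (circles (glue b a)) := ext_map (circle_of (glue b a)).
HB.instance Definition _ b a := GRing.RMorphism.on (@arc_map b a).

Definition oh_of y : OH n := [ffun p => if p.1 == p.2 then arc_map p.1 p.2 y else 0].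

Lemma oh_at_of a y : oh_at a a (oh_of y) = arc_map a a y.
Proof. by rewrite /oh_at /oh_comp ffunE /= eqxx. Qed.

Lemma oh_of_diagonal y : oh_diagonal (oh_of y).
Proof. by move=> b a /negbTE ba; rewrite /oh_at /oh_comp ffunE /= ba. Qed.

Lemma oh_of_is_additive : zmod_morphism oh_of.
Proof.
move=> x y; apply: oh_at_inj => b a; rewrite raddfB /=.
have [<-|ba] := eqVneq b a; first by rewrite !oh_at_of (raddfB (arc_map b b)).
by rewrite !oh_of_diagonal // subr0.
Qed.
HB.instance Definition _ := GRing.isZmodMorphism.Build (ext pt) (OH n) oh_of oh_of_is_additive.

Lemma merge_map_arc_map d b a y : d = b \/ d = a ->
  merge_map b a (arc_map d d y) = arc_map b a y.
Proof.
move=> dba; apply: etrans (ext_map_comp _ _ _) _; apply: eq_ext_map => i.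
exact: merge_map_circle.
Qed.

Lemma oh_of_compatible y : compatible (oh_of y).
Proof.
split=> [|b a]; first exact: oh_of_diagonal.
by rewrite !oh_at_of !merge_map_arc_map; [| right | left].
Qed.

Lemma OI_kernel u : OI u -> oh_of (opol_ext u) = 0.
Proof.
elim=> [|{}u v _ IHu _ IHv|c g [k [S [r [_ cS /andP[kr _] ->]]]]].
- by rewrite (raddf0 (@opol_ext n.*2)) raddf0.
- by rewrite (raddfD (@opol_ext n.*2)) raddfD /= IHu IHv addr0.
apply: oh_at_inj => b a; rewrite raddf0.
have [<-|ba] := eqVneq b a; last exact: oh_of_diagonal.
rewrite oh_at_of (rmorphM (@opol_ext n.*2)) (rmorphM (arc_map b b)) /=.
have -> : arc_map b b (opol_ext (odd_elem (@opol_var n.*2) r S)) = 0; last by rewrite mulr0.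
have -> : opol_ext (odd_elem (@opol_var n.*2) r S) = odd_elem (@ext_gen pt) r S.
  apply: etrans (rmorph_odd_elem (@opol_ext n.*2) _ _ _) _; apply: eq_odd_elem => i.
  exact: opol_ext_var.
apply: etrans (rmorph_odd_elem (arc_map b b) _ _ _) _.
rewrite (eq_odd_elem (x' := arc_gen b)) => [|i]; last exact: ext_map_gen.
by apply: odd_elem_arc_gen cS _; rewrite -addn1.
Qed.

Definition ohb_to_oh (x : OHB n) : OH n := oh_of (opol_ext (repr x)).

Lemma ohb_to_oh_proj u : ohb_to_oh (ohb_proj u) = oh_of (opol_ext u).
Proof.
apply/eqP; rewrite -subr_eq0 /ohb_to_oh -raddfB -(raddfB (@opol_ext n.*2)).
by apply/eqP/OI_kernel/(quot_projP (springer_ideal n)); rewrite quot_reprK.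
Qed.

Lemma ohb_to_oh_is_additive : zmod_morphism ohb_to_oh.
Proof.
move=> x y; have [u ->] := ohb_projP x; have [v ->] := ohb_projP y.
rewrite -(raddfB (@ohb_proj n)) !ohb_to_oh_proj (raddfB (@opol_ext n.*2)).
exact: raddfB.
Qed.
HB.instance Definition _ :=
  GRing.isZmodMorphism.Build (OHB n) (OH n) ohb_to_oh ohb_to_oh_is_additive.

Lemma ohb_to_oh_lift y : ohb_to_oh (ext_lift (@ohb_var n) y) = oh_of y.
Proof.
pose u : OPol n.*2 := \sum_(A : {set pt}) ext_prod (@opol_var n.*2) A *~ y A.
have eu : opol_ext u = y.
  rewrite /u (raddf_sum (@opol_ext n.*2)) [RHS]ext_sum_delta; apply: eq_bigr => A _.
  rewrite (raddfMz (@opol_ext n.*2)) -ext_prod_gen /ext_prod; congr (_ *~ _).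
  apply: etrans (big_morph _ (rmorphM (@opol_ext n.*2)) (rmorph1 (@opol_ext n.*2)) _ _ _) _.
  by apply: eq_bigr => i _; apply: opol_ext_var.
by rewrite -[in LHS]eu -ohb_proj_ext ohb_to_oh_proj eu.
Qed.

Lemma ohb_lift (x : OHB n) : exists y, x = ext_lift (@ohb_var n) y.
Proof. by have [u ->] := ohb_projP x; exists (opol_ext u); apply: ohb_proj_ext. Qed.

(** * Triangularity and bijectivity onto compatible families *)

Lemma ohb_to_oh_prod A : ohb_to_oh (xprod A) = oh_of (ext_delta A).
Proof. by rewrite -ohb_to_oh_lift ext_lift_delta. Qed.

Lemma std_span_all (x : OHB n) : std_span x.
Proof.
have [y ->] := ohb_lift x; rewrite /ext_lift.
elim/big_ind: _ => [|u v|A _]; [exact: std_span0|exact: std_spanD|].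
exact/std_spanMz/std_span_prod.
Qed.

(** For compatible families, whether this vanishes does not depend on the matching picked, since [I]
    determines the dotted arcs. The default 0 occurs only when [I] is not standard. *)
Definition leading_coef I (z : OH n) : int :=
  if [pick a : matching n | dotted_right_ends a I] is Some a
  then dotted_coef z (right_end_circles a I) else 0.

Lemma leading_coef_is_additive I : zmod_morphism (leading_coef I).
Proof.
move=> x y; rewrite /leading_coef; case: pickP => [a _|_]; last by rewrite subr0.
by rewrite /dotted_coef raddfB !ffunE.
Qed.
HB.instance Definition _ I :=
  GRing.isZmodMorphism.Build (OH n) int (leading_coef I) (leading_coef_is_additive I).

Lemma leading_coef_standard I (z : OH n) : standard I ->
  exists2 a, dotted_right_ends a I & leading_coef I z = dotted_coef z (right_end_circles a I).
Proof.
rewrite /leading_coef; case: pickP => [a aI _|nI /existsP[a]]; first by exists a.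
by rewrite nI.
Qed.

Lemma arc_circle_inj a I : dotted_right_ends a I -> {in I &, injective (arc_circle a)}.
Proof.
move=> /dotted_right_endsP aI i j iI jI /arc_circle_eq /orP[/eqP //|/eqP ji].
by have [] := aI _ iI; have [] := aI _ jI; rewrite ji matchingK => lt _ gt; move: (ltn_trans lt gt); rewrite ltnn.
Qed.

(** The coefficient is a sign; this form leaves it unnamed and makes it its own inverse. *)
Lemma leading_coef_diag I : standard I ->
  leading_coef I (oh_of (ext_delta I)) * leading_coef I (oh_of (ext_delta I)) = 1.
Proof.
move=> /(leading_coef_standard (oh_of (ext_delta I)))[a aI ->].
rewrite /dotted_coef oh_at_of /arc_map ext_mapE ext_lift_delta.
have [s ->] := ext_prod_map_inj (arc_circle_inj aI).
by rewrite ffunMzE ext_deltaE eqxx intz -expr2 sqrr_sign.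
Qed.

(** A nonzero coefficient means that [J] picks one end of each dotted arc, whereas [I] picks all the
    right ends. *)
Lemma leading_coef_triangular I J : standard I -> J != I ->
  leading_coef I (oh_of (ext_delta J)) != 0 -> (index_sum J < index_sum I)%N.
Proof.
move=> /(leading_coef_standard (oh_of (ext_delta J)))[a aI ->] JI.
rewrite /dotted_coef oh_at_of /arc_map ext_mapE ext_lift_delta.
have [/forall_inP Jinj|] := boolP
  [forall t in J, forall u in J, (arc_circle a t == arc_circle a u) ==> (t == u)]; last first.
  rewrite negb_forall_in => /exists_inP[t tJ].
  rewrite negb_forall_in => /exists_inP[u uJ]; rewrite negb_imply => /andP[/eqP tu ntu].
  by rewrite (ext_prod_map_noninj tJ uJ ntu tu) ffunE.
have inj : {in J &, injective (arc_circle a)}.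
  by move=> t u tJ uJ /eqP tu; have /forall_inP/(_ u uJ) := Jinj t tJ; rewrite tu => /eqP.
have [s ->] := ext_prod_map_inj inj.
rewrite ffunMzE ext_deltaE; case: (right_end_circles a I =P _) => [eIJ _|_]; last by rewrite mul0rz.
have /dotted_right_endsP aP := aI.
have cmp j i : i \in I -> arc_circle a j = arc_circle a i -> j != i -> (j < i)%N.
  move=> iI /esym /arc_circle_eq /orP[] /eqP -> //; first by rewrite eqxx.
  by have [] := aP i iI.
apply: (sum_weight_lt inj (esym eIJ)) => [j i jJ iI e|].
  by have [->//|/(cmp _ _ iI e)/ltnW] := eqVneq j i.
have cIJ : #|I| = #|J|.
  by rewrite -(card_in_imset inj) -(card_in_imset (arc_circle_inj aI)) -eIJ.
have [j jJ jI] : exists2 j, j \in J & j \notin I.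
  by apply/subsetPn; apply: contra JI => sub; rewrite eqEcard sub cIJ leqnn.
exists j => // i iI e; apply: cmp e _ => //.
by apply: contraNneq jI => ->.
Qed.

(** In a linear relation among standard monomials, the leading coefficient at [I] involves, besides
    that of [I], only monomials of smaller index sum; so the coefficients vanish in order of index
    sum. *)
Lemma ohb_to_oh_inj : injective ohb_to_oh.
Proof.
apply: raddf_inj => x; have [c ->] := std_span_all x => h0.
suff c0 I : standard I -> c I = 0 by apply: big1 => I /c0 ->; rewrite mulr0z.
have [m] := ubnP (index_sum I); elim: m I => // m IH I Im sI.
have := congr1 (leading_coef I) h0; rewrite raddf0 !raddf_sum (bigD1 I) //= big1 ?addr0.
  rewrite !raddfMz /= ohb_to_oh_prod -mulrzr intz => e0.
  have := leading_coef_diag sI; move: e0; set u := leading_coef _ _ => e0 uu.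
  by rewrite -[c I]mul1r -uu -mulrA e0 mulr0.
move=> J /andP[sJ JI]; rewrite !raddfMz /= ohb_to_oh_prod.
have [-> |/(leading_coef_triangular sI JI) JIlt] := eqVneq (leading_coef I (oh_of (ext_delta J))) 0.
  by rewrite mul0rz.
by rewrite (IH J) ?mulr0z //; apply: leq_trans JIlt Im.
Qed.

Lemma compatible_image (z : OH n) : compatible z -> exists x, ohb_to_oh x = z.
Proof.
(* [m] is the index sum being treated: below it the leading coefficients are already zero, and at
   most [k] values remain. *)
suff H k m (u : OH n) : (index_sum [set: pt] < m + k)%N -> compatible u ->
    (forall I, standard I -> (index_sum I < m)%N -> leading_coef I u = 0) ->
    exists x, ohb_to_oh x = u.
  by move=> zC; apply: (H (index_sum [set: pt]).+1 0%N).
elim: k m u => [|k IH] m u mk uC u0.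
  (* No value remains. [compatible_eq0] asks about an arbitrary matching [a], the hypothesis about
     the picked one, hence the transfer. *)
  exists 0; rewrite raddf0; apply/esym/compatible_eq0 => // a I aI.
  have sI : standard I by apply/existsP; exists a.
  have [a' a'I e] := leading_coef_standard u sI.
  apply: (right_end_circles_transfer uC (dotted_right_ends_unique a'I aI)).
  by rewrite -e u0 //; apply: leq_ltn_trans (index_sum_le I) _; rewrite addn0 in mk.
pose d I := leading_coef I (oh_of (ext_delta I)).
(* Since [d I] is its own inverse, [x1] reproduces the leading coefficients of [u] at index sum [m];
   by triangularity it leaves those below [m] equal to zero. *)
pose x1 := \sum_(I | standard I && (index_sum I == m)) xprod I *~ (d I * leading_coef I u).
have lead1 J : standard J -> (index_sum J <= m)%N ->
    leading_coef J (ohb_to_oh x1) = if index_sum J == m then leading_coef J u else 0.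
  move=> sJ Jm; rewrite !raddf_sum /=; case: eqP => [eJ|nJ]; last first.
    apply: big1 => I /andP[sI /eqP Im]; rewrite !raddfMz /= ohb_to_oh_prod.
    have IJ : I != J by apply/eqP => e; apply: nJ; rewrite -e.
    have [->|/(leading_coef_triangular sJ IJ)] := eqVneq (leading_coef J (oh_of (ext_delta I))) 0.
      by rewrite mul0rz.
    by rewrite Im ltnNge Jm.
  rewrite (bigD1 J) /=; last by rewrite sJ eJ eqxx.
  rewrite big1 ?addr0.
    by rewrite !raddfMz /= ohb_to_oh_prod -mulrzr intz mulrA leading_coef_diag // mul1r.
  move=> I /andP[/andP[sI /eqP Im] IJ]; rewrite !raddfMz /= ohb_to_oh_prod.
  have [->|/(leading_coef_triangular sJ IJ)] := eqVneq (leading_coef J (oh_of (ext_delta I))) 0.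
    by rewrite mul0rz.
  by rewrite Im eJ ltnn.
have [||J sJ Jm|x2 e2] := IH m.+1 (u - ohb_to_oh x1).
- by rewrite addSnnS.
- by apply: compatibleB; [exact: uC|apply: oh_of_compatible].
- rewrite raddfB /= lead1 //; case: eqP => [_|/eqP nJ]; first by rewrite subrr.
  by rewrite subr0; apply: u0 => //; rewrite ltn_neqAle nJ.
by exists (x1 + x2); rewrite raddfD /= e2 addrC subrK.
Qed.

Lemma ohb_to_oh_parity_part (p : bool) y : ext_parity p y -> oh_parity p (oh_of y).
Proof.
move=> py b a; have [<-|ba] := eqVneq b a => A; last first.
  by rewrite -/(oh_at b a (oh_of y)) oh_of_diagonal // ffunE.
by rewrite -/(oh_at b b (oh_of y)) oh_at_of; apply: ext_map_parity.
Qed.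

Definition ext_trunc (P : pred nat) y : ext pt := [ffun A : {set pt} => if P #|A| then y A else 0].

Lemma ext_truncC P y : y = ext_trunc P y + ext_trunc (predC P) y.
Proof. by apply/ffunP => A; rewrite !ffunE /=; case: (P _); rewrite ?addr0 ?add0r. Qed.

Lemma odd_center_image (C : choices n) (z : OH n) :
  odd_center C z <-> exists x, ohb_to_oh x = z.
Proof.
split=> [/odd_center_compatible /compatible_image //|[x <-]].
have [y ->] := ohb_lift x; rewrite ohb_to_oh_lift.
exists (oh_of (ext_trunc (predC odd) y)), (oh_of (ext_trunc odd y)).
split.
- by rewrite -raddfD addrC -ext_truncC.
- apply: compatible_supercentral; first exact: oh_of_compatible.
  apply: ohb_to_oh_parity_part => A; rewrite ffunE /=.
  by case: (odd #|A|); rewrite ?eqxx.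
apply: compatible_supercentral; first exact: oh_of_compatible.
apply: ohb_to_oh_parity_part => A; rewrite ffunE /=.
by case: (odd #|A|); rewrite ?eqxx.
Qed.

Lemma ohb_to_ohM (C : choices n) (x y : OHB n) :
  ohb_to_oh (x * y) = oh_mul C (ohb_to_oh x) (ohb_to_oh y).
Proof.
have [u ->] := ohb_projP x; have [v ->] := ohb_projP y.
have -> : ohb_proj u * ohb_proj v = ohb_proj (u * v) by rewrite rmorphM.
rewrite !ohb_to_oh_proj; apply: oh_at_inj => b a.
rewrite (oh_mul_diagl _ _ _ _ (oh_of_diagonal (opol_ext u))).
have [<-|ba] := eqVneq b a; last by rewrite !(oh_of_diagonal _ ba) mulr0.
rewrite merge_map_id !oh_at_of (rmorphM (@opol_ext n.*2)).
exact: (rmorphM (arc_map b b)).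
Qed.

Lemma oh_of_diag y : oh_of y = \sum_a oh_diag a (fun p => arc_map p.1 p.2 y).
Proof.
apply: oh_at_inj => b a; rewrite raddf_sum.
have [<-|ba] := eqVneq b a.
  rewrite oh_at_of (bigD1 b) //= oh_at_diag big1 ?addr0 // => c cb.
  by apply: oh_at_diag0; rewrite xpair_eqE negb_and eq_sym cb.
rewrite oh_of_diagonal // big1 // => c _; apply: oh_at_diag0.
by rewrite xpair_eqE negb_and; case: (eqVneq b c) => // <-; rewrite eq_sym ba.
Qed.

Lemma eq_oh_diag a F F' : (forall p, F p = F' p) -> oh_diag a F = oh_diag (n := n) a F'.
Proof. by move=> FF; apply/ffunP => p; rewrite !ffunE FF. Qed.

Lemma ohb_to_oh1 : ohb_to_oh 1 = oh_one n.
Proof.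
have -> : (1 : OHB n) = ohb_proj 1 by rewrite rmorph1.
rewrite ohb_to_oh_proj (rmorph1 (@opol_ext n.*2)) oh_of_diag; apply: eq_bigr => a _.
by apply: eq_oh_diag => p; apply: (rmorph1 (arc_map p.1 p.2)).
Qed.

Lemma ohb_to_oh_var i : ohb_to_oh (ohb_var i) = \sum_a oh_circle a i.
Proof.
rewrite /ohb_var ohb_to_oh_proj opol_ext_var oh_of_diag; apply: eq_bigr => a _.
by apply: eq_oh_diag => p; apply: ext_map_gen.
Qed.

(** Hence the two shifts in the degree cancel on the diagonal, and a wedge of k circles has degree
    2k. The circles are counted by the right ends of the arcs. *)
Lemma card_circles_diag a : #|circles (glue a a)| = n.
Proof.
pose R := [set i | (a i < i)%N].
have inj : {in R &, injective (arc_circle a)}.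
  move=> i j; rewrite !inE => iR jR /arc_circle_eq /orP[/eqP //|/eqP ji].
  by move: jR; rewrite ji matchingK => lt; move: (ltn_trans iR lt); rewrite ltnn.
have -> : #|circles (glue a a)| = #|R|.
  rewrite -(card_in_imset inj) -cardsT; apply: eq_card => c.
  rewrite inE; have [i ->] := arc_circleP c; apply/esym/imsetP.
  case: (ltngtP (a i) i) => [lt|gt|/ord_inj e]; last by have := matching_neq a i; rewrite e eqxx.
    by exists i; rewrite ?inE.
  by exists (a i); rewrite ?inE ?matchingK // arc_circle_partner.
have cR : #|~: R| = #|R|.
  rewrite -(card_imset R (can_inj (matchingK a))); apply: eq_card => i.
  rewrite !inE -leqNgt; apply/idP/imsetP => [iai|[j jR ->]].
    exists (a i); rewrite ?inE matchingK // ltn_neqAle iai andbT.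
    by apply: contra (matching_neq a i) => /eqP/ord_inj <-.
  by rewrite matchingK ltnW //; move: jR; rewrite inE.
by have := cardsC R; rewrite cR card_ord addnn => /double_inj.
Qed.

Lemma ext_map_support (T U : finType) (f : T -> U) (x : ext T) B :
  ext_map f x B != 0 -> exists2 A : {set T}, #|A| = #|B| & x A != 0.
Proof.
have [s ->] := ext_map_coef f x B => nz; apply: contrapT => nA; case/eqP: nz.
apply: big1 => A /andP[_ /eqP cA].
by have [->|xA] := eqVneq (x A) 0; [rewrite mul0r | case: nA; exists A].
Qed.

(** Treats degree and parity together: [P] singles out one degree or one parity. *)
Lemma ohb_to_oh_graded (P : pred nat) (x : OHB n) :
  (exists f : free_alg n.*2, x = ohb_proj (opol_proj f) /\ forall w, f@_w != 0 -> P (fdeg w)) <->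
  forall a (B : {set circles (glue a a)}), oh_at a a (ohb_to_oh x) B != 0 -> P #|B|.
Proof.
split=> [[f [-> fP]] a B|xP].
  rewrite ohb_to_oh_proj opol_ext_proj oh_at_of => /ext_map_support[A <-].
  rewrite /free_ext mmapE sum_ffunE => nz.
  have [w fw wA] : exists2 w, f@_w != 0 & word_ext w A != 0.
    apply: contrapT => nw; case/eqP: nz; apply: big1 => w _ /=.
    have [->|fw] := eqVneq (f@_w) 0; first by rewrite mulr0z mul0r ffunE.
    rewrite mulrzl ffunMzE; have [->|wA] := eqVneq (word_ext w A) 0; first by rewrite mul0rz.
    by case: nw; exists w.
  by rewrite (word_ext_coef wA); apply: fP.
(* Truncating a lift of [x] to the sizes in [P] does not change its image, so by injectivity the
   truncation is still a lift of [x]; listing its subsets as words gives the polynomial. *)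
have [y ey] := ohb_lift x; pose y' := ext_trunc P y.
have exy' : x = ext_lift (@ohb_var n) y'.
  apply: ohb_to_oh_inj; rewrite ohb_to_oh_lift ey ohb_to_oh_lift.
  apply: oh_at_inj => b a; have [<-|ba] := eqVneq b a; last by rewrite !(oh_of_diagonal _ ba).
  apply/ffunP => B; rewrite !oh_at_of.
  have y'0 : ~~ P #|B| -> arc_map b b y' B = 0.
    move=> nP; apply/eqP/negPn/negP => /ext_map_support[A cA].
    by rewrite ffunE cA (negbTE nP) eqxx.
  have [PB|nPB] := boolP (P #|B|); last first.
    rewrite y'0 //; apply/eqP/negPn/negP => nz; case/negP: nPB; apply: (xP b).
    by rewrite ey ohb_to_oh_lift oh_at_of.
  rewrite [in LHS](ext_truncC P y) (raddfD (arc_map b b)) ffunE.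
  have -> : arc_map b b (ext_trunc (predC P) y) B = 0; last by rewrite addr0.
  by apply/eqP/negPn/negP => /ext_map_support[A cA]; rewrite ffunE /= cA PB eqxx.
exists (\sum_(A : {set pt}) << y' A *g set_word A >>); split.
  rewrite exy' ohb_proj_free; congr (ext_lift _ _).
  rewrite (raddf_sum (@free_ext n.*2)) [LHS]ext_sum_delta; apply: eq_bigr => A _ /=.
  by rewrite /free_ext mmapU /= mulrzl -ext_prod_gen.
move=> w; rewrite raddf_sum => nz.
have [A [yA <-]] : exists A, y' A != 0 /\ set_word A = w.
  apply: contrapT => nA; case/eqP: nz; apply: big1 => A _ /=; rewrite mcoeffU.
  have [->|yA] := eqVneq (y' A) 0; first by rewrite mul0rn.
  by case: eqP => [e|_]; [case: nA; exists A | rewrite mulr0n].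
by rewrite fdeg_set_word; move: yA; rewrite ffunE; case: (P _); rewrite ?eqxx.
Qed.

Lemma ohb_to_oh_degree d (x : OHB n) : ohb_degree d x <-> oh_degree d (ohb_to_oh x).
Proof.
have [H1 H2] := ohb_to_oh_graded (fun k => k.*2 == d) x; split=> [[f [ex fd]]|xd].
  have {}H1 := H1 (ex_intro _ f (conj ex (fun w fw => introT eqP (fd w fw)))).
  move=> b a; have [<-|ba] := eqVneq b a => A; last first.
    by rewrite -/(oh_at b a (ohb_to_oh x)) (oh_of_diagonal _ ba) ffunE.
  rewrite -/(oh_at b b (ohb_to_oh x)).
  by move=> /H1 /eqP <-; rewrite card_circles_diag subrK.
have [|f [ex fd]] := H2.
  move=> a B /xd /=; rewrite card_circles_diag subrK => -[->]; exact: eqxx.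
by exists f; split=> // w /fd /eqP.
Qed.

Lemma ohb_to_oh_parity p (x : OHB n) : ohb_parity p x <-> oh_parity p (ohb_to_oh x).
Proof.
have [H1 H2] := ohb_to_oh_graded (fun k => odd k == p) x; split=> [[f [ex fp]]|xp].
  have {}H1 := H1 (ex_intro _ f (conj ex (fun w fw => introT eqP (fp w fw)))).
  move=> b a; have [<-|ba] := eqVneq b a => A; last first.
    by rewrite -/(oh_at b a (ohb_to_oh x)) (oh_of_diagonal _ ba) ffunE.
  rewrite -/(oh_at b b (ohb_to_oh x)).
  by move=> /H1 /eqP.
have [|f [ex fp]] := H2; first by move=> a B /xp ->.
by exists f; split=> // w /fp /eqP.
Qed.
End OddCenterMap.

Theorem theorem4p1 (n : nat) (C : choices n) :
  exists h : {additive OHB n -> OH n},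
    [/\ h 1 = oh_one n,
        forall x y : OHB n, h (x * y) = oh_mul C (h x) (h y),
        injective h
      & forall z : OH n, odd_center C z <-> exists x : OHB n, h x = z] /\
    [/\ forall (d : nat) (x : OHB n), ohb_degree d x <-> oh_degree d (h x),
        forall (p : bool) (x : OHB n), ohb_parity p x <-> oh_parity p (h x)
      & forall i : 'I_n.*2, h (ohb_var i) = \sum_(a : matching n) oh_circle a i].
Proof.
exists (@ohb_to_oh n); split; split.
- exact: ohb_to_oh1.
- exact: ohb_to_ohM.
- exact: ohb_to_oh_inj.
- exact: odd_center_image.
- exact: ohb_to_oh_degree.
- exact: ohb_to_oh_parity.
exact: ohb_to_oh_var.
Qed.
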